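(* Any smooth strictly saddle surface in $\mathbb R^3$ is locally metric-minimizing. That is, if $\Sigma$ is a smooth surface in $\mathbb R^3$ whose principal curvatures have opposite signs at each interior point, then every interior point $p$ of $\Sigma$ has a neighborhood in $\Sigma$ that is parametrized by a metric-minimizing disc $s\colon\mathbb D\to\mathbb R^3$.
   Context: $\mathbb D$ is the closed disc, with boundary $\partial\mathbb D=\mathbb S^1$. (Pseudo)metrics are allowed to take the value $\infty$. A map is short if it is distance-nonincreasing. A smooth surface in $\mathbb R^3$ is strictly saddle if its principal curvatures at each interior point have opposite signs. For a continuous map $s\colon\mathbb D\to Y$ to a metric space (here $Y=\mathbb R^3$) define the length pseudometric on $\mathbb D$ by $\langle x-y\rangle_s=\inf_\alpha \mathrm{length}(s\circ\alpha)$, the infimum over all paths $\alpha$ in $\mathbb D$ from $x$ to $y$. Identifying points at pseudodistance $0$ gives a metric space $\langle\mathbb D\rangle_s$, with projection $\hat\pi_s\colon\mathbb D\to\langle\mathbb D\rangle_s$. Put $\delta_s=\hat\pi_s|_{\mathbb S^1}$. Let $s,s'\colon\mathbb D\to Y$ be continuous maps with $s|_{\mathbb S^1}=s'|_{\mathbb S^1}$. Write $s\succcurlyeq s'$ if there is a majorization $\mu\colon\langle\mathbb D\rangle_s\to\langle\mathbb D\rangle_{s'}$, i.e. a short map with $\delta_{s'}=\mu\circ\delta_s$. A continuous map $s\colon\mathbb D\to Y$ is a metric-minimizing disc if $\delta_s$ is rectifiable and, whenever $s\succcurlyeq s'$, the corresponding majorization $\mu$ is distance-preserving. *)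

(* Defs.v *)
From HB Require Import structures.
From mathcomp Require Import all_boot all_order all_algebra generic_quotient.
From mathcomp Require Import all_classical all_reals all_analysis.
From mathcomp Require Import ring lra.

Set Implicit Arguments.
Unset Strict Implicit.
Unset Printing Implicit Defensive.
Import Order.TTheory GRing.Theory Num.Theory.
Import numFieldNormedType.Exports.
Local Open Scope classical_set_scope.
Local Open Scope ring_scope.
Local Open Scope quotient_scope.

(* The library norm on row vectors is the sup norm; it is only used for the
   topology and for derivatives. Lengths use the Euclidean norm below. *)
Section euclidean.
Context {R : realType}.

Definition enorm n (x : 'rV[R]_n) : R := Num.sqrt (\sum_i x 0 i ^+ 2).

Definition edist n (x y : 'rV[R]_n) : \bar R := (enorm (x - y))%:E.

Lemma sum_sqr_ge0 n (x : 'rV[R]_n) : 0 <= \sum_i x 0 i ^+ 2.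
Proof. by apply: sumr_ge0 => i _; exact: sqr_ge0. Qed.

Lemma enorm_ge0 n (x : 'rV[R]_n) : 0 <= enorm x.
Proof. exact: sqrtr_ge0. Qed.

Lemma sqr_enorm n (x : 'rV[R]_n) : enorm x ^+ 2 = \sum_i x 0 i ^+ 2.
Proof. by rewrite sqr_sqrtr// sum_sqr_ge0. Qed.

Lemma enorm0 n : enorm (0 : 'rV[R]_n) = 0.
Proof. by rewrite /enorm big1 ?sqrtr0// => i _; rewrite mxE expr0n. Qed.

Lemma enorm0_eq0 n (x : 'rV[R]_n) : enorm x = 0 -> x = 0.
Proof.
move=> x0; have := sqr_enorm x; rewrite x0 expr0n/= => /esym/eqP.
rewrite psumr_eq0; last by move=> i _; exact: sqr_ge0.
move=> /allP h; apply/rowP => i; rewrite mxE.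
by have := h i (mem_index_enum i); rewrite sqrf_eq0 => /eqP.
Qed.

Lemma enormN n (x : 'rV[R]_n) : enorm (- x) = enorm x.
Proof. by congr Num.sqrt; apply: eq_bigr => i _; rewrite mxE sqrrN. Qed.

Lemma cauchy_schwarz n (x y : 'rV[R]_n) :
  \sum_i x 0 i * y 0 i <= enorm x * enorm y.
Proof.
have [x0|x0] := eqVneq (enorm x) 0.
  by rewrite x0 mul0r big1// => i _; rewrite (enorm0_eq0 x0) mxE mul0r.
have [y0|y0] := eqVneq (enorm y) 0.
  by rewrite y0 mulr0 big1// => i _; rewrite (enorm0_eq0 y0) mxE mulr0.
have xp : 0 < enorm x by rewrite lt_neqAle eq_sym x0 enorm_ge0.
have yp : 0 < enorm y by rewrite lt_neqAle eq_sym y0 enorm_ge0.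
have : 0 <= \sum_i (enorm y * x 0 i - enorm x * y 0 i) ^+ 2.
  by apply: sumr_ge0 => i _; exact: sqr_ge0.
rewrite (_ : \sum_i _ = enorm y ^+ 2 * (\sum_i x 0 i ^+ 2)
   - 2 * enorm x * enorm y * (\sum_i x 0 i * y 0 i)
   + enorm x ^+ 2 * (\sum_i y 0 i ^+ 2)); last first.
  rewrite !mulr_sumr -sumrB -big_split/=; apply: eq_bigr => i _; ring.
rewrite -!sqr_enorm => h.
have hp : 0 < enorm x * enorm y by rewrite mulr_gt0.
rewrite -(ler_pM2l hp); nra.
Qed.

Lemma ler_enormD n (x y : 'rV[R]_n) : enorm (x + y) <= enorm x + enorm y.
Proof.
rewrite -(@ler_pXn2r _ 2)// ?nnegrE ?addr_ge0 ?enorm_ge0//.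
rewrite sqr_enorm (_ : \sum_i _ = (\sum_i x 0 i ^+ 2)
   + 2 * (\sum_i x 0 i * y 0 i) + \sum_i y 0 i ^+ 2); last first.
  rewrite !mulr_sumr -!big_split/=; apply: eq_bigr => i _; rewrite mxE; ring.
rewrite -!sqr_enorm; have := cauchy_schwarz x y; nra.
Qed.

Lemma edist_ge0 n (x y : 'rV[R]_n) : (0 <= edist x y)%E.
Proof. by rewrite lee_fin enorm_ge0. Qed.

Lemma edistxx n (x : 'rV[R]_n) : edist x x = 0%E.
Proof. by rewrite /edist subrr enorm0. Qed.

Lemma edistC n (x y : 'rV[R]_n) : edist x y = edist y x.
Proof. by rewrite /edist -enormN opprB. Qed.

Lemma edist_triangle n (y x z : 'rV[R]_n) :
  (edist x z <= edist x y + edist y z)%E.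
Proof. by rewrite -EFinD lee_fin -(subrKA y) ler_enormD. Qed.

End euclidean.
Arguments edist {R n} x y.

Section curve_length.
Context {R : realType} {Y : Type}.

Definition partition_sums (d : Y -> Y -> \bar R) (a b : R) (g : R -> Y) :
    set (\bar R) :=
  [set l | exists n (t : nat -> R),
    [/\ {homo t : i j / (i <= j)%N >-> i <= j}, t 0%N = a, t n = b &
        l = (\sum_(i < n) d (g (t i)) (g (t i.+1)))%E]].

Definition curve_length (d : Y -> Y -> \bar R) (a b : R) (g : R -> Y) :
    \bar R :=
  ereal_sup (partition_sums d a b g).

Context (d : Y -> Y -> \bar R) (d0 : forall x, d x x = 0%E).

Lemma curve_length_ge0 a b g : (forall x y, (0 <= d x y)%E) -> a <= b ->
  (0 <= curve_length d a b g)%E.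
Proof.
move=> d_ge0 ab; apply: le_trans (ereal_sup_ubound _); last first.
  exists 1%N, (fun i => if i is 0%N then a else b); split => //.
  by move=> [|i] [|j].
by rewrite big_ord_recl big_ord0 adde0.
Qed.

Lemma curve_length_cst a b y : (curve_length d a b (cst y) <= 0)%E.
Proof.
apply: ge_ereal_sup => _ [n [t [_ _ _ ->]]].
by rewrite big1// => i _; rewrite /cst d0.
Qed.

Lemma curve_length_rev g : (forall x y, d x y = d y x) ->
  (curve_length d 0 1 (fun t => g (1 - t)%R) <= curve_length d 0 1 g)%E.
Proof.
move=> dC; apply: ge_ereal_sup => _ [n [t [tm t0 tn ->]]].
apply: ereal_sup_ubound; exists n, (fun i => 1 - t (n - i)%N); split.
- by move=> i j ij; rewrite lerD2l lerN2 tm// leq_sub2l.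
- by rewrite subn0 tn subrr.
- by rewrite subnn t0 subr0.
- rewrite (reindex_inj rev_ord_inj)/=; apply: eq_bigr => i _.
  by rewrite dC subnSK.
Qed.

Lemma curve_length_cat (f g : R -> Y) : (forall x y, (0 <= d x y)%E) ->
  (forall y x z, (d x z <= d x y + d y z)%E) -> f 1 = g 0 ->
  (curve_length d 0 1 (fun t => if (t <= 2^-1)%R then f (2 * t)%R else g (2 * t - 1)%R)
   <= curve_length d 0 1 f + curve_length d 0 1 g)%E.
Proof.
move=> d_ge0 dD fg; apply: ge_ereal_sup => _ [n [t [tm t0 tn ->]]].
pose u i := 2 * Num.min (t i) 2^-1; pose v i := 2 * Num.max (t i) 2^-1 - 1.
apply: (@le_trans _ _ (\sum_(i < n) d (f (u i)) (f (u i.+1)) +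
                       \sum_(i < n) d (g (v i)) (g (v i.+1)))%E); last first.
  apply: leeD; apply: ereal_sup_ubound.
    exists n, u; split => //.
    - move=> i j /tm ij; rewrite /u ler_pM2l// le_min !ge_min ij lexx/= orbT//.
    - by rewrite /u t0 min_l ?mulr0// invr_ge0.
    - by rewrite /u tn min_r ?divff//; lra.
  exists n, v; split => //.
  - move=> i j /tm ij; rewrite /v lerD2r ler_pM2l// ge_max !le_max ij lexx/= orbT//.
  - by rewrite /v t0 max_r ?divff ?subrr// invr_ge0.
  - by rewrite /v tn max_l; lra.
rewrite -big_split/=; apply: lee_sum => i _.
rewrite /u /v; have := tm i i.+1 (leqnSn i).
have h1 : 2 * 2^-1 = 1 :> R by rewrite divff.
case: (leP (t i) 2^-1) => hi; case: (leP (t i.+1) 2^-1) => hj ij.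
- by rewrite h1 subrr d0 adde0.
- by rewrite h1 subrr -fg dD.
- by have := lt_le_trans hi (le_trans ij hj); rewrite ltxx.
- by rewrite h1 d0 add0e.
Qed.

End curve_length.

Lemma within_continuous_reparam {R : realType} {T : topologicalType}
    (A B : set R) (h : R -> R) (f g : R -> T) : continuous h ->
  (forall t, A t -> B (h t)) -> (forall t, A t -> f (h t) = g t) ->
  {within B, continuous f} -> {within A, continuous g}.
Proof.
move=> ch hAB fg /subspace_continuousP cf; apply/subspace_continuousP => t At.
rewrite /from_subspace -(fg _ At); apply: cvg_trans (_ : f (h r) @[r --> within A (nbhs t)] --> _).
  by apply: fmap_within_eq => r /set_mem/fg.
apply: cvg_comp (cf _ (hAB _ At)).
move=> U BU; change (\forall r \near t, A r -> U (h r)).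
have : \forall r \near t, B (h r) -> U (h r) by exact: (ch t _ BU).
by apply: filterS => r hr Ar; apply: hr; exact: hAB.
Qed.

Section disc.
Context (R : realType).

Definition disc : Type := [set x : 'rV[R]_2 | enorm x <= 1].
HB.instance Definition _ := Topological.on disc.

Definition circle : Type := [set x : disc | enorm (val x) = 1].

Let trig (t : R) : 'rV[R]_2 := \row_(i < 2) (if i == 0 then cos t else sin t).

Lemma enorm_trig t : enorm (trig t) = 1.
Proof.
by rewrite /enorm 2!big_ord_recl big_ord0 addr0 !mxE/= cos2Dsin2 sqrtr1.
Qed.

Lemma enorm_trig_le1 t : enorm (trig t) <= 1.
Proof. by rewrite enorm_trig. Qed.

Definition circle_point (t : R) : circle :=
  exist _ (exist _ (trig t) (mem_set (enorm_trig_le1 t)))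
          (mem_set (enorm_trig t)).

Definition disc_path (x y : disc) : set (R -> disc) :=
  [set a : R -> disc | {within `[0, 1], continuous a} /\ a 0 = x /\ a 1 = y].

End disc.

Section length_space.
Context {R : realType}.
Implicit Types (s : disc R -> 'rV[R]_3) (x y z : disc R).

Definition length_dist s x y : \bar R :=
  ereal_inf [set curve_length edist 0 1 (s \o a) | a in disc_path x y].

Lemma length_dist_ge0 s x y : (0 <= length_dist s x y)%E.
Proof.
apply: le_ereal_inf_tmp => _ [a _ <-].
by apply: curve_length_ge0 => //; exact: edist_ge0.
Qed.

Lemma length_distxx s x : length_dist s x x = 0%E.
Proof.
apply/eqP; rewrite eq_le length_dist_ge0 andbT.
apply: (@le_trans _ _ (curve_length edist 0 1 (s \o cst x))).
  apply: ereal_inf_lbound; exists (cst x) => //.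
  by split => //; apply: continuous_subspaceT; exact: cst_continuous.
exact: (curve_length_cst (@edistxx R 3) 0 1 (s x)).
Qed.

Lemma le_length_distC s x y : (length_dist s y x <= length_dist s x y)%E.
Proof.
apply: le_ereal_inf_tmp => _ [a [ca [a0 a1]] <-].
apply: le_trans (curve_length_rev (s \o a) (@edistC R 3)).
apply: ereal_inf_lbound; exists (fun t => a (1 - t)) => //; split; last first.
  by rewrite subr0 subrr.
apply: (@within_continuous_reparam _ _ _ _ (fun t => 1 - t)) ca => t //.
  by apply: cvgB; [exact: cvg_cst|exact: cvg_id].
by rewrite /= !in_itv/= => /andP[t0 t1]; apply/andP; split; lra.
Qed.

Lemma length_distC s x y : length_dist s x y = length_dist s y x.
Proof. by apply/eqP; rewrite eq_le !le_length_distC. Qed.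

Lemma disc_path_cat x y z (a b : R -> disc R) :
  disc_path x y a -> disc_path y z b ->
  disc_path x z (fun t => if t <= 2^-1 then a (2 * t) else b (2 * t - 1)).
Proof.
move=> [ca [a0 a1]] [cb [b0 b1]]; split; last first.
  rewrite invr_ge0 ler0n mulr0; split => //.
  have -> : (1 <= 2^-1 :> R) = false by apply/negbTE; rewrite -ltNge; lra.
  by rewrite (_ : 2 * 1 - 1 = 1)//; lra.
have -> : `[0, 1]%classic = `[0, 2^-1]%classic `|` `[2^-1, 1]%classic :> set R.
  apply/seteqP; split => t /=; rewrite !in_itv/=.
    by move=> /andP[t0 t1]; case: (leP t 2^-1) => ?; [left|right]; lra.
  by case=> /andP[? ?]; lra.
apply: withinU_continuous; [exact: itv_closed|exact: itv_closed| |].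
- apply: (@within_continuous_reparam _ _ _ _ (fun t => 2 * t)) ca => t.
  + by apply: cvgMl_tmp; exact: cvg_id.
  + by rewrite /= !in_itv/= => /andP[? ?]; lra.
  + by rewrite /= in_itv/= => /andP[_ ->].
- apply: (@within_continuous_reparam _ _ _ _ (fun t => 2 * t - 1)) cb => t.
  + by apply: cvgB; [apply: cvgMl_tmp; exact: cvg_id|exact: cvg_cst].
  + by rewrite /= !in_itv/= => /andP[? ?]; lra.
  + rewrite /= in_itv/= => /andP[t0 t1]; case: ifPn => // t2.
    have -> : t = 2^-1 by lra.
    by rewrite divff// subrr b0 a1.
Qed.

Lemma length_dist_triangle s y x z :
  (length_dist s x z <= length_dist s x y + length_dist s y z)%E.
Proof.
have [->|yz] := eqVneq (length_dist s y z) +oo%E.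
  rewrite addey ?leey// -ltNye; exact: lt_le_trans (length_dist_ge0 _ _ _).
rewrite -leeBlDr ?fin_numE; last first.
  by rewrite yz andbT gt_eqF// (lt_le_trans _ (length_dist_ge0 _ _ _)).
apply: le_ereal_inf_tmp => _ [a pa <-].
rewrite leeBlDr ?fin_numE; last first.
  by rewrite yz andbT gt_eqF// (lt_le_trans _ (length_dist_ge0 _ _ _)).
have [->|la] := eqVneq (curve_length edist 0 1 (s \o a)) +oo%E.
  rewrite addye ?leey// -ltNye; exact: lt_le_trans (length_dist_ge0 _ _ _).
have la0 : (0 <= curve_length edist 0 1 (s \o a))%E.
  by apply: curve_length_ge0 => //; exact: edist_ge0.
rewrite addeC -leeBlDr ?fin_numE; last first.
  by rewrite la andbT gt_eqF// (lt_le_trans _ la0).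
apply: le_ereal_inf_tmp => _ [b pb <-].
rewrite leeBlDr ?fin_numE; last first.
  by rewrite la andbT gt_eqF// (lt_le_trans _ la0).
rewrite addeC.
have ab : (s \o a) 1 = (s \o b) 0.
  by rewrite /=; case: pa => _ [_ ->]; case: pb => _ [-> _].
apply: le_trans (curve_length_cat (@edistxx R 3) (@edist_ge0 R 3)
  (@edist_triangle R 3) ab).
apply: ereal_inf_lbound; eexists; first exact: disc_path_cat pa pb.
by congr curve_length; apply/funext => t /=; case: ifP.
Qed.

Definition indist s : rel (disc R) := fun x y => length_dist s x y == 0%E.

Lemma indist_refl s : reflexive (indist s).
Proof. by move=> x; rewrite /indist length_distxx. Qed.

Lemma indist_sym s : symmetric (indist s).
Proof. by move=> x y; rewrite /indist length_distC. Qed.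

Lemma indist_trans s : transitive (indist s).
Proof.
move=> y x z /eqP xy /eqP yz; rewrite /indist eq_le length_dist_ge0 andbT.
by rewrite (le_trans (length_dist_triangle s y x z))// xy yz adde0.
Qed.

Canonical indist_equiv s :=
  EquivRel (indist s) (indist_refl s) (indist_sym s) (@indist_trans s).

(* The metric space obtained from the disc with the pseudometric [length_dist s]
   by identifying points at distance 0. *)
Definition length_space s : Type := {eq_quot indist_equiv s}.

Definition length_proj s (x : disc R) : length_space s :=
  \pi_({eq_quot indist_equiv s}) x.

Definition space_dist s (c c' : length_space s) : \bar R :=
  length_dist s (repr (c : {eq_quot indist_equiv s}))
                (repr (c' : {eq_quot indist_equiv s})).

Lemma space_dist_proj s x y :
  space_dist (length_proj s x) (length_proj s y) = length_dist s x y.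
Proof.
have le u v u' v' : indist s u u' -> indist s v v' ->
    (length_dist s u v <= length_dist s u' v')%E.
  move=> /eqP uu' /eqP vv'; apply: le_trans (length_dist_triangle s u' u v) _.
  rewrite uu' add0e; apply: le_trans (length_dist_triangle s v' u' v) _.
  by rewrite (length_distC s v') vv' adde0.
have r u : indist s (repr (\pi_({eq_quot indist_equiv s}) u)) u.
  have h := reprK (\pi_({eq_quot indist_equiv s}) u).
  exact: (introT (eqmodP (indist_equiv s) _ _) h).
apply/eqP; rewrite eq_le /space_dist /length_proj.
by apply/andP; split; apply: le => //; rewrite indist_sym.
Qed.

Definition bdry_curve s (x : circle R) : length_space s :=
  length_proj s (val x).

(* Finite length suffices: it forces [bdry_curve s] to be continuous. *)
Definition bdry_rectifiable s : Prop :=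
  (curve_length (@space_dist s) 0 (2 * pi) (bdry_curve s \o @circle_point R)
   < +oo)%E.

Definition short_map s s' (m : length_space s -> length_space s') : Prop :=
  forall c c', (space_dist (m c) (m c') <= space_dist c c')%E.

Definition majorization s s' (m : length_space s -> length_space s') : Prop :=
  short_map m /\ bdry_curve s' = m \o bdry_curve s.

Definition distance_preserving s s' (m : length_space s -> length_space s') :
    Prop :=
  forall c c', space_dist (m c) (m c') = space_dist c c'.

Definition metric_minimizing_disc s : Prop :=
  [/\ continuous s, bdry_rectifiable s &
      forall s', continuous s' ->
        (forall x : circle R, s (val x) = s' (val x)) ->
        forall m : length_space s -> length_space s',
          majorization m -> distance_preserving m].

End length_space.

Section surface.
Context {R : realType}.
Implicit Types (S : set 'rV[R]_3) (f : 'rV[R]_2 -> 'rV[R]_3) (u : 'rV[R]_2).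

Definition iter_derive (vs : seq 'rV[R]_2) f : 'rV[R]_2 -> 'rV[R]_3 :=
  foldr (fun v g u => 'D_v g u) f vs.

(* C^oo on the open set [U]; values of [f] outside [U] are irrelevant. *)
Definition smooth_on (U : set 'rV[R]_2) f : Prop :=
  forall vs u, U u -> differentiable (iter_derive vs f) u.

Definition immersive_at f u : Prop :=
  forall w : 'rV[R]_2, 'D_w f u = 0 -> w = 0.

(* A smooth chart of the subset [S] of R^3 over [H], where [H] is either the
   plane or a closed half-plane: [f] is a smooth immersion of the open set [U],
   and restricts to a homeomorphism from [U `&` H] onto the open subset [S `&` V]
   of [S], with inverse [g]. *)
Record smooth_chart S (H U : set 'rV[R]_2) (V : set 'rV[R]_3)
    f (g : 'rV[R]_3 -> 'rV[R]_2) : Prop := SmoothChart {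
  chart_open_dom : open U;
  chart_open_img : open V;
  chart_smooth : smooth_on U f;
  chart_immersive : forall u, U u -> immersive_at f u;
  chart_to : forall u, (U `&` H) u -> (S `&` V) (f u);
  chart_from : forall q, (S `&` V) q -> (U `&` H) (g q);
  chart_invl : forall u, (U `&` H) u -> g (f u) = u;
  chart_invr : forall q, (S `&` V) q -> f (g q) = q;
  chart_inv_continuous : {within S `&` V, continuous g} }.

(* [f] is a chart of [S] over [H] sending [u] to [p]. *)
Definition chart_at S (H : set 'rV[R]_2) (p : 'rV[R]_3) f u : Prop :=
  exists U V g, [/\ smooth_chart S H U V f g, (U `&` H) u & f u = p].

Definition interior_point S p : Prop := exists f u, chart_at S setT p f u.

Definition half_plane : set 'rV[R]_2 := [set u | 0 <= u 0 1].

Definition boundary_point S p : Prop :=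
  exists f u, chart_at S half_plane p f u /\ u 0 1 = 0.

(* Embedded smooth surface, possibly with boundary. *)
Definition smooth_surface S : Prop :=
  forall p, S p -> interior_point S p \/ boundary_point S p.

(* Indices are taken modulo 3. *)
Definition cross (a b : 'rV[R]_3) : 'rV[R]_3 :=
  \row_(i < 3) (a 0 (i + 1) * b 0 (i + 2%:R) - a 0 (i + 2%:R) * b 0 (i + 1)).

Definition unit_normal f u : 'rV[R]_3 :=
  let n := cross ('D_('e_0) f u) ('D_('e_1) f u) in (enorm n)^-1 *: n.

(* [k] is an eigenvalue of the shape operator, i.e. of minus the differential of
   the unit normal, acting on the tangent plane at [f u]. *)
Definition principal_curvature f u (k : R) : Prop :=
  exists2 w : 'rV[R]_2, w != 0 & - 'D_w (unit_normal f) u = k *: 'D_w f u.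

(* Replacing the chart can only change the signs of both curvatures at once. *)
Definition strictly_saddle S : Prop :=
  forall p f u, chart_at S setT p f u ->
    exists k1 k2, [/\ principal_curvature f u k1, principal_curvature f u k2 &
                      k1 < 0 < k2].

Definition locally_metric_minimizing S : Prop :=
  forall p, interior_point S p ->
    exists s : disc R -> 'rV[R]_3,
      [/\ metric_minimizing_disc s, injective s, range s `<=` S &
          within S (nbhs p) (range s)].

End surface.

(* Main.v *)
Require Import Defs.
From mathcomp Require Import all_boot all_order all_algebra generic_quotient.
From mathcomp Require Import all_classical all_reals all_analysis.
From mathcomp Require Import ring lra.

Set Implicit Arguments.
Unset Strict Implicit.
Unset Printing Implicit Defensive.
Import Order.TTheory GRing.Theory Num.Theory.
Import numFieldNormedType.Exports.
Local Open Scope classical_set_scope.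
Local Open Scope ring_scope.

(** Near an interior point write the surface as [F x t], with axes that have asymptotic
    directions at the point; the metric-minimizing discs are the restrictions of [F] to small
    round discs. Let [s] be such a restriction, let a majorization from [s] to [s'] be given,
    and let [M] be a map of the disc to itself that represents it. It has to be shown that the
    majorization does not decrease distances. This has an analytic part and a topological part.

    Rigidity: [s' \o M = s]. The map [G] equal to [s' \o M] inside the disc and to [F] outside
    does not increase lengths. Cover the disc by a net of mesh [h] whose edges are asymptotic
    ([net_exists]). In a spring network with positive stresses [w] in equilibrium a map that
    lengthens no edge and fixes the boundary is trivial: with [W = G - F],
    [sum w |dW|^2 = sum w |dG|^2 - sum w |dF|^2 - 2 sum w dF.dW], where the difference of the
    first two sums is not positive and the last sum vanishes by summation by parts. The edges at
    a node of an asymptotic net lie in the tangent plane up to third order in [h], because the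
    second fundamental form vanishes on them. Hence there are positive stresses in equilibrium
    up to third order ([node_stress]), and the energy of [W] is [O(h)], which is the sum of
    [O(h^-2)] errors of order [h^3] ([net_energy]). On the other hand a nonzero value of [W]
    costs an amount of energy that is bounded below, so that [W = 0] ([energy_rigidity]). The
    asymptotic directions exist on a neighbourhood because the principal curvatures have
    opposite signs ([asymptotic_basis], [asymptotic_exists]).

    No shortcuts: [length_dist s x y <= length_dist s' (M x) (M y)]. Let [a] be a path from [M x]
    to [M y]. For every [t] between 0 and [length_dist s x y] there are a point [p] at distance
    [t] from [x] and a point [a r] with [s p = s' (a r)] ([crossing]): otherwise the frontier of
    the set of points at distance less than [t] from [x] would be mapped by [M] to a set that
    avoids the path. This contradicts a winding number argument: the image of that set winds
    once around [M x] and not at all around [M y]. As [M] may be discontinuous, the argument is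
    made for chains of points that replace the images of the edges of a fine grid. As the
    distance of [s] agrees to first order with the length of chords, the occurrence of all the
    values [t] along [s' \o a] forces the length of this curve to be at least
    [length_dist s x y] ([length_of_hits], [no_shortcut]). *)

(** * Euclidean algebra in space *)

Section space.
Context {R : realType}.
Implicit Types (a b c : 'rV[R]_3).

Definition dot n (a b : 'rV[R]_n) : R := \sum_i a 0 i * b 0 i.

Lemma sqr_enormE n (a : 'rV[R]_n) : enorm a ^+ 2 = dot a a.
Proof. by rewrite sqr_enorm; apply: eq_bigr => i _; rewrite expr2. Qed.

Lemma dotC n (a b : 'rV[R]_n) : dot a b = dot b a.
Proof. by apply: eq_bigr => i _; rewrite mulrC. Qed.

Lemma dotDl n (a b c : 'rV[R]_n) : dot (a + b) c = dot a c + dot b c.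
Proof. by rewrite -big_split; apply: eq_bigr => i _; rewrite mxE mulrDl. Qed.

Lemma dotZl n k (a b : 'rV[R]_n) : dot (k *: a) b = k * dot a b.
Proof. by rewrite mulr_sumr; apply: eq_bigr => i _; rewrite mxE mulrA. Qed.

Lemma dotDr n (a b c : 'rV[R]_n) : dot c (a + b) = dot c a + dot c b.
Proof. by rewrite dotC dotDl !(dotC c). Qed.

Lemma dotZr n k (a b : 'rV[R]_n) : dot b (k *: a) = k * dot b a.
Proof. by rewrite dotC dotZl dotC. Qed.

Lemma dotNl n (a b : 'rV[R]_n) : dot (- a) b = - dot a b.
Proof. by rewrite -scaleN1r dotZl mulN1r. Qed.

Lemma dotNr n (a b : 'rV[R]_n) : dot b (- a) = - dot b a.
Proof. by rewrite dotC dotNl dotC. Qed.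

Lemma dot0l n (a : 'rV[R]_n) : dot 0 a = 0.
Proof. by rewrite /dot big1// => i _; rewrite mxE mul0r. Qed.

Lemma dot0r n (a : 'rV[R]_n) : dot a 0 = 0.
Proof. by rewrite dotC dot0l. Qed.

Definition dotE := (dotDl, dotDr, dotNl, dotNr, dotZl, dotZr).

Lemma ler_norm_dot n (a b : 'rV[R]_n) : `|dot a b| <= enorm a * enorm b.
Proof.
rewrite ler_norml cauchy_schwarz andbT lerNl -dotNl.
by rewrite -(enormN a) cauchy_schwarz.
Qed.

Lemma enormZ n k (a : 'rV[R]_n) : enorm (k *: a) = `|k| * enorm a.
Proof.
apply/eqP; rewrite -(@eqrXn2 _ 2)//; last 2 first.
- exact: enorm_ge0.
- by rewrite mulr_ge0// enorm_ge0.
by rewrite exprMn !sqr_enormE dotZl dotZr mulrA real_normK ?num_real// expr2.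
Qed.

Lemma enorm_distC n (a b : 'rV[R]_n) : enorm (a - b) = enorm (b - a).
Proof. by rewrite -enormN opprB. Qed.

Lemma ler_enormB n (a b : 'rV[R]_n) : enorm (a - b) <= enorm a + enorm b.
Proof. by rewrite -(enormN b) ler_enormD. Qed.

Lemma enorm_distD n (b a c : 'rV[R]_n) :
  enorm (a - c) <= enorm (a - b) + enorm (b - c).
Proof. by rewrite -(subrKA b) ler_enormD. Qed.

Lemma ler_enorm_dist n (a b : 'rV[R]_n) : `|enorm a - enorm b| <= enorm (a - b).
Proof.
rewrite ler_norml; apply/andP; split.
- have := ler_enormD (b - a) a; rewrite subrK (enorm_distC b); lra.
- have := ler_enormD (a - b) b; rewrite subrK; lra.
Qed.

Lemma enorm_eq0 n (a : 'rV[R]_n) : (enorm a == 0) = (a == 0).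
Proof.
by apply/eqP/eqP => [/enorm0_eq0//|->]; rewrite enorm0.
Qed.

Lemma dot3E a b :
  dot a b = a 0 0 * b 0 0 + a 0 1 * b 0 1 + a 0 (2%:R) * b 0 (2%:R).
Proof.
rewrite /dot !big_ord_recl big_ord0 addr0 addrA.
by congr (_ * _ + _ * _ + _ * _); congr (_ 0 _); apply: val_inj.
Qed.

Lemma cross0E a b : cross a b 0 0 = a 0 1 * b 0 2%:R - a 0 2%:R * b 0 1.
Proof. by rewrite mxE !add0r. Qed.

Lemma cross1E a b : cross a b 0 1 = a 0 2%:R * b 0 0 - a 0 0 * b 0 2%:R.
Proof.
rewrite mxE; congr (_ * _ - _ * _); congr (_ 0 _); exact: val_inj.
Qed.

Lemma cross2E a b : cross a b 0 2%:R = a 0 0 * b 0 1 - a 0 1 * b 0 0.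
Proof.
rewrite mxE; congr (_ * _ - _ * _); congr (_ 0 _); exact: val_inj.
Qed.

Definition crossE := (cross0E, cross1E, cross2E).

Lemma rV3P a b : a 0 0 = b 0 0 -> a 0 1 = b 0 1 -> a 0 2%:R = b 0 2%:R -> a = b.
Proof.
move=> h0 h1 h2; apply/rowP => -[[|[|[|//]]] hi].
- by rewrite (_ : Ordinal hi = 0)//; apply: val_inj.
- by rewrite (_ : Ordinal hi = 1)//; apply: val_inj.
- by rewrite (_ : Ordinal hi = 2%:R)//; apply: val_inj.
Qed.

Lemma dot_crossl a b : dot (cross a b) a = 0.
Proof. by rewrite dot3E !crossE; ring. Qed.

Lemma dot_crossr a b : dot (cross a b) b = 0.
Proof. by rewrite dot3E !crossE; ring. Qed.

Lemma dot_cross_cross a b :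
  dot (cross a b) (cross a b) = dot a a * dot b b - dot a b ^+ 2.
Proof. by rewrite !dot3E !crossE; ring. Qed.

Lemma perp_cross a b r : dot r a = 0 -> dot r b = 0 ->
  dot (cross a b) (cross a b) *: r = dot r (cross a b) *: cross a b.
Proof.
move=> ra rb.
(* [n x (r x n) = |n|^2 r - (n.r) n], and [r x n = (r.b) a - (r.a) b]. *)
have e : dot (cross a b) (cross a b) *: r - dot r (cross a b) *: cross a b =
    dot r b *: cross (cross a b) a - dot r a *: cross (cross a b) b.
  have vE k l (u v : 'rV[R]_3) i : (k *: u - l *: v) 0 i = k * u 0 i - l * v 0 i.
    by rewrite !mxE.
  by apply: rV3P; rewrite !vE !dot3E !crossE; ring.
by apply/eqP; rewrite -subr_eq0 e ra rb !scale0r subrr.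
Qed.

Lemma enorm_cross a b : enorm (cross a b) <= enorm a * enorm b.
Proof.
rewrite -(@ler_pXn2r _ 2)// ?nnegrE ?mulr_ge0 ?enorm_ge0//.
rewrite sqr_enormE dot_cross_cross exprMn !sqr_enormE gerBl; exact: sqr_ge0.
Qed.

End space.

(** * Equilibrium of stresses at a node *)

Section node.
Context {R : realType}.
Implicit Types (X T f g : 'rV[R]_3).

Lemma ler_normM (a b A B : R) : `|a| <= A -> `|b| <= B -> `|a * b| <= A * B.
Proof. by move=> ha hb; rewrite normrM ler_pM. Qed.

Lemma ler_normP (a b e : R) : `|a - b| <= e -> `|a| <= `|b| + e.
Proof.
move=> h; have := ler_normD (a - b) b; rewrite subrK; lra.
Qed.

Lemma ler_dot_bd n (a b : 'rV[R]_n) (A B : R) :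
  enorm a <= A -> enorm b <= B -> `|dot a b| <= A * B.
Proof.
move=> ha hb; apply: le_trans (ler_norm_dot _ _) _.
by rewrite ler_pM// enorm_ge0.
Qed.

(** A vector orthogonal to [X] and [T] is a multiple of their cross product, so that its
    component along the cross product controls it. *)
Lemma perp_enorm X T f (c e : R) : 0 < c ->
  c <= dot (cross X T) (cross X T) -> dot f X = 0 -> dot f T = 0 ->
  `|dot f (cross X T)| <= e -> enorm f <= e / Num.sqrt c.
Proof.
move=> c0 cn fX fT fn; set n := cross X T in cn fn.
have n0 : Num.sqrt c <= enorm n.
  rewrite -(@ler_pXn2r _ 2)// ?nnegrE ?sqrtr_ge0 ?enorm_ge0//.
  by rewrite sqr_enormE sqr_sqrtr// ltW.
have sc : 0 < Num.sqrt c by rewrite sqrtr_gt0.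
have np : 0 < enorm n by apply: lt_le_trans n0.
have := congr1 (@enorm R 3) (perp_cross fX fT); rewrite -/n !enormZ.
rewrite -sqr_enormE ger0_norm ?sqr_ge0// expr2 -mulrA [RHS]mulrC.
move=> /(mulfI (lt0r_neq0 np)) h; rewrite ler_pdivlMr//.
by apply: le_trans fn; rewrite -h mulrC ler_wpM2r// enorm_ge0.
Qed.

(** Continuation of stresses across a node of a net, from the incoming edges [f'], [g'] with
    stresses [A'], [B'] to the outgoing edges [f], [g]. The tangential part of the equation of
    equilibrium is a linear system for the outgoing stresses, with determinant of the order of
    [h ^+ 2] since the slopes are small, so that Cramer's rule changes the stresses by [O(h)].
    The normal part of the residual is not adjustable: it is of order [h ^+ 3] only because the
    edges are asymptotic. *)
Lemma node_stress (C c K : R) : 0 < c -> 1 <= C -> 1 <= K ->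
  exists K' h0, [/\ 0 < K', 0 < h0 &
  forall (h : R) X T f f' g g' (mu nu A' B' : R), 0 < h <= h0 ->
    enorm X <= C -> enorm T <= C -> c <= dot (cross X T) (cross X T) ->
    `|mu| <= 100^-1 -> `|nu| <= 100^-1 ->
    enorm (f - h *: (X + mu *: T)) <= K * h ^+ 2 ->
    enorm (f' - h *: (X + mu *: T)) <= K * h ^+ 2 ->
    enorm (g - h *: (nu *: X + T)) <= K * h ^+ 2 ->
    enorm (g' - h *: (nu *: X + T)) <= K * h ^+ 2 ->
    `|dot f (cross X T)| <= K * h ^+ 3 -> `|dot f' (cross X T)| <= K * h ^+ 3 ->
    `|dot g (cross X T)| <= K * h ^+ 3 -> `|dot g' (cross X T)| <= K * h ^+ 3 ->
    0 <= A' <= 2 -> 0 <= B' <= 2 ->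
    exists AB : R * R, [/\ `|AB.1 - A'| <= K' * h, `|AB.2 - B'| <= K' * h &
      enorm (AB.1 *: f - A' *: f' + (AB.2 *: g - B' *: g')) <= K' * h ^+ 3]].
Proof.
move=> c0 C1 K1.
have C0 : 0 < C by lra.
have K0 : 0 < K by lra.
pose L := 96 * K ^+ 2 * C ^+ 3 / c.
have L0 : 0 < L by rewrite /L divr_gt0// !mulr_gt0// exprn_gt0.
pose K' := L + (8 + 2 * L) * K / Num.sqrt c.
have K'L : L <= K' by rewrite /K' lerDl divr_ge0 ?sqrtr_ge0// mulr_ge0 ?ltW//; lra.
exists K', (Num.min 1 (c / (40 * K ^+ 2 * C ^+ 3))); split.
- by lra.
- by rewrite lt_min ltr01 divr_gt0// !mulr_gt0// exprn_gt0.
move=> h X T f f' g g' mu nu A' B' /andP[h0]; rewrite le_min => /andP[h1 hc].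
move=> XC TC cn mu1 nu1 fX f'X gX g'X fn f'n gn g'n A2 B2.
have {}hc : 40 * K ^+ 2 * C ^+ 3 * h <= c.
  by move: hc; rewrite ler_pdivlMr 1?mulrC// !mulr_gt0// exprn_gt0.
have h2 : 0 < h ^+ 2 by rewrite exprn_gt0.
have CC : C ^+ 2 = C * C by rewrite expr2.
have KC : 0 < K * C by rewrite mulr_gt0.
have XX : `|dot X X| <= C ^+ 2 by rewrite CC; exact: ler_dot_bd.
have XT : `|dot X T| <= C ^+ 2 by rewrite CC; exact: ler_dot_bd.
have TT : `|dot T T| <= C ^+ 2 by rewrite CC; exact: ler_dot_bd.
have muB (a : R) : `|a| <= C ^+ 2 -> `|mu * a| <= C ^+ 2 / 100.
  by move=> ha; rewrite mulrC; apply: ler_normM.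
have nuB (a : R) : `|a| <= C ^+ 2 -> `|nu * a| <= C ^+ 2 / 100.
  by move=> ha; rewrite mulrC; apply: ler_normM.
set E := K * C * h ^+ 2.
(* [f1], [f2], [g1], [g2] are the main parts of the coefficients of the linear system *)
have dB (v w y : 'rV[R]_3) : enorm (v - w) <= K * h ^+ 2 -> enorm y <= C ->
    `|dot v y - dot w y| <= E.
  by move=> hv hy; rewrite -dotNl -dotDl /E mulrAC; apply: ler_dot_bd.
have F1 := dB _ _ _ fX XC; have F2 := dB _ _ _ fX TC.
have G1 := dB _ _ _ gX XC; have G2 := dB _ _ _ gX TC.
rewrite !dotE in F1 F2 G1 G2; rewrite (dotC T X) in F1 F2 G1 G2.
set f1 := h * _ in F1; set f2 := h * _ in F2.
set g1 := h * _ in G1; set g2 := h * _ in G2.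
have hB (a b : R) : `|a| <= C ^+ 2 -> `|b| <= C ^+ 2 / 100 -> `|h * (a + b)| <= 2 * C ^+ 2 * h.
  move=> ha hb; rewrite normrM gtr0_norm// mulrC ler_pM2r//.
  by apply: le_trans (ler_normD _ _) _; have := normr_ge0 a; move: ha hb; clear; lra.
have f1B : `|f1| <= 2 * C ^+ 2 * h by apply: hB => //; exact: muB.
have f2B : `|f2| <= 2 * C ^+ 2 * h by apply: hB => //; exact: muB.
have g1B : `|g1| <= 2 * C ^+ 2 * h by rewrite /g1 addrC; apply: hB => //; exact: nuB.
have g2B : `|g2| <= 2 * C ^+ 2 * h by rewrite /g2 addrC; apply: hB => //; exact: nuB.
have EB : E <= K * C ^+ 2 * h.
  have : C * h <= C * C by rewrite ler_pM2l// (le_trans h1).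
  rewrite /E CC (_ : K * C * h ^+ 2 = K * h * (C * h)); last by ring.
  by rewrite (_ : K * (C * C) * h = K * h * (C * C)) ?ler_pM2l ?mulr_gt0//; ring.
have KC2 : C ^+ 2 * h <= K * C ^+ 2 * h.
  by rewrite -mulrA ler_peMl// mulr_ge0 ?sqr_ge0 ?ltW.
have C2h : 0 <= C ^+ 2 * h by rewrite mulr_ge0 ?sqr_ge0 ?ltW.
have up (a : R) : `|a| <= 2 * C ^+ 2 * h -> `|a| <= 3 * K * C ^+ 2 * h.
  by move: KC2 C2h; clear; lra.
have bd (a b : R) : `|a - b| <= E -> `|b| <= 2 * C ^+ 2 * h -> `|a| <= 3 * K * C ^+ 2 * h.
  by move=> /ler_normP; move: KC2 C2h EB; clear; lra.
have F1B := bd _ _ F1 f1B; have F2B := bd _ _ F2 f2B.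
have G1B := bd _ _ G1 g1B; have G2B := bd _ _ G2 g2B.
have f1B' : `|f1| <= 3 * K * C ^+ 2 * h by exact: up.
have f2B' : `|f2| <= 3 * K * C ^+ 2 * h by exact: up.
set D := dot f X * dot g T - dot f T * dot g X.
have D0 : c * h ^+ 2 / 2 <= D.
  have -> : D = f1 * g2 - f2 * g1 + ((dot f X - f1) * dot g T
      + f1 * (dot g T - g2) - (dot f T - f2) * dot g X - f2 * (dot g X - g1)).
    by rewrite /D; ring.
  have -> : f1 * g2 - f2 * g1 = (1 - mu * nu) * (h ^+ 2 * dot (cross X T) (cross X T)).
    by rewrite dot_cross_cross /f1 /f2 /g1 /g2; ring.
  have mn : `|mu * nu| <= 100^-1 by apply: le_trans (ler_normM mu1 nu1) _; clear; lra.
  have r1 : 99 / 100 * (c * h ^+ 2) <=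
      (1 - mu * nu) * (h ^+ 2 * dot (cross X T) (cross X T)).
    apply: ler_pM.
    - by clear; lra.
    - by rewrite mulr_ge0 ?ltW.
    - by move: mn; rewrite ler_norml; clear => /andP[_]; lra.
    - by rewrite [leRHS]mulrC ler_pM2r.
  have q1 := ler_normM F1 G2B; have q2 := ler_normM f1B' G2.
  have q3 := ler_normM F2 G1B; have q4 := ler_normM f2B' G1.
  have q5 : E * (3 * K * C ^+ 2 * h) <= 3 / 40 * (c * h ^+ 2).
    rewrite (_ : E * _ = 3 / 40 * (40 * K ^+ 2 * C ^+ 3 * h * h ^+ 2)).
      by rewrite ler_pM2l ?ler_pM2r//.
    by rewrite /E; field.
  have : 0 <= c * h ^+ 2 by rewrite mulr_ge0 ?ltW.
  move: r1 q5 q1 q2 q3 q4; rewrite !ler_norml; clear.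
  by move=> ? ? /andP[? ?] /andP[? ?] /andP[? ?] /andP[? ?]; lra.
have Dp : 0 < D by apply: lt_le_trans D0; rewrite divr_gt0// mulr_gt0.
have dfB (v w u : 'rV[R]_3) : enorm (v - u) <= K * h ^+ 2 -> enorm (w - u) <= K * h ^+ 2 ->
    enorm (v - w) <= 2 * K * h ^+ 2.
  move=> hv hw; apply: le_trans (enorm_distD u _ _) _; rewrite (enorm_distC u).
  by move: hv hw; clear; lra.
have eB (y : 'rV[R]_3) : enorm y <= C ->
    `|dot (A' *: (f - f') + B' *: (g - g')) y| <= 8 * K * C * h ^+ 2.
  move=> hy; rewrite (_ : 8 * K * C * h ^+ 2 = 8 * K * h ^+ 2 * C); last by ring.
  apply: ler_dot_bd => //; apply: le_trans (ler_enormD _ _) _; rewrite !enormZ.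
  have ff := dfB _ _ _ fX f'X; have gg := dfB _ _ _ gX g'X.
  have a2 : `|A'| <= 2 by rewrite ger0_norm; move: A2 B2; clear; lra.
  have b2 : `|B'| <= 2 by rewrite ger0_norm; move: A2 B2; clear; lra.
  have := ler_pM (normr_ge0 _) (enorm_ge0 _) a2 ff.
  by have := ler_pM (normr_ge0 _) (enorm_ge0 _) b2 gg; clear; lra.
set e1 := - dot (A' *: (f - f') + B' *: (g - g')) X.
set e2 := - dot (A' *: (f - f') + B' *: (g - g')) T.
have e1B : `|e1| <= 8 * K * C * h ^+ 2 by rewrite normrN; exact: eB.
have e2B : `|e2| <= 8 * K * C * h ^+ 2 by rewrite normrN; exact: eB.
pose al := (e1 * dot g T - e2 * dot g X) / D.
pose be := (e2 * dot f X - e1 * dot f T) / D.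
have LB (a b a' b' : R) : `|a| <= 8 * K * C * h ^+ 2 -> `|b| <= 3 * K * C ^+ 2 * h ->
    `|a'| <= 8 * K * C * h ^+ 2 -> `|b'| <= 3 * K * C ^+ 2 * h ->
    `|(a * b - a' * b') / D| <= L * h.
  move=> ha hb ha' hb'.
  rewrite normrM normfV (gtr0_norm Dp) ler_pdivrMr//.
  apply: (@le_trans _ _ (L * h * (c * h ^+ 2 / 2))); last first.
    by rewrite ler_pM2l// mulr_gt0.
  have -> : L * h * (c * h ^+ 2 / 2) = 2 * (8 * K * C * h ^+ 2 * (3 * K * C ^+ 2 * h)).
    by rewrite /L; field; rewrite gt_eqF.
  have := ler_normM ha hb; have := ler_normM ha' hb'.
  by have := ler_normB (a * b) (a' * b'); clear; lra.
have alB : `|al| <= L * h by exact: LB.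
have beB : `|be| <= L * h by exact: LB.
exists (A' + al, B' + be) => /=; split.
- rewrite addrC addKr; apply: le_trans alB _; rewrite ler_pM2r//.
- rewrite addrC addKr; apply: le_trans beB _; rewrite ler_pM2r//.
set r := _ + _.
have rX : dot r X = 0.
  rewrite /r (_ : _ + _ = al *: f + be *: g + (A' *: (f - f') + B' *: (g - g'))).
    have E1 : dot (A' *: (f - f') + B' *: (g - g')) X = - e1 by rewrite opprK.
    rewrite dotDl E1 dotDl !dotZl.
    by rewrite /al /be /D; field; rewrite -/D gt_eqF.
  by apply/rowP => i; rewrite !mxE; ring.
have rT : dot r T = 0.
  rewrite /r (_ : _ + _ = al *: f + be *: g + (A' *: (f - f') + B' *: (g - g'))).
    have E2 : dot (A' *: (f - f') + B' *: (g - g')) T = - e2 by rewrite opprK.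
    rewrite dotDl E2 dotDl !dotZl.
    by rewrite /al /be /D; field; rewrite -/D gt_eqF.
  by apply/rowP => i; rewrite !mxE; ring.
have Lh : L * h <= L by rewrite ler_piMr// ltW.
have rn : `|dot r (cross X T)| <= (8 + 2 * L) * K * h ^+ 3.
  rewrite /r !dotE.
  have a2 : `|A'| <= 2 by rewrite ger0_norm; move: A2 B2; clear; lra.
  have b2 : `|B'| <= 2 by rewrite ger0_norm; move: A2 B2; clear; lra.
  have a3 : `|A' + al| <= 2 + L by have := ler_normD A' al; move: a2 alB Lh; clear; lra.
  have b3 : `|B' + be| <= 2 + L by have := ler_normD B' be; move: b2 beB Lh; clear; lra.
  have q1 := ler_normM a3 fn; have q2 := ler_normM a2 f'n.
  have q3 := ler_normM b3 gn; have q4 := ler_normM b2 g'n.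
  move: q1 q2 q3 q4; rewrite !ler_norml; clear.
  by move=> /andP[? ?] /andP[? ?] /andP[? ?] /andP[? ?]; apply/andP; split; lra.
apply: le_trans (perp_enorm c0 cn rX rT rn) _.
have h3 : 0 < h ^+ 3 by rewrite exprn_gt0.
by rewrite mulrAC ler_pM2r// /K' lerDr ltW.
Qed.

End node.

(** * Second-order expansions and asymptotic directions *)

Section jet.
Context {R : realType}.
Implicit Types (F Fx Ft Fxx Fxt Ftt : R -> R -> 'rV[R]_3) (mu nu : R -> R -> R).

Definition box (rho x t : R) : Prop := `|x| <= rho /\ `|t| <= rho.

Definition bounded_lip (rho C : R) (f : R -> R -> 'rV[R]_3) : Prop :=
  (forall x t, box rho x t -> enorm (f x t) <= C) /\
  (forall x t x' t', box rho x t -> box rho x' t' ->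
    enorm (f x' t' - f x t) <= C * (`|x' - x| + `|t' - t|)).

(** A Taylor expansion of order two that is uniform on a box, with Lipschitz coefficients;
    [Fxt] is the mean of the two mixed derivatives. *)
Record jet2 F Fx Ft Fxx Fxt Ftt (rho C : R) : Prop := Jet2 {
  jet_x : bounded_lip rho C Fx;
  jet_t : bounded_lip rho C Ft;
  jet_xx : bounded_lip rho C Fxx;
  jet_xt : bounded_lip rho C Fxt;
  jet_tt : bounded_lip rho C Ftt;
  jet_taylor : forall x t x' t', box rho x t -> box rho x' t' ->
    enorm (F x' t' - F x t - ((x' - x) *: Fx x t + (t' - t) *: Ft x t)
      - 2^-1 *: ((x' - x) ^+ 2 *: Fxx x t + (2 * (x' - x) * (t' - t)) *: Fxt x t
                 + (t' - t) ^+ 2 *: Ftt x t))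
    <= C * (`|x' - x| + `|t' - t|) ^+ 3 }.

(** Exchanging the coordinates exchanges the two families of asymptotic lines, so that
    statements about one family carry over to the other. *)
Definition swap {T : Type} (f : R -> R -> T) (x t : R) : T := f t x.

Lemma box_swap rho x t : box rho x t -> box rho t x.
Proof. by case. Qed.

Lemma bounded_lip_swap rho C f : bounded_lip rho C f -> bounded_lip rho C (swap f).
Proof.
move=> [b l]; split=> [x t /box_swap/b//|x t x' t' /box_swap p /box_swap q].
by rewrite (addrC `|_ - x|); exact: l.
Qed.

Lemma jet2_swap F Fx Ft Fxx Fxt Ftt rho C : jet2 F Fx Ft Fxx Fxt Ftt rho C ->
  jet2 (swap F) (swap Ft) (swap Fx) (swap Ftt) (swap Fxt) (swap Fxx) rho C.
Proof.
case=> jx jt jxx jxt jtt tay; split; try exact: bounded_lip_swap.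
move=> x t x' t' /box_swap p /box_swap q; have := tay _ _ _ _ p q.
rewrite /swap (addrC `|t' - t|); set v := (X in enorm X <= _ -> _).
set w := (X in _ -> enorm X <= _); suff -> : v = w by [].
by apply/rowP => i; rewrite !mxE; ring.
Qed.

(** A field of slopes [mu] such that the direction [(1, mu)] annihilates the second
    fundamental form. *)
Record asymptotic Fx Ft Fxx Fxt Ftt (rho C : R) mu : Prop := Asymptotic {
  asym_small : forall x t, `|mu x t| <= 100^-1;
  asym_lip : forall x t x' t', box rho x t -> box rho x' t' ->
    `|mu x' t' - mu x t| <= C * (`|x' - x| + `|t' - t|);
  asym_eq : forall x t, box rho x t ->
    dot (cross (Fx x t) (Ft x t))
      (Fxx x t + (2 * mu x t) *: Fxt x t + mu x t ^+ 2 *: Ftt x t) = 0 }.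

(** The quadratic term of the expansion along an asymptotic direction is tangent to the
    surface, so that the normal component of an edge is of third order. An edge is seen from
    either endpoint: [a] is negative at the far one, where the slope [m] of the edge is the
    value of the field at the other endpoint, at distance [O(h)] from [mu x t]. *)
Lemma edge_x F Fx Ft Fxx Fxt Ftt rho C mu (h a m x t : R) : 1 <= C ->
  jet2 F Fx Ft Fxx Fxt Ftt rho C -> asymptotic Fx Ft Fxx Fxt Ftt rho C mu ->
  0 < h <= 8^-1 -> 2^-1 <= `|a| <= 2 -> box rho x t ->
  box rho (x + h * a) (t + h * a * m) -> `|m| <= 1 -> `|m - mu x t| <= 4 * C * h ->
  let f := a^-1 *: (F (x + h * a) (t + h * a * m) - F x t) in
  enorm (f - h *: (Fx x t + mu x t *: Ft x t)) <= 1000 * C ^+ 4 * h ^+ 2 /\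
  `|dot f (cross (Fx x t) (Ft x t))| <= 1000 * C ^+ 4 * h ^+ 3.
Proof.
move=> C1 j as_mu /andP[h0 h8] /andP[a1 a2] zb z'b m1 mmu f.
have C0 : 0 < C by apply: lt_le_trans C1.
have a0 : a != 0 by rewrite -normr_gt0 (lt_le_trans _ a1)// invr_gt0.
have := jet_taylor j zb z'b; rewrite ![_ + _ - x]addrC ![_ + _ - t]addrC !addKr.
set n := cross _ _; set Q := _ + _ ^+ 2 *: Ftt x t; set E := _ - _ - _ => EB.
have mB := asym_small as_mu x t.
have [[xB _] [tB _]] := (jet_x j, jet_t j).
have [[xxB _] [xtB _]] := (jet_xx j, jet_xt j).
have [ttB _] := jet_tt j.
move: xB tB xxB xtB ttB => /(_ _ _ zb) xB /(_ _ _ zb) tB /(_ _ _ zb) xxB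
  /(_ _ _ zb) xtB /(_ _ _ zb) ttB.
set X := Fx x t in n E EB xB *; set T := Ft x t in n E EB tB *.
set XX := Fxx x t in Q E EB xxB *; set XT := Fxt x t in Q E EB xtB *.
set TT := Ftt x t in Q E EB ttB *; set u := mu x t in mB mmu *.
have ha : `|h * a| <= 2 * h by rewrite normrM gtr0_norm// mulrC ler_pM2r.
have hm : `|h * a * m| <= 2 * h.
  by rewrite normrM (le_trans _ ha)// ler_piMr.
have EB' : enorm E <= 64 * C * h ^+ 3.
  apply: le_trans EB _; rewrite (_ : 64 * C * h ^+ 3 = C * (4 * h) ^+ 3); last by ring.
  rewrite ler_pM2l//; apply: lerXn2r; rewrite ?nnegrE ?addr_ge0//.
  - by rewrite mulr_ge0// ltW.
  - by move: ha hm; clear; lra.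
pose q := XX + (2 * m) *: XT + m ^+ 2 *: TT.
have fE : f = h *: (X + m *: T) + (2^-1 * h ^+ 2 * a) *: q + a^-1 *: E.
  rewrite /E /f /Q /q; apply/rowP => i; rewrite !mxE; field.
  exact: a0.
have ai : `|a^-1| <= 2.
  by rewrite normfV -[leRHS]invrK lef_pV2// posrE ?invr_gt0// (lt_le_trans _ a1)// invr_gt0.
have nB : enorm n <= C ^+ 2.
  by apply: le_trans (enorm_cross _ _) _; rewrite expr2 ler_pM// enorm_ge0.
have qB : enorm q <= 4 * C.
  apply: le_trans (ler_enormD _ _) _; rewrite enormZ.
  apply: le_trans (lerD (ler_enormD _ _) (lexx _)) _; rewrite enormZ.
  have h1 : `|2 * m| * enorm XT <= 2 * C.
    by apply: ler_pM => //; rewrite ?enorm_ge0// normrM ger0_norm// ler_piMr.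
  have h2 : `|m ^+ 2| * enorm TT <= 1 * C.
    by apply: ler_pM; rewrite ?enorm_ge0// normrX exprn_ile1.
  by move: h1 h2 xxB; clear; lra.
have h2 : 0 < h ^+ 2 by rewrite exprn_gt0.
have h3 : 0 < h ^+ 3 by rewrite exprn_gt0.
have c2 : 1 <= C ^+ 2 by rewrite exprn_ege1.
have C2 : C <= C ^+ 2 by rewrite expr2 ler_peMl// ltW.
have C3 : C ^+ 2 <= C ^+ 3 by rewrite (exprS _ 2) ler_peMl ?sqr_ge0.
have C4 : C ^+ 3 <= C ^+ 4 by rewrite (exprS _ 3) ler_peMl ?exprn_ge0// ltW.
have ah : `|2^-1 * h ^+ 2 * a| <= h ^+ 2.
  have hh : 0 < 2^-1 * h ^+ 2 by apply: mulr_gt0; rewrite ?invr_gt0.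
  rewrite normrM gtr0_norm//.
  rewrite [leRHS](_ : _ = 2^-1 * h ^+ 2 * 2); last by field.
  by rewrite ler_pM2l.
have aE : enorm (a^-1 *: E) <= 128 * C * h ^+ 3.
  rewrite enormZ; apply: le_trans (ler_pM _ _ ai EB') _; rewrite ?enorm_ge0//.
  by rewrite !mulrA -natrM.
have ch k l : k <= l -> 0 <= l -> k * h ^+ 3 <= 8^-1 * l * h ^+ 2.
  move=> kl l0; rewrite (exprS _ 2) mulrA ler_pM2r// mulrC.
  apply: (@le_trans _ _ (h * l)); first by rewrite ler_pM2l.
  by rewrite ler_wpM2r.
split.
  have -> : f - h *: (X + u *: T) =
      h *: ((m - u) *: T) + (2^-1 * h ^+ 2 * a) *: q + a^-1 *: E.
    by rewrite fE; apply/rowP => i; rewrite !mxE; ring.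
  apply: le_trans (ler_enormD _ _) _; apply: le_trans (lerD (ler_enormD _ _) aE) _.
  rewrite !enormZ (gtr0_norm h0).
  have l1 : h * (`|m - u| * enorm T) <= h * (4 * C * h * C).
    by rewrite ler_pM2l// ler_pM ?enorm_ge0.
  have l2 := ler_pM (normr_ge0 _) (enorm_ge0 _) ah qB.
  have l3 : 128 * C * h ^+ 3 <= 16 * C * h ^+ 2.
    rewrite -[leRHS](_ : 8^-1 * (128 * C) * h ^+ 2 = _); last by field.
    by apply: ch => //; rewrite mulr_ge0// ltW.
  have l4 : C ^+ 2 * h ^+ 2 <= C ^+ 4 * h ^+ 2 by rewrite ler_pM2r// (le_trans C3).
  have l5 : C * h ^+ 2 <= C ^+ 2 * h ^+ 2 by rewrite ler_pM2r.
  rewrite (_ : h * (4 * C * h * C) = 4 * (C ^+ 2 * h ^+ 2)) in l1; last by ring.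
  rewrite -[leRHS]mulrA.
  have l6 : 0 <= C * h ^+ 2 by rewrite mulr_ge0// ltW.
  by move: l1 l2 l3 l4 l5 l6; rewrite -!mulrA; clear; lra.
have nq : `|dot q n| <= 16 * C ^+ 4 * h.
  have -> : dot q n = (m - u) * dot (2 *: XT + (m + u) *: TT) n.
    have := asym_eq as_mu zb; rewrite -/X -/T -/n -/XX -/XT -/TT -/u => e.
    rewrite dotC in e; rewrite -[LHS](subr0 (dot q n)) -e /q !dotE; ring.
  apply: le_trans (ler_normM mmu (_ : _ <= 4 * C * C ^+ 2)) _.
    apply: ler_dot_bd => //; apply: le_trans (ler_enormD _ _) _; rewrite !enormZ.
    have l1 : `|2| * enorm XT <= 2 * C by rewrite ger0_norm// ler_pM2l.
    have l2 : `|m + u| * enorm TT <= 2 * C.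
      apply: ler_pM; rewrite ?enorm_ge0//; apply: le_trans (ler_normD _ _) _.
      by move: m1 mB; clear; lra.
    by move: l1 l2; clear; lra.
  by rewrite le_eqVlt; apply/orP; left; apply/eqP; ring.
have Xn : dot (h *: (X + m *: T)) n = 0.
  rewrite dotZl dotDl dotZl (dotC X) (dotC T) /n dot_crossl dot_crossr.
  by rewrite mulr0 addr0 mulr0.
rewrite fE dotDl dotDl Xn add0r (dotZl (2^-1 * _ * _)).
have l1 := ler_normM ah nq.
have l2 : `|dot (a^-1 *: E) n| <= 128 * C * h ^+ 3 * C ^+ 2 by exact: ler_dot_bd.
apply: le_trans (ler_normD _ _) _; apply: le_trans (lerD l1 l2) _.
have l3 : C ^+ 3 * h ^+ 3 <= C ^+ 4 * h ^+ 3 by rewrite ler_pM2r.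
rewrite (_ : 128 * C * h ^+ 3 * C ^+ 2 = 128 * (C ^+ 3 * h ^+ 3)); last by ring.
rewrite (_ : h ^+ 2 * (16 * C ^+ 4 * h) = 16 * (C ^+ 4 * h ^+ 3)); last by ring.
rewrite -mulrA.
have l4 : 0 <= C ^+ 4 * h ^+ 3 by rewrite mulr_ge0 ?exprn_ge0// ltW.
by move: l3 l4; clear; lra.
Qed.

Lemma crossC (a b : 'rV[R]_3) : cross a b = - cross b a.
Proof. by apply: rV3P; rewrite !mxE; ring. Qed.

Lemma edge_t F Fx Ft Fxx Fxt Ftt rho C nu (h b m x t : R) : 1 <= C ->
  jet2 F Fx Ft Fxx Fxt Ftt rho C ->
  asymptotic (swap Ft) (swap Fx) (swap Ftt) (swap Fxt) (swap Fxx) rho C (swap nu) ->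
  0 < h <= 8^-1 -> 2^-1 <= `|b| <= 2 -> box rho x t ->
  box rho (x + h * b * m) (t + h * b) -> `|m| <= 1 -> `|m - nu x t| <= 4 * C * h ->
  let g := b^-1 *: (F (x + h * b * m) (t + h * b) - F x t) in
  enorm (g - h *: (nu x t *: Fx x t + Ft x t)) <= 1000 * C ^+ 4 * h ^+ 2 /\
  `|dot g (cross (Fx x t) (Ft x t))| <= 1000 * C ^+ 4 * h ^+ 3.
Proof.
move=> C1 /jet2_swap j as_nu hh bb /box_swap zb /box_swap z'b m1 mnu.
move=> g; have [p q] := edge_x C1 j as_nu hh bb zb z'b m1 mnu.
split; first by rewrite [_ *: _ + _]addrC; exact: p.
by rewrite crossC dotNr normrN; exact: q.
Qed.

End jet.

(** * Nets with edges of prescribed slopes *)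

Section net.
Context {R : realType}.

(** Both the vertices of the net and the stresses of its edges are obtained in this way, from
    values on two sides; the rule depends on the cell in the case of the stresses. *)
Lemma goursat (T : Type) (left bot : nat -> T) (step : nat -> nat -> T -> T -> T -> T) :
  left 0%N = bot 0%N ->
  exists Z : nat -> nat -> T,
    [/\ forall j, Z 0%N j = left j, forall i, Z i 0%N = bot i &
        forall i j, Z i.+1 j.+1 = step i j (Z i j) (Z i j.+1) (Z i.+1 j)].
Proof.
move=> lb.
pose Z := fix Z i := match i with
  | 0%N => left
  | i'.+1 => fix row j := match j with
    | 0%N => bot i'.+1
    | j'.+1 => step i' j' (Z i' j') (Z i' j'.+1) (row j')
    end
  end.
by exists Z; split => // -[|i].
Qed.

(** Every edge follows one of the two fields of slopes at its origin, so that the last vertex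
    of a cell is the intersection of two lines. As the fields are Lipschitz, opposite edges of
    a cell differ by the factor [1 + O(h)], and the factors [a], [b] stay near 1 along the
    [N] = [8 r / h] edges of a row. The net starts at [(- 2 r, - 2 r)] in order to surround the
    square [|x|, |t| <= r]. *)
Lemma net_exists (mu nu : R -> R -> R) (rho C h r : R) (N : nat) :
  1 <= C -> 0 < h -> N%:R * h = 8 * r -> h <= r -> 12 * r <= rho -> 64 * C * r <= 1 ->
  (forall x t, `|mu x t| <= 100^-1) -> (forall x t, `|nu x t| <= 100^-1) ->
  (forall x t x' t', box rho x t -> box rho x' t' ->
    `|mu x' t' - mu x t| <= C * (`|x' - x| + `|t' - t|)) ->
  (forall x t x' t', box rho x t -> box rho x' t' ->
    `|nu x' t' - nu x t| <= C * (`|x' - x| + `|t' - t|)) ->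
  exists x t a b : nat -> nat -> R,
  [/\ forall i j, x i.+1 j = x i j + h * a i j /\
        t i.+1 j = t i j + h * a i j * mu (x i j) (t i j),
      forall i j, x i j.+1 = x i j + h * b i j * nu (x i j) (t i j) /\
        t i j.+1 = t i j + h * b i j,
      forall i j, (i <= N)%N -> (j <= N)%N ->
        `|a i j - 1| <= 4^-1 /\ `|b i j - 1| <= 4^-1,
      forall i j, (i <= N)%N -> (j <= N)%N ->
        - (2 * r) + 3 / 4 * (h * i%:R) - (h * j%:R) / 40 <= x i j
          <= - (2 * r) + 5 / 4 * (h * i%:R) + (h * j%:R) / 40 &
      forall i j, (i <= N)%N -> (j <= N)%N ->
        - (2 * r) + 3 / 4 * (h * j%:R) - (h * i%:R) / 40 <= t i j
          <= - (2 * r) + 5 / 4 * (h * j%:R) + (h * i%:R) / 40].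
Proof.
move=> C1 h0 Nh hr r12 rC mu1 nu1 muL nuL.
have C0 : 0 < C by apply: lt_le_trans C1.
have r0 : 0 < r by apply: lt_le_trans hr.
pose M (z : R * R) := mu z.1 z.2; pose V (z : R * R) := nu z.1 z.2.
pose bot i := iter i (fun z => (z.1 + h, z.2 + h * M z)) (- (2 * r), - (2 * r)).
pose left j := iter j (fun z => (z.1 + h * V z, z.2 + h)) (- (2 * r), - (2 * r)).
(* the intersection of the lines through [Q] of slope [M Q] and through [P] of slope [V P] *)
pose step (S Q P : R * R) :=
  let X := (P.1 + V P * (Q.2 - P.2 - M Q * Q.1)) / (1 - M Q * V P) in
  (X, Q.2 + M Q * (X - Q.1)).
have [Z [ZL ZB ZS]] := @goursat _ left bot (fun _ _ => step) erefl.
have den z z' : 1 - M z * V z' != 0.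
  have := ler_normM (mu1 z.1 z.2) (nu1 z'.1 z'.2); rewrite ler_norml -/(M z) -/(V z').
  by clear; move: (M z * V z') => y; rewrite subr_eq0 => /andP[_ y1]; apply/eqP => e; lra.
pose x i j := (Z i j).1; pose t i j := (Z i j).2.
pose a i j := (x i.+1 j - x i j) / h; pose b i j := (t i j.+1 - t i j) / h.
have h_n0 : h != 0 by rewrite gt_eqF.
have relx i j : x i.+1 j = x i j + h * a i j by rewrite /a; field.
have relt i j : t i j.+1 = t i j + h * b i j by rewrite /b; field.
have rel1 i j : t i.+1 j = t i j + h * a i j * M (Z i j).
  case: j => [|j]; first by rewrite /a /x /t !ZB /=; field.
  by rewrite /a /x /t ZS /=; field; rewrite h_n0 den.
have rel2 i j : x i j.+1 = x i j + h * b i j * V (Z i j).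
  case: i => [|i]; first by rewrite /b /x /t !ZL /=; field.
  by rewrite /b /x /t ZS /=; field; rewrite h_n0 den.
have a0 i : a i 0%N = 1 by rewrite /a /x !ZB /= addrAC subrr add0r divff.
have b0 j : b 0%N j = 1 by rewrite /b /t !ZL /= addrAC subrr add0r divff.
pose good i j := [/\ `|a i j - 1| <= 2 * C * (h * j%:R),
   `|b i j - 1| <= 2 * C * (h * i%:R),
   - (2 * r) + 3 / 4 * (h * i%:R) - (h * j%:R) / 40 <= x i j
          <= - (2 * r) + 5 / 4 * (h * i%:R) + (h * j%:R) / 40 &
   - (2 * r) + 3 / 4 * (h * j%:R) - (h * i%:R) / 40 <= t i j
          <= - (2 * r) + 5 / 4 * (h * j%:R) + (h * i%:R) / 40].
have hN i : (i <= N)%N -> 0 <= h * i%:R <= 8 * r.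
  move=> iN; apply/andP; split; first by rewrite mulr_ge0// ltW.
  by rewrite -Nh mulrC ler_pM2r// ler_nat.
have C16 i : (i <= N)%N -> 2 * C * (h * i%:R) <= 4^-1.
  move=> /hN /andP[_]; rewrite -(ler_pM2l (_ : 0 < 2 * C)) ?mulr_gt0//.
  by move: rC; clear; lra.
have hS i : h * i.+1%:R = h * i%:R + h by rewrite -natr1 mulrDr mulr1.
have stepx i j : (i <= N)%N -> (j <= N)%N -> good i j ->
   [/\ box rho (x i j) (t i j), box rho (x i.+1 j) (t i.+1 j),
       - (2 * r) + 3 / 4 * (h * i.+1%:R) - (h * j%:R) / 40 <= x i.+1 j
          <= - (2 * r) + 5 / 4 * (h * i.+1%:R) + (h * j%:R) / 40 &
       - (2 * r) + 3 / 4 * (h * j%:R) - (h * i.+1%:R) / 40 <= t i.+1 j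
          <= - (2 * r) + 5 / 4 * (h * j%:R) + (h * i.+1%:R) / 40].
  move=> iN jN [ga _ /andP[x1 x2] /andP[t1 t2]].
  have /andP[i1 i2] := hN _ iN; have /andP[j1 j2] := hN _ jN.
  have {}ga : `|a i j - 1| <= 4^-1 := le_trans ga (C16 _ jN).
  have a2 : `|a i j| <= 5 / 4 by move: (ler_normP ga); rewrite normr1; clear; lra.
  have am : `|h * a i j * M (Z i j)| <= h / 40.
    rewrite -mulrA normrM gtr0_norm// ler_pM2l//.
    by apply: le_trans (ler_normM a2 (mu1 _ _)) _; clear; lra.
  have ha : 3 / 4 * h <= h * a i j <= 5 / 4 * h.
    by rewrite !(mulrC _ h) !ler_pM2l//; move: ga; rewrite ler_norml; clear; lra.
  move: ha am; rewrite /box relx rel1 !ler_norml hS; clear -x1 x2 t1 t2 i1 i2 j1 j2 hr r12.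
  move: (h * a i j) (h * a i j * _) => v u /andP[? ?] /andP[? ?].
  by split; [split|split|..]; apply/andP; split; lra.
have stept i j : (i <= N)%N -> (j <= N)%N -> good i j ->
   [/\ box rho (x i j) (t i j), box rho (x i j.+1) (t i j.+1),
       - (2 * r) + 3 / 4 * (h * i%:R) - (h * j.+1%:R) / 40 <= x i j.+1
          <= - (2 * r) + 5 / 4 * (h * i%:R) + (h * j.+1%:R) / 40 &
       - (2 * r) + 3 / 4 * (h * j.+1%:R) - (h * i%:R) / 40 <= t i j.+1
          <= - (2 * r) + 5 / 4 * (h * j.+1%:R) + (h * i%:R) / 40].
  move=> iN jN [_ gb /andP[x1 x2] /andP[t1 t2]].
  have /andP[i1 i2] := hN _ iN; have /andP[j1 j2] := hN _ jN.
  have {}gb : `|b i j - 1| <= 4^-1 := le_trans gb (C16 _ iN).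
  have b2 : `|b i j| <= 5 / 4 by move: (ler_normP gb); rewrite normr1; clear; lra.
  have bm : `|h * b i j * V (Z i j)| <= h / 40.
    rewrite -mulrA normrM gtr0_norm// ler_pM2l//.
    by apply: le_trans (ler_normM b2 (nu1 _ _)) _; clear; lra.
  have hb : 3 / 4 * h <= h * b i j <= 5 / 4 * h.
    by rewrite !(mulrC _ h) !ler_pM2l//; move: gb; rewrite ler_norml; clear; lra.
  move: hb bm; rewrite /box relt rel2 !ler_norml hS; clear -x1 x2 t1 t2 i1 i2 j1 j2 hr r12.
  move: (h * b i j) (h * b i j * _) => v u /andP[? ?] /andP[? ?].
  by split; [split|split|..]; apply/andP; split; lra.
(* two ways around a cell lead to the same vertex, with slopes that differ by [O(h)] *)
have diag i j : (i <= N)%N -> (j <= N)%N -> good i j ->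
   `|a i j.+1 - a i j| <= 2 * C * h /\ `|b i.+1 j - b i j| <= 2 * C * h.
  move=> iN jN g; have [zb Pb _ _] := stepx _ _ iN jN g.
  have [_ Qb _ _] := stept _ _ iN jN g.
  case: g => ga gb _ _.
  have {}ga : `|a i j - 1| <= 4^-1 := le_trans ga (C16 _ jN).
  have {}gb : `|b i j - 1| <= 4^-1 := le_trans gb (C16 _ iN).
  have a2 : `|a i j| <= 5 / 4 by move: (ler_normP ga); rewrite normr1; clear; lra.
  have b2 : `|b i j| <= 5 / 4 by move: (ler_normP gb); rewrite normr1; clear; lra.
  have e1 : a i j.+1 - a i j =
      (b i.+1 j - b i j) * V (Z i.+1 j) + b i j * (V (Z i.+1 j) - V (Z i j)).
    by apply: (mulfI h_n0); have := rel2 i.+1 j; rewrite !relx rel2; clear; lra.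
  have e2 : b i.+1 j - b i j =
      (a i j.+1 - a i j) * M (Z i j.+1) + a i j * (M (Z i j.+1) - M (Z i j)).
    by apply: (mulfI h_n0); have := rel1 i j.+1; rewrite !relt rel1; clear; lra.
  have inc u s : `|u| <= 5 / 4 -> `|s| <= 100^-1 ->
      C * (`|h * u| + `|h * u * s|) <= 101 / 80 * C * h.
    move=> u1 s1; rewrite (_ : 101 / 80 * C * h = C * (101 / 80 * h)); last by ring.
    rewrite ler_pM2l// !normrM (gtr0_norm h0) -mulrA -mulrDr mulrC ler_pM2r//.
    by have := ler_pM (normr_ge0 _) (normr_ge0 _) u1 s1; move: u1; clear; lra.
  have d1 : `|V (Z i.+1 j) - V (Z i j)| <= 101 / 80 * C * h.
    apply: le_trans (nuL _ _ _ _ zb Pb) _; rewrite relx rel1.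
    rewrite ![_ + _ - x i j]addrC ![_ + _ - t i j]addrC !addKr.
    exact: inc a2 (mu1 _ _).
  have d2 : `|M (Z i j.+1) - M (Z i j)| <= 101 / 80 * C * h.
    apply: le_trans (muL _ _ _ _ zb Qb) _; rewrite relt rel2 addrC.
    rewrite ![_ + _ - x i j]addrC ![_ + _ - t i j]addrC !addKr.
    exact: inc b2 (nu1 _ _).
  have q1 := ler_normM b2 d1; have q2 := ler_normM a2 d2.
  have q3 := ler_normM (lexx `|b i.+1 j - b i j|) (nu1 (Z i.+1 j).1 (Z i.+1 j).2).
  have q4 := ler_normM (lexx `|a i j.+1 - a i j|) (mu1 (Z i j.+1).1 (Z i j.+1).2).
  have p1 : `|a i j.+1 - a i j| <= `|b i.+1 j - b i j| / 100 + 5 / 4 * (101 / 80 * C * h).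
    by rewrite {1}e1; apply: le_trans (ler_normD _ _) _; exact: lerD.
  have p2 : `|b i.+1 j - b i j| <= `|a i j.+1 - a i j| / 100 + 5 / 4 * (101 / 80 * C * h).
    by rewrite {1}e2; apply: le_trans (ler_normD _ _) _; exact: lerD.
  have Ch : 0 <= C * h by rewrite mulr_ge0 ?ltW.
  by move: p1 p2 Ch; clear; split; lra.
have gen i j : (i <= N)%N -> (j <= N)%N -> good i j.
  elim: i j => [|i IHi] j.
    move=> _; elim: j => [|j IHj] jN.
      split; rewrite ?a0 ?b0 ?subrr ?normr0 ?mulr0//.
      - by rewrite /x ZL /=; clear -r0; lra.
      - by rewrite /t ZL /=; clear -r0; lra.
    have {}IHj := IHj (ltnW jN).
    have [_ _ ? ?] := stept _ _ (leq0n N) (ltnW jN) IHj.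
    have [da _] := diag _ _ (leq0n N) (ltnW jN) IHj.
    split => //; last by rewrite b0 subrr normr0 mulr0 mulr0.
    case: IHj => ga _ _ _; rewrite hS; have := ler_normD (a 0%N j.+1 - a 0%N j) (a 0%N j - 1).
    by rewrite addrA subrK; move: ga da; clear; lra.
  elim: j => [|j IHj] iN jN.
    have g := IHi 0%N (ltnW iN) jN.
    have [_ _ ? ?] := stepx _ _ (ltnW iN) jN g.
    have [_ db] := diag _ _ (ltnW iN) jN g.
    split => //; first by rewrite a0 subrr normr0 mulr0 mulr0.
    case: g => _ gb _ _; rewrite hS; have := ler_normD (b i.+1 0%N - b i 0%N) (b i 0%N - 1).
    by rewrite addrA subrK; move: gb db; clear; lra.
  have g1 := IHi j.+1 (ltnW iN) jN.
  have g2 := IHj iN (ltnW jN).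
  have [_ _ ? ?] := stepx _ _ (ltnW iN) jN g1.
  have [_ db] := diag _ _ (ltnW iN) jN g1.
  have [da _] := diag _ _ iN (ltnW jN) g2.
  split => //.
    case: g2 => ga _ _ _; rewrite hS.
    have := ler_normD (a i.+1 j.+1 - a i.+1 j) (a i.+1 j - 1).
    by rewrite addrA subrK; move: ga da; clear; lra.
  case: g1 => _ gb _ _; rewrite hS.
  have := ler_normD (b i.+1 j.+1 - b i j.+1) (b i j.+1 - 1).
  by rewrite addrA subrK; move: gb db; clear; lra.
exists x, t, a, b; split => // i j iN jN.
- by case: (gen _ _ iN jN) => ga gb _ _; split; [exact: le_trans ga (C16 _ jN)|exact: le_trans gb (C16 _ iN)].
- by case: (gen _ _ iN jN).
- by case: (gen _ _ iN jN).
Qed.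

End net.

(** * Stress energy of a competitor on a net *)

Section energy.
Context {R : realType}.
Implicit Types (F Fx Ft Fxx Fxt Ftt G : R -> R -> 'rV[R]_3) (mu nu : R -> R -> R).

Lemma sum_by_parts (p w : nat -> 'rV[R]_3) N : w 0%N = 0 -> w N = 0 ->
  \sum_(0 <= i < N) dot (p i) (w i.+1 - w i) =
  - \sum_(1 <= i < N) dot (p i - p i.-1) (w i).
Proof.
move=> w0; case: N => [|N] wN; first by rewrite !big_geq// oppr0.
suff H n : \sum_(0 <= i < n.+1) dot (p i) (w i.+1 - w i) =
    dot (p n) (w n.+1) - \sum_(1 <= i < n.+1) dot (p i - p i.-1) (w i).
  by rewrite H wN dot0r add0r.
elim: n => [|n IHn].
  by rewrite big_nat1 [in RHS]big_geq// w0 subr0 subr0.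
rewrite big_nat_recr//= IHn [in RHS]big_nat_recr//= !dotE; ring.
Qed.

Lemma sum_nat_le (f : nat -> R) (e : R) m N : 0 <= e ->
  (forall i, (m <= i < N)%N -> f i <= e) -> \sum_(m <= i < N) f i <= N%:R * e.
Proof.
move=> e0 fe; rewrite big_nat; apply: le_trans (ler_sum _ fe) _.
by rewrite -big_nat sumr_const_nat -[_ *+ (N - m)]mulr_natl ler_wpM2r// ler_nat leq_subr.
Qed.

(** The infinitesimal form of not increasing the lengths of curves, in terms of chords. *)
Definition short_for Fx Ft (rho C : R) G : Prop :=
  forall x t x' t', box rho x t -> box rho x' t' ->
    enorm (G x' t' - G x t) <= enorm ((x' - x) *: Fx x t + (t' - t) *: Ft x t)
      + C * (`|x' - x| + `|t' - t|) ^+ 2.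

Lemma enorm_diff_le Fx Ft rho C x t (u v : R) :
  bounded_lip rho C Fx -> bounded_lip rho C Ft -> box rho x t ->
  enorm (u *: Fx x t + v *: Ft x t) <= C * (`|u| + `|v|).
Proof.
move=> [xb _] [tb _] zb; apply: le_trans (ler_enormD _ _) _; rewrite !enormZ mulrDr.
by rewrite ![C * _]mulrC lerD// ler_wpM2l ?xb ?tb.
Qed.

Lemma jet_taylor1 F Fx Ft Fxx Fxt Ftt rho C x t x' t' :
  jet2 F Fx Ft Fxx Fxt Ftt rho C -> box rho x t -> box rho x' t' -> 0 <= C ->
  `|x' - x| + `|t' - t| <= 1 -> 
  enorm (F x' t' - F x t - ((x' - x) *: Fx x t + (t' - t) *: Ft x t)) <=
    2 * C * (`|x' - x| + `|t' - t|) ^+ 2.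
Proof.
move=> j zb zb' C0 d1; have := jet_taylor j zb zb'.
set u := x' - x in d1 *; set v := t' - t in d1 *; set E := _ - (_ + v *: _).
set Q := _ + v ^+ 2 *: _; set d := `|u| + `|v| in d1 *.
have d0 : 0 <= d by rewrite addr_ge0.
have [[xxB _] [xtB _]] := (jet_xx j, jet_xt j); have [ttB _] := jet_tt j.
have QB : enorm Q <= C * d ^+ 2.
  apply: le_trans (ler_enormD _ _) _; apply: le_trans (lerD (ler_enormD _ _) (lexx _)) _.
  rewrite !enormZ !normrM (ger0_norm (ler0n _ 2)).
  have l1 := ler_wpM2l (mulr_ge0 (normr_ge0 u) (normr_ge0 u)) (xxB _ _ zb).
  have l2 := ler_wpM2l (mulr_ge0 (normr_ge0 u) (normr_ge0 v)) (xtB _ _ zb).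
  have l3 := ler_wpM2l (mulr_ge0 (normr_ge0 v) (normr_ge0 v)) (ttB _ _ zb).
  move: l1 l2 l3; rewrite /d; clear; move: (enorm _) (enorm _) (enorm _) => p q s.
  by move: `|u| `|v| => {}u {}v; nra.
have d3 : C * d ^+ 3 <= C * d ^+ 2.
  by rewrite ler_wpM2l// (exprS _ 2) ler_piMl// sqr_ge0.
have := ler_enormD (E - 2^-1 *: Q) (2^-1 *: Q); rewrite subrK enormZ ger0_norm//.
have d2 : 0 <= C * d ^+ 2 by rewrite mulr_ge0// sqr_ge0.
by move: QB d3 d2; clear; lra.
Qed.

(** Writing [W = G - F], this is [|dG|^2 = |dF|^2 + 2 dF.dW + |dW|^2] together with
    [|dG| <= |dF| + O(h^2)]. *)
Lemma edge_energy F Fx Ft Fxx Fxt Ftt rho C G x t x' t' h :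
  jet2 F Fx Ft Fxx Fxt Ftt rho C -> short_for Fx Ft rho C G ->
  box rho x t -> box rho x' t' -> 1 <= C -> 0 < h <= 8^-1 ->
  `|x' - x| + `|t' - t| <= 4 * h ->
  enorm (G x' t' - F x' t' - (G x t - F x t)) ^+ 2 <=
    - 2 * dot (F x' t' - F x t) (G x' t' - F x' t' - (G x t - F x t))
    + 1000 * C ^+ 2 * h ^+ 3.
Proof.
move=> j sh zb zb' C1 /andP[h0 h8] d4.
have C0 : 0 <= C by apply: le_trans C1.
have d1 : `|x' - x| + `|t' - t| <= 1 by apply: le_trans d4 _; move: h8; clear; lra.
have FB := jet_taylor1 j zb zb' C0 d1; have GB := sh _ _ _ _ zb zb'.
have DB := enorm_diff_le (x' - x) (t' - t) (jet_x j) (jet_t j) zb.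
set d := `|_| + _ in d1 d4 FB GB DB.
set D := (_ *: _ + _ *: _) in FB GB DB.
have d0 : 0 <= d by rewrite addr_ge0.
have -> : G x' t' - F x' t' - (G x t - F x t) = (G x' t' - G x t) - (F x' t' - F x t).
  by apply/rowP => i; rewrite !mxE; ring.
set dG := G _ _ - _ in GB *; set dF := F _ _ - _ in FB *.
have d2 : d ^+ 2 <= 16 * h ^+ 2.
  by rewrite (_ : 16 * h ^+ 2 = (4 * h) ^+ 2) ?lerXn2r ?nnegrE//; [rewrite mulr_ge0// ltW|ring].
have GB' : enorm dG <= enorm D + 16 * C * h ^+ 2.
  by apply: le_trans GB _; have := ler_wpM2l C0 d2; clear; lra.
have FB' : enorm D <= enorm dF + 32 * C * h ^+ 2.
  have := ler_enorm_dist dF D; rewrite ler_norml => /andP[l1 _].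
  by have := ler_wpM2l C0 d2; move: FB l1; clear; lra.
have DB' : enorm D <= 4 * C * h by apply: le_trans DB _; have := ler_wpM2l C0 d4; clear; lra.
clearbody dG dF D.
have := sqr_enormE (dG - dF); have := sqr_enormE dG; have := sqr_enormE dF.
rewrite !dotE (dotC dF dG); set gf := dot dG dF => <- <- ->.
have e0 : 0 <= C * h ^+ 2 by rewrite mulr_ge0// sqr_ge0.
have Ch : 0 <= C * h by rewrite mulr_ge0// ltW.
have s1 : enorm dG ^+ 2 <= (enorm D + 16 * C * h ^+ 2) ^+ 2.
  by rewrite lerXn2r ?nnegrE ?addr_ge0 ?enorm_ge0// -mulrA mulr_ge0.
have s2 : enorm D ^+ 2 <= (enorm dF + 32 * C * h ^+ 2) ^+ 2.
  by rewrite lerXn2r ?nnegrE ?addr_ge0 ?enorm_ge0// -mulrA mulr_ge0.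
have FB2 : enorm dF <= 8 * C * h.
  have := ler_enorm_dist dF D; rewrite ler_norml => /andP[_ l1].
  have l2 : C * h ^+ 2 <= C * h * 8^-1 by rewrite expr2 mulrA ler_wpM2l.
  by have := ler_wpM2l C0 d2; move: FB l1 l2 DB' Ch; clear; lra.
have s3 := ler_wpM2l e0 DB'; have s4 := ler_wpM2l e0 FB2.
have s5 : (C * h ^+ 2) * (C * h ^+ 2) <= (C * h ^+ 2) * (C * h * 8^-1).
  by rewrite ler_wpM2l// expr2 mulrA ler_wpM2l.
move: s1 s2 s3 s4 s5; rewrite !sqrrD.
by have s6 := mulr_ge0 e0 Ch; move: s6; clear; lra.
Qed.

Lemma defect_lip F Fx Ft Fxx Fxt Ftt rho C G x t x' t' :
  jet2 F Fx Ft Fxx Fxt Ftt rho C -> short_for Fx Ft rho C G ->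
  box rho x t -> box rho x' t' -> 1 <= C -> rho <= 4^-1 ->
  enorm (G x' t' - F x' t' - (G x t - F x t)) <= 5 * C * (`|x' - x| + `|t' - t|).
Proof.
move=> j sh zb zb' C1 r4.
have C0 : 0 <= C by apply: le_trans C1.
have d1 : `|x' - x| + `|t' - t| <= 1.
  have := ler_normB x' x; have := ler_normB t' t; case: zb zb' => ? ? [? ?].
  by move: r4; lra.
have FB := jet_taylor1 j zb zb' C0 d1; have GB := sh _ _ _ _ zb zb'.
have DB := enorm_diff_le (x' - x) (t' - t) (jet_x j) (jet_t j) zb.
set d := `|_| + _ in d1 FB GB DB *; set D := (_ *: _ + _ *: _) in FB GB DB.
have d0 : 0 <= d by rewrite addr_ge0.
have d2 : C * d ^+ 2 <= C * d by rewrite ler_wpM2l// expr2 ler_piMl.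
have -> : G x' t' - F x' t' - (G x t - F x t) =
    (G x' t' - G x t) - (F x' t' - F x t - D) - D.
  by apply/rowP => i; rewrite !mxE; ring.
apply: le_trans (ler_enormB _ _) _; apply: le_trans (lerD (ler_enormB _ _) (lexx _)) _.
by move: FB GB DB d2; clear; lra.
Qed.

(** The stress energy of the defect of a competitor on a fine asymptotic net is of the
    order of the mesh: the competitor does not increase the length of any edge, so up to
    the discretisation error it can only lower the energy, while the equilibrium of the
    stresses makes the surface itself the minimiser. *)
Lemma net_energy F Fx Ft Fxx Fxt Ftt mu nu (rho C c r K' h0 : R) G :
  jet2 F Fx Ft Fxx Fxt Ftt rho C -> asymptotic Fx Ft Fxx Fxt Ftt rho C mu ->
  asymptotic (swap Ft) (swap Fx) (swap Ftt) (swap Fxt) (swap Fxx) rho C (swap nu) ->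
  1 <= C -> 0 < c -> rho <= 4^-1 -> 12 * r <= rho -> 64 * C * r <= 1 ->
  0 < K' -> 16 * K' * r <= 1 ->
  (forall x t, box rho x t -> c <= dot (cross (Fx x t) (Ft x t)) (cross (Fx x t) (Ft x t))) ->
  (forall (h : R) X T f f' g g' (mu nu A' B' : R), 0 < h <= h0 ->
    enorm X <= C -> enorm T <= C -> c <= dot (cross X T) (cross X T) ->
    `|mu| <= 100^-1 -> `|nu| <= 100^-1 ->
    enorm (f - h *: (X + mu *: T)) <= 1000 * C ^+ 4 * h ^+ 2 ->
    enorm (f' - h *: (X + mu *: T)) <= 1000 * C ^+ 4 * h ^+ 2 ->
    enorm (g - h *: (nu *: X + T)) <= 1000 * C ^+ 4 * h ^+ 2 ->
    enorm (g' - h *: (nu *: X + T)) <= 1000 * C ^+ 4 * h ^+ 2 ->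
    `|dot f (cross X T)| <= 1000 * C ^+ 4 * h ^+ 3 ->
    `|dot f' (cross X T)| <= 1000 * C ^+ 4 * h ^+ 3 ->
    `|dot g (cross X T)| <= 1000 * C ^+ 4 * h ^+ 3 ->
    `|dot g' (cross X T)| <= 1000 * C ^+ 4 * h ^+ 3 ->
    0 <= A' <= 2 -> 0 <= B' <= 2 ->
    exists AB : R * R, [/\ `|AB.1 - A'| <= K' * h, `|AB.2 - B'| <= K' * h &
      enorm (AB.1 *: f - A' *: f' + (AB.2 *: g - B' *: g')) <= K' * h ^+ 3]) ->
  (forall x t, r ^+ 2 <= x ^+ 2 + t ^+ 2 -> box rho x t -> G x t = F x t) ->
  short_for Fx Ft rho C G ->
  forall (N : nat) h, 0 < h -> h <= h0 -> h <= 8^-1 -> h <= r -> N%:R * h = 8 * r ->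
  exists x t : nat -> nat -> R,
  [/\ forall i j, (i <= N)%N -> (j <= N)%N -> box rho (x i j) (t i j),
     forall k, (k <= N)%N ->
       [/\ x 0%N k < - r, r < x N k, t k 0%N < - r & r < t k N],
     forall i j, (i < N)%N -> (j <= N)%N ->
       exists2 am : R * R, 3 / 4 <= am.1 <= 5 / 4 /\ `|am.2| <= 100^-1 &
         x i.+1 j = x i j + h * am.1 /\ t i.+1 j = t i j + h * am.1 * am.2,
     forall i j, (i <= N)%N -> (j < N)%N ->
       exists2 bm : R * R, 3 / 4 <= bm.1 <= 5 / 4 /\ `|bm.2| <= 100^-1 &
         t i j.+1 = t i j + h * bm.1 /\ x i j.+1 = x i j + h * bm.1 * bm.2 &
     let W i j := G (x i j) (t i j) - F (x i j) (t i j) in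
     \sum_(1 <= j < N) \sum_(0 <= i < N) enorm (W i.+1 j - W i j) ^+ 2
       <= 64 * r ^+ 2 * (40 * C * K' + 20000 * C ^+ 2) * h].
Proof.
move=> j as_mu as_nu C1 c0 r4 r12 rC K'0 rK' cr stress Gout sh N h h0p hh0 h8 hr Nh.
have C0 : 0 < C by apply: lt_le_trans C1.
have r0 : 0 < r by apply: lt_le_trans hr.
have nu_small x t : `|nu x t| <= 100^-1 by exact: (asym_small as_nu t x).
have nu_lip x t x' t' : box rho x t -> box rho x' t' ->
    `|nu x' t' - nu x t| <= C * (`|x' - x| + `|t' - t|).
  by move=> /box_swap zb /box_swap zb'; rewrite (addrC `|x' - x|); exact: (asym_lip as_nu zb zb').
have [x [t [a [b [Ha Hb ab Hx Ht]]]]] := net_exists C1 h0p Nh hr r12 rC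
  (asym_small as_mu) nu_small (asym_lip as_mu) nu_lip.
have hN i : (i <= N)%N -> 0 <= h * i%:R <= 8 * r.
  move=> iN; apply/andP; split; first by rewrite mulr_ge0// ltW.
  by rewrite -Nh mulrC ler_pM2r// ler_nat.
have zbox i k : (i <= N)%N -> (k <= N)%N -> box rho (x i k) (t i k).
  move=> iN kN; have := Hx _ _ iN kN; have := Ht _ _ iN kN.
  have := hN _ iN; have := hN _ kN; rewrite /box !ler_norml; move: r12; clear.
  by move=> ? /andP[? ?] /andP[? ?] /andP[? ?] /andP[? ?]; split; apply/andP; split; lra.
have bdry k : (k <= N)%N ->
    [/\ x 0%N k < - r, r < x N k, t k 0%N < - r & r < t k N].
  move=> kN; have := Hx _ _ (leq0n N) kN; have := Hx _ _ (leqnn N) kN.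
  have := Ht _ _ kN (leq0n N); have := Ht _ _ kN (leqnn N).
  have := hN _ kN; rewrite (mulrC h N%:R) Nh mulr0; move: r0; clear.
  by move=> ? /andP[? ?] /andP[? ?] /andP[? ?] /andP[? ?] /andP[? ?]; split; lra.
have aB i k : (i <= N)%N -> (k <= N)%N -> 3 / 4 <= a i k <= 5 / 4.
  by move=> iN kN; have [] := ab _ _ iN kN; rewrite ler_norml; clear; lra.
have bB i k : (i <= N)%N -> (k <= N)%N -> 3 / 4 <= b i k <= 5 / 4.
  by move=> iN kN; have [_] := ab _ _ iN kN; rewrite ler_norml; clear; lra.
exists x, t; split => //.
- move=> i k iN kN; exists (a i k, mu (x i k) (t i k)); last exact: Ha.
  by split; [exact: aB (ltnW iN) kN|exact: asym_small as_mu _ _].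
- move=> i k iN kN; exists (b i k, nu (x i k) (t i k)); last by case: (Hb i k).
  by split; [exact: bB iN (ltnW kN)|exact: nu_small].
pose Z (f : R -> R -> 'rV[R]_3) i k := f (x i k) (t i k).
pose f i k := (a i k)^-1 *: (Z F i.+1 k - Z F i k).
pose g i k := (b i k)^-1 *: (Z F i k.+1 - Z F i k).
have hh : 0 < h <= 8^-1 by rewrite h0p.
have Ch : 0 <= C * h by rewrite mulr_ge0 ?ltW.
pose n i k := cross (Z Fx i k) (Z Ft i k).
have inc (u s : R) : 3 / 4 <= u <= 5 / 4 -> `|s| <= 100^-1 ->
    `|h * u| + `|h * u * s| <= 4 * h.
  move=> /andP[u1 u2] s1; have u3 : `|u| <= 5 / 4 by rewrite ger0_norm//; move: u1; clear; lra.
  rewrite !normrM (gtr0_norm h0p) -mulrA -mulrDr (mulrC 4 h) ler_pM2l//.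
  by have := ler_pM (normr_ge0 _) (normr_ge0 _) u3 s1; move: u3; clear; lra.
have abs2 (u : R) : 3 / 4 <= u <= 5 / 4 -> 2^-1 <= `|u| <= 2.
  by move=> /andP[u1 u2]; rewrite ger0_norm; move: u1 u2; clear; lra.
have small1 (s : R) : `|s| <= 100^-1 -> `|s| <= 1 by clear; lra.
have mu1 i k : `|mu (x i k) (t i k)| <= 100^-1 := asym_small as_mu _ _.
have nu1 i k : `|nu (x i k) (t i k)| <= 100^-1 := nu_small _ _.
have stepx i k : (i < N)%N -> (k <= N)%N ->
    `|x i.+1 k - x i k| + `|t i.+1 k - t i k| <= 4 * h.
  move=> iN kN; have [-> ->] := Ha i k.
  rewrite ![_ + _ - x i k]addrC ![_ + _ - t i k]addrC !addKr.
  exact: inc (aB _ _ (ltnW iN) kN) (mu1 _ _).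
have stept i k : (i <= N)%N -> (k < N)%N ->
    `|x i k.+1 - x i k| + `|t i k.+1 - t i k| <= 4 * h.
  move=> iN kN; have [-> ->] := Hb i k; rewrite addrC.
  rewrite ![_ + _ - x i k]addrC ![_ + _ - t i k]addrC !addKr.
  exact: inc (bB _ _ iN (ltnW kN)) (nu1 _ _).
have eR i k : (i < N)%N -> (k <= N)%N ->
    enorm (f i k - h *: (Z Fx i k + mu (x i k) (t i k) *: Z Ft i k))
      <= 1000 * C ^+ 4 * h ^+ 2 /\ `|dot (f i k) (n i k)| <= 1000 * C ^+ 4 * h ^+ 3.
  move=> iN kN; rewrite /f /Z; have [-> ->] := Ha i k.
  apply: (edge_x C1 j as_mu hh (abs2 _ (aB _ _ (ltnW iN) kN)) (zbox _ _ (ltnW iN) kN)).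
  - by have [<- <-] := Ha i k; exact: zbox.
  - exact: small1.
  - by rewrite subrr normr0 -mulrA mulr_ge0.
have eL i k : (i < N)%N -> (k <= N)%N ->
    enorm (f i k - h *: (Z Fx i.+1 k + mu (x i.+1 k) (t i.+1 k) *: Z Ft i.+1 k))
      <= 1000 * C ^+ 4 * h ^+ 2 /\ `|dot (f i k) (n i.+1 k)| <= 1000 * C ^+ 4 * h ^+ 3.
  move=> iN kN; have [e1 e2] := Ha i k.
  have e1' : x i k = x i.+1 k + h * - a i k by rewrite e1; ring.
  have e2' : t i k = t i.+1 k + h * - a i k * mu (x i k) (t i k) by rewrite {1}e2; ring.
  have -> : f i k = (- a i k)^-1 *: (F (x i.+1 k + h * - a i k)
        (t i.+1 k + h * - a i k * mu (x i k) (t i k)) - Z F i.+1 k).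
    by rewrite -e1' -e2' invrN scaleNr -scalerN opprB.
  apply: (edge_x C1 j as_mu hh _ (zbox _ _ iN kN)).
  - by rewrite normrN; exact: abs2 (aB _ _ (ltnW iN) kN).
  - by rewrite -e1' -e2'; exact: zbox (ltnW iN) kN.
  - exact: small1.
  - apply: le_trans (asym_lip as_mu (zbox _ _ iN kN) (zbox _ _ (ltnW iN) kN)) _.
    rewrite (distrC (x i k)) (distrC (t i k)) (mulrC 4) -mulrA ler_pM2l//.
    exact: stepx.
have eU i k : (i <= N)%N -> (k < N)%N ->
    enorm (g i k - h *: (nu (x i k) (t i k) *: Z Fx i k + Z Ft i k))
      <= 1000 * C ^+ 4 * h ^+ 2 /\ `|dot (g i k) (n i k)| <= 1000 * C ^+ 4 * h ^+ 3.
  move=> iN kN; rewrite /g /Z; have [-> ->] := Hb i k.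
  apply: (edge_t C1 j as_nu hh (abs2 _ (bB _ _ iN (ltnW kN))) (zbox _ _ iN (ltnW kN))).
  - by have [<- <-] := Hb i k; exact: zbox.
  - exact: small1.
  - by rewrite subrr normr0 -mulrA mulr_ge0.
have eD i k : (i <= N)%N -> (k < N)%N ->
    enorm (g i k - h *: (nu (x i k.+1) (t i k.+1) *: Z Fx i k.+1 + Z Ft i k.+1))
      <= 1000 * C ^+ 4 * h ^+ 2 /\ `|dot (g i k) (n i k.+1)| <= 1000 * C ^+ 4 * h ^+ 3.
  move=> iN kN; have [e1 e2] := Hb i k.
  have e2' : t i k = t i k.+1 + h * - b i k by rewrite e2; ring.
  have e1' : x i k = x i k.+1 + h * - b i k * nu (x i k) (t i k) by rewrite {1}e1; ring.
  have -> : g i k = (- b i k)^-1 *: (F (x i k.+1 + h * - b i k * nu (x i k) (t i k))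
        (t i k.+1 + h * - b i k) - Z F i k.+1).
    by rewrite -e1' -e2' invrN scaleNr -scalerN opprB.
  apply: (edge_t C1 j as_nu hh _ (zbox _ _ iN kN)).
  - by rewrite normrN; exact: abs2 (bB _ _ iN (ltnW kN)).
  - by rewrite -e1' -e2'; exact: zbox iN (ltnW kN).
  - exact: small1.
  - apply: le_trans (nu_lip _ _ _ _ (zbox _ _ iN kN) (zbox _ _ iN (ltnW kN))) _.
    rewrite (distrC (x i k)) (distrC (t i k)) (mulrC 4) -mulrA ler_pM2l//.
    exact: stept.
(* the stresses equal 1 on two sides of the net and propagate by continuation across the nodes *)
pose P (p : (nat * nat) * (R * R)) (AB : R * R) :=
  (p.1.1.+1 < N)%N -> (p.1.2.+1 < N)%N -> 0 <= p.2.1 <= 2 -> 0 <= p.2.2 <= 2 ->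
  [/\ `|AB.1 - p.2.1| <= K' * h, `|AB.2 - p.2.2| <= K' * h &
    enorm (AB.1 *: f p.1.1.+1 p.1.2.+1 - p.2.1 *: f p.1.1 p.1.2.+1
      + (AB.2 *: g p.1.1.+1 p.1.2.+1 - p.2.2 *: g p.1.1.+1 p.1.2)) <= K' * h ^+ 3].
have /choice[sel selP] : forall p, exists AB, P p AB.
  move=> [[i k] [A' B']]; have [iN|] := boolP (i.+1 < N)%N; last by move=> /negP iN; exists (0, 0) => /iN.
  have [kN|] := boolP (k.+1 < N)%N; last by move=> /negP kN; exists (0, 0) => _ /kN.
  have [A2|] := boolP (0 <= A' <= 2); last by move=> /negP A2; exists (0, 0) => _ _ /A2.
  have [B2|] := boolP (0 <= B' <= 2); last by move=> /negP B2; exists (0, 0) => _ _ _ /B2.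
  have [r1 r2] := eR _ _ iN (ltnW kN); have [l1 l2] := eL _ _ (ltnW iN) (ltnW kN).
  have [u1 u2] := eU _ _ (ltnW iN) kN; have [d1 d2] := eD _ _ (ltnW iN) (ltnW kN).
  have zb := zbox _ _ (ltnW iN) (ltnW kN).
  have [xb _] := jet_x j; have [tb _] := jet_t j.
  have hb : 0 < h <= h0 by rewrite h0p.
  have [AB HAB] := stress h _ _ _ _ _ _ _ _ A' B' hb (xb _ _ zb) (tb _ _ zb) (cr _ _ zb)
    (mu1 _ _) (nu1 _ _) r1 l1 u1 d1 r2 l2 u2 d2 A2 B2.
  by exists AB.
have [S [S0j Si0 Srec]] := @goursat _ (fun=> (1, 1)) (fun=> (1, 1))
  (fun i k _ U V => sel ((i, k), (U.1, V.2))) erefl.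
have Kh i : (i <= N)%N -> K' * (h * i%:R) <= 2^-1.
  move=> /hN /andP[_]; rewrite -(ler_pM2l K'0); move: rK'; clear; lra.
have range2 (A : R) i : `|A - 1| <= K' * (h * i%:R) -> (i <= N)%N -> 2^-1 <= A <= 3 / 2.
  by move=> l /Kh; move: l; rewrite ler_norml; clear; lra.
have range0 (A : R) i : `|A - 1| <= K' * (h * i%:R) -> (i <= N)%N -> 0 <= A <= 2.
  by move=> l /(range2 _ _ l); clear; lra.
have Sgood i k : (i < N)%N -> (k < N)%N -> `|(S i k).1 - 1| <= K' * (h * i%:R) /\
    `|(S i k).2 - 1| <= K' * (h * k%:R).
  have Khi m : 0 <= K' * (h * m%:R) by rewrite !mulr_ge0// ltW.
  elim: i k => [|i IHi] k; first by rewrite S0j /= subrr normr0.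
  elim: k => [|k IHk] iN kN; first by rewrite Si0 /= subrr normr0.
  have [gA gA'] := IHi k.+1 (ltnW iN) kN; have [gB' gB] := IHk iN (ltnW kN).
  rewrite Srec.
  have := selP (i, k, ((S i k.+1).1, (S i.+1 k).2)) iN kN
    (range0 _ _ gA (ltnW (ltnW iN))) (range0 _ _ gB (ltnW (ltnW kN))).
  set AB := sel _ => -[dA dB _]; rewrite -!natr1 !mulrDr !mulr1.
  have := ler_normD (AB.1 - (S i k.+1).1) ((S i k.+1).1 - 1).
  have := ler_normD (AB.2 - (S i.+1 k).2) ((S i.+1 k).2 - 1).
  by rewrite !addrA !subrK; move: gA gB dA dB; clear; split; lra.
have res i k : (i.+1 < N)%N -> (k.+1 < N)%N ->
    enorm ((S i.+1 k.+1).1 *: f i.+1 k.+1 - (S i k.+1).1 *: f i k.+1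
      + ((S i.+1 k.+1).2 *: g i.+1 k.+1 - (S i.+1 k).2 *: g i.+1 k)) <= K' * h ^+ 3.
  move=> iN kN; rewrite (Srec i k).
  have [gA _] := Sgood i k.+1 (ltnW iN) kN; have [_ gB] := Sgood i.+1 k iN (ltnW kN).
  by have [] := selP (i, k, ((S i k.+1).1, (S i.+1 k).2)) iN kN
    (range0 _ _ gA (ltnW (ltnW iN))) (range0 _ _ gB (ltnW (ltnW kN))).
move=> W.
have W0 i k : (i <= N)%N -> (k <= N)%N -> r < `|x i k| \/ r < `|t i k| -> W i k = 0.
  move=> iN kN out; rewrite /W Gout ?subrr//; last exact: zbox.
  have sq (u : R) : r < `|u| -> r ^+ 2 <= u ^+ 2.
    by move=> ru; rewrite -(real_normK (num_real u)) lerXn2r ?nnegrE// ltW.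
  have := sqr_ge0 (x i k); have := sqr_ge0 (t i k).
  by case: out => /sq; clear; lra.
have Wb i k : (i <= N)%N -> (k <= N)%N -> enorm (W i k) <= 5 * C.
  move=> iN kN; have zb := zbox _ _ iN kN; have rb : box rho rho rho.
    by split; rewrite ger0_norm//; move: r12 r0; clear; lra.
  have e : G rho rho - F rho rho = 0.
    rewrite Gout ?subrr//.
    have : r ^+ 2 <= rho ^+ 2.
      by rewrite lerXn2r ?nnegrE//; move: r12 r0; clear; lra.
    by have := sqr_ge0 rho; clear; lra.
  have := defect_lip j sh rb zb C1 r4; rewrite e subr0 -/(W i k) => l.
  apply: le_trans l _; rewrite -[leRHS]mulr1; apply: ler_wpM2l; first by rewrite mulr_ge0 ?ltW.
  have := ler_normB (x i k) rho; have := ler_normB (t i k) rho.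
  by case: zb rb => z1 z2 [b1 b2]; move: r4 z1 z2 b1 b2; clear; lra.
(* [A / u] is the weight of an edge of stress [A] in the energy *)
have wgt (A u D : R) (p q : 'rV[R]_3) : 2^-1 <= A <= 3 / 2 -> 3 / 4 <= u <= 5 / 4 -> 0 <= D ->
    enorm q ^+ 2 <= - 2 * dot p q + D ->
    2 / 5 * enorm q ^+ 2 <= - 2 * dot (A *: (u^-1 *: p)) q + 2 * D.
  move=> /andP[A1 A2] /andP[u1 u2] D0 l.
  have u0 : 0 < u by apply: lt_le_trans u1; clear; lra.
  have w1 : 2 / 5 <= A / u by rewrite ler_pdivlMr//; move: A1 u2; clear; lra.
  have w2 : A / u <= 2 by rewrite ler_pdivrMr//; move: A2 u1; clear; lra.
  have w0 : 0 <= A / u by apply: le_trans w1; clear; lra.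
  rewrite scalerA dotZl; have := ler_wpM2l w0 l.
  have := ler_wpM2r (sqr_ge0 (enorm q)) w1; have := ler_wpM2r D0 w2; clear; lra.
have h3 : 0 <= h ^+ 3 := exprn_ge0 3 (ltW h0p).
pose D := 1000 * C ^+ 2 * h ^+ 3; have DE : 1000 * C ^+ 2 * h ^+ 3 = D by [].
have D0 : 0 <= D := mulr_ge0 (mulr_ge0 (ler0n R 1000) (sqr_ge0 C)) h3.
clearbody D.
have D2 : 0 <= 2 * D by rewrite mulr_ge0.
have ND : 0 <= N%:R * (2 * D) by rewrite mulr_ge0.
have E0 : 0 <= K' * h ^+ 3 * (5 * C).
  by rewrite mulr_ge0//; rewrite mulr_ge0// ltW.
have NE : 0 <= N%:R * (K' * h ^+ 3 * (5 * C)) by rewrite mulr_ge0.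
have EX i k : (i < N)%N -> (k < N)%N -> 2 / 5 * enorm (W i.+1 k - W i k) ^+ 2 <=
    - 2 * dot ((S i k).1 *: f i k) (W i.+1 k - W i k) + 2 * D.
  move=> iN kN; have [gA _] := Sgood _ _ iN kN.
  apply: (wgt _ _ _ _ _ (range2 _ _ gA (ltnW iN)) (aB _ _ (ltnW iN) (ltnW kN)) D0).
  rewrite -DE; apply: (edge_energy j sh (zbox _ _ (ltnW iN) (ltnW kN)) (zbox _ _ iN (ltnW kN)) C1 hh).
  exact: stepx iN (ltnW kN).
have ET i k : (i < N)%N -> (k < N)%N -> 2 / 5 * enorm (W i k.+1 - W i k) ^+ 2 <=
    - 2 * dot ((S i k).2 *: g i k) (W i k.+1 - W i k) + 2 * D.
  move=> iN kN; have [_ gB] := Sgood _ _ iN kN.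
  apply: (wgt _ _ _ _ _ (range2 _ _ gB (ltnW kN)) (bB _ _ (ltnW iN) (ltnW kN)) D0).
  rewrite -DE; apply: (edge_energy j sh (zbox _ _ (ltnW iN) (ltnW kN)) (zbox _ _ (ltnW iN) kN) C1 hh).
  exact: stept (ltnW iN) kN.
have absr (u : R) : u < - r -> r < `|u|.
  by move=> ur; rewrite ler0_norm; move: ur r0; clear; lra.
have absr' (u : R) : r < u -> r < `|u|.
  by move=> ur; rewrite ger0_norm; move: ur r0; clear; lra.
have W0k k : (k <= N)%N -> W 0%N k = 0.
  by move=> kN; apply: W0 => //; have [/absr ? _ _ _] := bdry _ kN; left.
have WNk k : (k <= N)%N -> W N k = 0.
  by move=> kN; apply: W0 => //; have [_ /absr' ? _ _] := bdry _ kN; left.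
have Wi0 k : (k <= N)%N -> W k 0%N = 0.
  by move=> kN; apply: W0 => //; have [_ _ /absr ? _] := bdry _ kN; right.
have WiN k : (k <= N)%N -> W k N = 0.
  by move=> kN; apply: W0 => //; have [_ _ _ /absr' ?] := bdry _ kN; right.
pose p i k := (S i k).1 *: f i k; pose q i k := (S i k).2 *: g i k.
have SX : 2 / 5 * (\sum_(1 <= k < N) \sum_(0 <= i < N) enorm (W i.+1 k - W i k) ^+ 2) <=
    2 * (\sum_(1 <= k < N) \sum_(1 <= i < N) dot (p i k - p i.-1 k) (W i k))
    + N%:R * (N%:R * (2 * D)).
  apply: le_trans (_ : \sum_(1 <= k < N)
     (2 * \sum_(1 <= i < N) dot (p i k - p i.-1 k) (W i k) + N%:R * (2 * D)) <= _).
    rewrite mulr_sumr !big_nat; apply: ler_sum => k /andP[_ kN].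
    have := sum_by_parts (p^~ k) (w := W^~ k) (W0k k (ltnW kN)) (WNk k (ltnW kN)).
    move=> /(congr1 (fun z => - 2 * z)) /=; rewrite mulrNN mulr_sumr => <-.
    apply: le_trans (_ : \sum_(0 <= i < N) (- 2 * dot (p i k) (W i.+1 k - W i k) + 2 * D) <= _).
      by rewrite mulr_sumr !big_nat; apply: ler_sum => i /andP[_ iN]; exact: EX.
    rewrite big_split/= lerD2l; by apply: sum_nat_le.
  rewrite big_split/= -mulr_sumr lerD2l; by apply: sum_nat_le.
have ST : 0 <=
    2 * (\sum_(1 <= i < N) \sum_(1 <= k < N) dot (q i k - q i k.-1) (W i k))
    + N%:R * (N%:R * (2 * D)).
  apply: (@le_trans _ _ (\sum_(1 <= i < N)
     (2 * \sum_(1 <= k < N) dot (q i k - q i k.-1) (W i k) + N%:R * (2 * D)))).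
    rewrite big_nat; apply: sumr_ge0 => i /andP[_ iN].
    have := sum_by_parts (q i) (w := W i) (Wi0 i (ltnW iN)) (WiN i (ltnW iN)).
    move=> /(congr1 (fun z => - 2 * z)) /=; rewrite mulrNN mulr_sumr => <-.
    apply: (@le_trans _ _ (\sum_(0 <= k < N) (- 2 * dot (q i k) (W i k.+1 - W i k) + 2 * D))).
      rewrite big_nat; apply: sumr_ge0 => k /andP[_ kN].
      apply: le_trans (ET _ _ iN kN); by rewrite mulr_ge0 ?sqr_ge0// divr_ge0.
    rewrite big_split/= lerD2l; by apply: sum_nat_le.
  rewrite big_split/= -mulr_sumr lerD2l; by apply: sum_nat_le.
rewrite exchange_big/= in ST.
have SR : \sum_(1 <= k < N) \sum_(1 <= i < N) dot (p i k - p i.-1 k) (W i k)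
   + \sum_(1 <= k < N) \sum_(1 <= i < N) dot (q i k - q i k.-1) (W i k)
   <= N%:R * (N%:R * (K' * h ^+ 3 * (5 * C))).
  rewrite -big_split/=; apply: sum_nat_le => //.
  case=> // k /andP[_ kN]; rewrite -big_split/=; apply: sum_nat_le => //.
  case=> // i /andP[_ iN]; rewrite -dotDl /=; apply: le_trans (ler_norm _) _.
  by apply: ler_dot_bd; [exact: res|apply: Wb; exact: ltnW].
have NN : N%:R * N%:R * h ^+ 2 = 64 * r ^+ 2.
  transitivity ((N%:R * h) ^+ 2); first by ring.
  by rewrite Nh; ring.
move: SX ST SR; set s1 := \sum_(_ <= _ < _) _; set s2 := \sum_(_ <= _ < _) _.
set s3 := \sum_(_ <= _ < _) _ => SX ST SR.
have -> : 64 * r ^+ 2 * (40 * C * K' + 20000 * C ^+ 2) * h =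
   40 * C * (N%:R * (N%:R * (K' * h ^+ 3))) + 20 * (N%:R * (N%:R * D)).
  by rewrite -NN -DE; ring.
have t1 := mulr_ge0 (ler0n R N) NE.
have t2 := mulr_ge0 (ler0n R N) ND.
by move: SX ST SR t1 t2; clear; lra.
Qed.
End energy.

(** * Rigidity from the energy *)

Section rigidity.
Context {R : realType}.

(** A node of the net closest to a given point is close to it, since otherwise one of
    the two families of edges would lead to a closer node. *)
Lemma net_dense (x t : nat -> nat -> R) (N : nat) (h r X T : R) : 0 < h <= r ->
  (forall k, (k <= N)%N -> [/\ x 0%N k < - r, r < x N k, t k 0%N < - r & r < t k N]) ->
  (forall i j, (i < N)%N -> (j <= N)%N ->
     exists2 am : R * R, 3 / 4 <= am.1 <= 5 / 4 /\ `|am.2| <= 100^-1 &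
       x i.+1 j = x i j + h * am.1 /\ t i.+1 j = t i j + h * am.1 * am.2) ->
  (forall i j, (i <= N)%N -> (j < N)%N ->
     exists2 bm : R * R, 3 / 4 <= bm.1 <= 5 / 4 /\ `|bm.2| <= 100^-1 &
       t i j.+1 = t i j + h * bm.1 /\ x i j.+1 = x i j + h * bm.1 * bm.2) ->
  `|X| <= r -> `|T| <= r ->
  exists i j, [/\ (i <= N)%N, (j <= N)%N, `|x i j - X| <= h & `|t i j - T| <= h].
Proof.
move=> /andP[h0 hr] bd ex et Xr Tr.
pose D (p : 'I_N.+1 * 'I_N.+1) := (x p.1 p.2 - X) ^+ 2 + (t p.1 p.2 - T) ^+ 2.
have [[[i hi] [j hj]] _ Dmin] := @arg_minP _ _ _ (ord0, ord0) xpredT D erefl.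
have iN : (i <= N)%N by rewrite -ltnS.
have jN : (j <= N)%N by rewrite -ltnS.
have {}Dmin i' j' : (i' <= N)%N -> (j' <= N)%N ->
    (x i j - X) ^+ 2 + (t i j - T) ^+ 2 <= (x i' j' - X) ^+ 2 + (t i' j' - T) ^+ 2.
  by move=> i'N; rewrite -ltnS => jN'; move: i'N; rewrite -ltnS => iN'; have := Dmin (Ordinal iN', Ordinal jN') isT.
clear hi hj D.
(* [(e, s)] is the vector from the node to the target, and the edge leads along [(1, m)] *)
have step (e s a m : R) : 3 / 4 <= a <= 5 / 4 -> `|m| <= 100^-1 -> `|s| <= e -> h < e ->
    (e - h * a) ^+ 2 + (s - h * a * m) ^+ 2 < e ^+ 2 + s ^+ 2.
  move=> /andP[a1 a2] m1 se he.
  have ms := ler_normM m1 se; have mm := ler_normM m1 m1.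
  have q1 : 0 < h * a by rewrite mulr_gt0//; move: a1; clear; lra.
  have -> : (e - h * a) ^+ 2 + (s - h * a * m) ^+ 2 =
     e ^+ 2 + s ^+ 2 - (h * a) * (2 * e + 2 * (m * s) - h * a * (1 + m * m)) by ring.
  rewrite gtrBl mulr_gt0//.
  have q2 : h * a * (1 + m * m) <= h * (5 / 4 * (1 + 100^-1)).
    rewrite -mulrA ler_pM2l//; apply: ler_pM => //.
    - by move: a1; clear; lra.
    - by rewrite addr_ge0// -expr2 sqr_ge0.
    - by move: mm; rewrite ler_norml; clear; lra.
  by move: ms q2 he h0; rewrite ler_norml; clear; lra.
have cmp (u v : R) : `|v| <= `|u| -> h < `|u| -> u < 0 \/ 0 < u.
  by move=> _; case: (ltgtP u 0) => [|//|->]; [left|right|rewrite normr0; move: h0; clear; lra].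
have hx : `|t i j - T| <= `|x i j - X| -> `|x i j - X| <= h.
  move=> le; rewrite leNgt; apply/negP => lt.
  case: (cmp _ _ le lt) => sg.
    have iN' : (i < N)%N.
      rewrite ltn_neqAle iN andbT; apply/eqP => e.
      have [_ l _ _] := bd _ jN; move: sg l Xr; rewrite e ler_norml; clear; lra.
    have [[a m] [/= a1 m1] [e1 e2]] := ex _ _ iN' jN.
    have := Dmin _ _ iN' jN; rewrite e1 e2 leNgt => /negP; apply.
    rewrite (ltr0_norm sg) in lt le.
    have := step _ (- (t i j - T)) _ _ a1 m1 _ lt; rewrite normrN => /(_ le).
    rewrite (_ : (- (x i j - X) - h * a) ^+ 2 = (x i j + h * a - X) ^+ 2); last by ring.
    rewrite (_ : (- (t i j - T) - _) ^+ 2 = (t i j + h * a * m - T) ^+ 2); last by ring.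
    by rewrite !sqrrN.
  case: i iN Dmin cmp le sg lt => [|i] iN Dmin _ le sg lt.
    have [l _ _ _] := bd _ jN; move: sg l Xr; rewrite ler_norml; clear; lra.
  have [[a m] [/= a1 m1] [e1 e2]] := ex _ _ iN jN.
  have := Dmin _ _ (ltnW iN) jN; rewrite leNgt => /negP; apply.
  rewrite (gtr0_norm sg) in lt le.
  have := step _ (t i.+1 j - T) _ _ a1 m1 le lt; rewrite {1}e1 {1}e2.
  rewrite (_ : (x i j + h * a - X - h * a) ^+ 2 = (x i j - X) ^+ 2); last by ring.
  by rewrite (_ : (t i j + _ - T - _) ^+ 2 = (t i j - T) ^+ 2); last by ring.
have ht : `|x i j - X| <= `|t i j - T| -> `|t i j - T| <= h.
  move=> le; rewrite leNgt; apply/negP => lt.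
  case: (cmp _ _ le lt) => sg.
    have jN' : (j < N)%N.
      rewrite ltn_neqAle jN andbT; apply/eqP => e.
      have [_ _ _ l] := bd _ iN; move: sg l Tr; rewrite e ler_norml; clear; lra.
    have [[a m] [/= a1 m1] [e1 e2]] := et _ _ iN jN'.
    have := Dmin _ _ iN jN'; rewrite e1 e2 leNgt => /negP; apply.
    rewrite (ltr0_norm sg) in lt le.
    have := step _ (- (x i j - X)) _ _ a1 m1 _ lt; rewrite normrN => /(_ le).
    rewrite (_ : (- (t i j - T) - h * a) ^+ 2 = (t i j + h * a - T) ^+ 2); last by ring.
    rewrite (_ : (- (x i j - X) - _) ^+ 2 = (x i j + h * a * m - X) ^+ 2); last by ring.
    by rewrite !sqrrN addrC [X in _ < X]addrC.
  case: j jN Dmin cmp le sg lt hx => [|j] jN Dmin _ le sg lt hx.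
    have [_ _ l _] := bd _ iN; move: sg l Tr; rewrite ler_norml; clear; lra.
  have [[a m] [/= a1 m1] [e1 e2]] := et _ _ iN jN.
  have := Dmin _ _ iN (ltnW jN); rewrite leNgt => /negP; apply.
  rewrite (gtr0_norm sg) in lt le.
  have := step _ (x i j.+1 - X) _ _ a1 m1 le lt; rewrite {1}e1 {1}e2.
  rewrite (_ : (t i j + h * a - T - h * a) ^+ 2 = (t i j - T) ^+ 2); last by ring.
  rewrite (_ : (x i j + _ - X - _) ^+ 2 = (x i j - X) ^+ 2); last by ring.
  by rewrite addrC [X in _ < X]addrC.
exists i, j; split=> //.
- by case: (leP `|t i j - T| `|x i j - X|) => [/hx//|/ltW le]; apply: le_trans le (ht le).
- by case: (leP `|x i j - X| `|t i j - T|) => [/ht//|/ltW le]; apply: le_trans le (hx le).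
Qed.

(** Cauchy-Schwarz along a row that starts from zero, in the form of the inequality between
    arithmetic and geometric means. *)
Lemma row_energy (W : nat -> 'rV[R]_3) (N i0 : nat) (d : R) : 0 < d -> (0 < N)%N ->
  (i0 <= N)%N -> W 0%N = 0 -> d <= 2 * enorm (W i0) ->
  d ^+ 2 / (4 * N%:R) <= \sum_(0 <= i < N) enorm (W i.+1 - W i) ^+ 2.
Proof.
move=> d0 N0 iN W0 dW.
have Np : 0 < N%:R :> R by rewrite ltr0n.
have tel : enorm (W i0) <= \sum_(0 <= i < i0) enorm (W i.+1 - W i).
  elim: i0 {iN dW} => [|i0 IH]; first by rewrite W0 enorm0 big_geq.
  rewrite big_nat_recr//=; apply: le_trans (lerD IH (lexx _)).
  have := ler_enormD (W i0) (W i0.+1 - W i0).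
  by rewrite addrC subrK.
have amgm (u : R) : u <= N%:R / d * u ^+ 2 + d / (4 * N%:R).
  have -> : N%:R / d * u ^+ 2 + d / (4 * N%:R) =
     u + (2 * N%:R * u - d) ^+ 2 / (4 * N%:R * d) by field; rewrite !gt_eqF.
  by rewrite lerDl divr_ge0 ?sqr_ge0// mulr_ge0// ?mulr_ge0// ltW.
have le0 : d / 2 <= \sum_(0 <= i < N) enorm (W i.+1 - W i).
  rewrite (big_cat_nat (leq0n _) iN)/=; apply: (@le_trans _ _ (enorm (W i0))).
    by move: dW; clear; lra.
  apply: le_trans tel _; rewrite lerDl; apply: sumr_ge0 => *; exact: enorm_ge0.
have le1 : \sum_(0 <= i < N) enorm (W i.+1 - W i) <=
    N%:R / d * (\sum_(0 <= i < N) enorm (W i.+1 - W i) ^+ 2) + d / 4.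
  apply: le_trans (ler_sum _ (fun i _ => amgm (enorm (W i.+1 - W i)))) _.
  rewrite big_split/= -mulr_sumr lerD2l sumr_const_nat subn0 -[_ *+ N]mulr_natl.
  by rewrite le_eqVlt; apply/orP; left; apply/eqP; field; rewrite gt_eqF.
rewrite ler_pdivrMr ?mulr_gt0//; set S := \sum_(0 <= i < N) enorm _ ^+ 2 in le1 *.
have : d / 4 <= N%:R / d * S by move: le0 le1; clear; lra.
rewrite -(ler_pM2l (_ : 0 < 4 * d)) ?mulr_gt0//.
rewrite (_ : 4 * d * (N%:R / d * S) = S * (4 * N%:R)); last by field; rewrite gt_eqF.
by rewrite (_ : 4 * d * (d / 4) = d ^+ 2)//; field.
Qed.

(** If the defect [G - F] had norm [d] at some point then, being Lipschitz, it would be at least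
    [d / 2] at a node of each of [M] consecutive rows, with [M / N] bounded below. Each of these
    rows has energy at least [d ^+ 2 / (4 N)], whereas the energy of the net tends to zero with
    its mesh. *)
Theorem energy_rigidity (F Fx Ft Fxx Fxt Ftt : R -> R -> 'rV[R]_3) (mu nu : R -> R -> R)
    (rho C c : R) :
  jet2 F Fx Ft Fxx Fxt Ftt rho C -> asymptotic Fx Ft Fxx Fxt Ftt rho C mu ->
  asymptotic (swap Ft) (swap Fx) (swap Ftt) (swap Fxt) (swap Fxx) rho C (swap nu) ->
  1 <= C -> 0 < c -> 0 < rho -> rho <= 4^-1 ->
  (forall x t, box rho x t ->
    c <= dot (cross (Fx x t) (Ft x t)) (cross (Fx x t) (Ft x t))) ->
  exists2 r0 : R, 0 < r0 & forall r, 0 < r -> r <= r0 -> forall G,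
    (forall x t, r ^+ 2 <= x ^+ 2 + t ^+ 2 -> box rho x t -> G x t = F x t) ->
    short_for Fx Ft rho C G ->
    forall X T, `|X| <= r -> `|T| <= r -> G X T = F X T.
Proof.
move=> j as_mu as_nu C1 c0 rho0 r4 cr.
have C0 : 0 < C by apply: lt_le_trans C1.
have K1 : 1 <= 1000 * C ^+ 4.
  have := exprn_ege1 4 C1; clear; lra.
have [K' [h0 [K'0 h0p stress]]] := node_stress c0 C1 K1.
exists (Num.min (rho / 12) (Num.min (64 * C)^-1 (16 * K')^-1)).
  by rewrite !lt_min !invr_gt0 divr_gt0//= !mulr_gt0.
move=> r r0; rewrite !le_min => /andP[r1 /andP[r2 r3]] G Gout sh X T Xr Tr.
have {}r1 : 12 * r <= rho by move: r1; clear; lra.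
have {}r2 : 64 * C * r <= 1 by rewrite mulrC -ler_pdivlMr ?mul1r// mulr_gt0.
have {}r3 : 16 * K' * r <= 1 by rewrite mulrC -ler_pdivlMr ?mul1r// mulr_gt0.
apply/eqP; rewrite -subr_eq0 -enorm_eq0; apply/negPn/negP => dn0.
set d := enorm _ in dn0.
have d0 : 0 < d by rewrite lt_neqAle eq_sym dn0 enorm_ge0.
set E := 64 * r ^+ 2 * (40 * C * K' + 20000 * C ^+ 2).
have E0 : 0 <= E.
  apply: mulr_ge0 (mulr_ge0 (ler0n R 64) (sqr_ge0 r)) _.
  exact: addr_ge0 (mulr_ge0 (mulr_ge0 (ler0n R 40) (ltW C0)) (ltW K'0))
    (mulr_ge0 (ler0n R 20000) (sqr_ge0 C)).
have EE : 64 * r ^+ 2 * (40 * C * K' + 20000 * C ^+ 2) = E by [].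
clearbody E.
(* [M] rows out of [N = M * q] fit near the defect; [q] is fixed while the mesh tends to zero *)
pose q := (Num.bound (320 * C * r / d) + 8)%N.
pose M := (Num.bound (8 * r / h0 + 64 * r + 32 * r * E / d ^+ 2)).+1.
have q1 : 320 * C * r <= d * q%:R.
  rewrite [leRHS]mulrC -ler_pdivrMr// natrD; apply: ltW.
  apply: lt_le_trans (archi_boundP _) _; last by rewrite lerDl.
  exact: divr_ge0 (mulr_ge0 (mulr_ge0 (ler0n R 320) (ltW C0)) (ltW r0)) (ltW d0).
have q8 : 8 <= q%:R :> R by rewrite natrD lerDr.
have q0 : 0 < q%:R :> R by apply: lt_le_trans q8.
have [m1 m2 m3] : [/\ 0 <= 8 * r / h0, 0 <= 64 * r & 0 <= 32 * r * E / d ^+ 2].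
  split; first by apply: divr_ge0 (ltW h0p); exact: mulr_ge0 (ltW r0).
    exact: mulr_ge0 (ltW r0).
  by apply: divr_ge0 (sqr_ge0 d); apply: mulr_ge0 E0; exact: mulr_ge0 (ltW r0).
have Mb : 8 * r / h0 + 64 * r + 32 * r * E / d ^+ 2 < M%:R.
  by apply: lt_trans (archi_boundP _) _; [apply: addr_ge0 m3; exact: addr_ge0|rewrite ltr_nat].
have M1 : 1 <= M%:R :> R by rewrite ler1n.
have M0 : 0 < M%:R :> R by apply: lt_le_trans M1.
have Mh : 8 * r <= h0 * M%:R.
  by rewrite [leRHS]mulrC -ler_pdivrMr//; move: Mb m1 m2 m3; clear; lra.
have M64 : 64 * r <= M%:R by move: Mb m1 m2 m3; clear; lra.
have ME : 32 * r * E < d ^+ 2 * M%:R.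
  by rewrite [ltRHS]mulrC -ltr_pdivrMr ?exprn_gt0//; move: Mb m1 m2; clear; lra.
pose N := (M * q)%N; pose h := 8 * r / N%:R.
have NE : N%:R = M%:R * q%:R :> R by rewrite natrM.
clearbody q M.
have N0 : 0 < N%:R :> R by rewrite NE mulr_gt0.
have Nh : N%:R * h = 8 * r by rewrite /h mulrC divfK// gt_eqF.
have Mh8 : M%:R * h * q%:R = 8 * r by rewrite -Nh NE; ring.
have hp : 0 < h by rewrite /h divr_gt0// mulr_gt0.
have MN : M%:R <= N%:R :> R by rewrite NE ler_peMr// ?ltW//; move: q8; clear; lra.
have hh0 : h <= h0.
  by rewrite /h ler_pdivrMr//; apply: le_trans Mh _; rewrite ler_pM2l.
have h8 : h <= 8^-1.
  by rewrite /h ler_pdivrMr//; move: M64 MN; clear; lra.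
have hr : h <= r.
  rewrite /h ler_pdivrMr// [leRHS]mulrC ler_pM2r// NE; apply: le_trans q8 _.
  by rewrite ler_peMl// ltW.
clearbody h.
have [x [t [zbox bd ex et]]] := net_energy j as_mu as_nu C1 c0 r4 r1 r2 K'0 r3 cr stress
  Gout sh hp hh0 h8 hr Nh.
set W := fun _ _ => _; rewrite EE => SE.
have [i0 [j0 [iN jN xX tT]]] := net_dense (introT andP (conj hp hr)) bd ex et Xr Tr.
have Np : (0 < N)%N by rewrite -(ltr0n R).
have XTb : box rho X T.
  by split; [apply: le_trans Xr _|apply: le_trans Tr _]; move: r1 r0; clear; lra.
have rs (u : R) : u < - r -> r ^+ 2 <= u ^+ 2.
  move=> ur; rewrite -(sqrrN u) lerXn2r ?nnegrE//; move: ur r0; clear; lra.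
have rs' (u : R) : r < u -> r ^+ 2 <= u ^+ 2.
  by move=> ur; rewrite lerXn2r ?nnegrE ?ltW// (lt_trans r0).
have W0j k : (k <= N)%N -> W 0%N k = 0.
  move=> kN; have [/rs l _ _ _] := bd _ kN; rewrite /W Gout ?subrr//; last exact: zbox.
  by apply: le_trans l _; rewrite lerDl sqr_ge0.
have WiN k : (k <= N)%N -> W k N = 0.
  move=> kN; have [_ _ _ /rs' l] := bd _ kN; rewrite /W Gout ?subrr//; last exact: zbox.
  by apply: le_trans l _; rewrite lerDr sqr_ge0.
have Wi0 k : (k <= N)%N -> W k 0%N = 0.
  move=> kN; have [_ _ /rs l _] := bd _ kN; rewrite /W Gout ?subrr//; last exact: zbox.
  by apply: le_trans l _; rewrite lerDr sqr_ge0.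
have drift m : (j0 + m <= N)%N ->
    `|x i0 (j0 + m)%N - X| + `|t i0 (j0 + m)%N - T| <= 2 * h + 2 * (h * m%:R).
  elim: m => [|m IH] mN; first by rewrite addn0 mulr0 mulr0 addr0; move: xX tT; clear; lra.
  have mN' : (j0 + m < N)%N by rewrite -addnS.
  have [[b s] [/= /andP[b1 b2] s1] [e1 e2]] := et _ _ iN mN'.
  have {}IH := IH (ltnW mN'); rewrite addnS e1 e2 -(natr1 m) mulrDr mulr1.
  rewrite (addrAC _ _ (- X)) (addrAC _ _ (- T)).
  have b3 : `|b| <= 5 / 4 by rewrite ger0_norm//; move: b1; clear; lra.
  have q2 : `|h * b| <= h * (5 / 4) by rewrite normrM gtr0_norm// ler_pM2l.
  have := ler_normM q2 s1.
  have := ler_normD (x i0 (j0 + m)%N - X) (h * b * s).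
  have := ler_normD (t i0 (j0 + m)%N - T) (h * b).
  move: IH q2 hp; clear; lra.
have q3 : 20 * C * (M%:R * h) <= d / 2.
  rewrite -(ler_pM2r q0) -[leLHS]mulrA Mh8; move: q1; clear; lra.
have big m : (m < M)%N -> (j0 + m <= N)%N -> d <= 2 * enorm (W i0 (j0 + m)%N).
  move=> mM mN; have := defect_lip j sh XTb (zbox _ _ iN mN) C1 r4.
  rewrite -/(W i0 (j0 + m)%N) => l.
  have l1 := ler_enorm_dist (W i0 (j0 + m)%N) (G X T - F X T).
  have l2 : h + h * m%:R <= M%:R * h.
    rewrite -{1}(mulr1 h) -mulrDr mulrC ler_pM2r// addrC natr1 ler_nat//.
  have l3 := ler_wpM2l (mulr_ge0 (ler0n R 5) (ltW C0)) (drift m mN).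
  have l4 := ler_wpM2l (mulr_ge0 (ler0n R 10) (ltW C0)) l2.
  move: l1; rewrite ler_norml -/d => /andP[l1 _].
  by move: l l1 l3 l4 q3 d0; clear; lra.
have jM m : (m < M)%N -> (j0 + m < N)%N.
  elim: m => [|m IH] mM.
    rewrite addn0 ltn_neqAle jN andbT; apply/eqP => e.
    have := big 0%N mM; rewrite addn0 jN => /(_ isT).
    rewrite e WiN// enorm0; move: d0; clear; lra.
  have lt := IH (ltnW mM); rewrite addnS ltn_neqAle lt andbT; apply/eqP => e.
  have := big m.+1 mM; rewrite addnS e leqnn => /(_ isT).
  rewrite WiN// enorm0; move: d0; clear; lra.
have j00 : (0 < j0)%N.
  rewrite lt0n; apply/eqP => e; have M00 : (0 < M)%N by rewrite -(ltr0n R).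
  have := big 0%N M00; rewrite addn0 e => /(_ isT).
  rewrite Wi0// enorm0; move: d0; clear; lra.
have jMN : (j0 + M <= N)%N.
  have M00 : (0 < M)%N by rewrite -(ltr0n R).
  by have := jM M.-1; rewrite -addnS prednK// leqnn => /(_ isT).
pose S k := \sum_(0 <= i < N) enorm (W i.+1 k - W i k) ^+ 2.
have S0 k : 0 <= S k by apply: sumr_ge0 => ? _; exact: sqr_ge0.
have : M%:R * (d ^+ 2 / (4 * N%:R)) <= \sum_(1 <= k < N) S k.
  rewrite (big_cat_nat j00 (leq_trans (leq_addr M j0) jMN))/= (big_cat_nat (leq_addr M j0) jMN)/=.
  rewrite addrCA -[leLHS]addr0; apply: lerD; last first.
    by apply: addr_ge0; apply: sumr_ge0.
  rewrite -{1}[j0]add0n big_addn addKn.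
  apply: (@le_trans _ _ (\sum_(0 <= m < M) (d ^+ 2 / (4 * N%:R)))).
    by rewrite sumr_const_nat subn0 mulr_natl.
  rewrite !big_nat; apply: ler_sum => m /andP[_ mM].
  have mN := ltnW (jM _ mM).
  rewrite addnC; apply: (@row_energy (W^~ (j0 + m)%N) N i0) => //; first exact: W0j.
  exact: big.
move=> /le_trans/(_ SE); rewrite mulrA ler_pdivrMr ?mulr_gt0// leNgt => /negP; apply.
rewrite (_ : E * h * (4 * N%:R) = 4 * E * (N%:R * h)); last by ring.
by rewrite Nh; move: ME; clear; lra.
Qed.

End rigidity.

(** * Fields of asymptotic slopes *)

Section slopes.
Context {R : realType}.

Lemma bounded_lip_mono (rho rho' C C' : R) f : rho' <= rho -> C <= C' ->
  bounded_lip rho C f -> bounded_lip rho' C' f.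
Proof.
move=> rr CC [b l]; have bx x t : box rho' x t -> box rho x t.
  by case=> ? ?; split; apply: le_trans rr.
split=> [x t /bx zb|x t x' t' /bx zb /bx zb'].
  exact: le_trans (b _ _ zb) CC.
by apply: le_trans (l _ _ _ _ zb zb') _; rewrite ler_wpM2r// addr_ge0.
Qed.

Lemma jet2_mono F Fx Ft Fxx Fxt Ftt (rho rho' C C' : R) : rho' <= rho -> C <= C' ->
  jet2 F Fx Ft Fxx Fxt Ftt rho C -> jet2 F Fx Ft Fxx Fxt Ftt rho' C'.
Proof.
move=> rr CC [jx jt jxx jxt jtt tay]; split; try exact: bounded_lip_mono rr CC _.
move=> x t x' t' [? ?] [? ?]; apply: le_trans (tay _ _ _ _ _ _) _.
- by split; apply: le_trans rr.
- by split; apply: le_trans rr.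
- by rewrite ler_wpM2r// exprn_ge0// addr_ge0.
Qed.

Definition box_lip (rho L : R) (f : R -> R -> R) : Prop :=
  forall x t x' t', box rho x t -> box rho x' t' ->
    `|f x' t' - f x t| <= L * (`|x' - x| + `|t' - t|).

(** The root of the quadratic equation that is close to zero, in the form
    [- P / (S + sqrt D)], which does not divide by the coefficient [Q] that may vanish. *)
Lemma slope_root (P Q S : R -> R -> R) (rho L : R) : 0 <= L ->
  box_lip rho L P -> box_lip rho L Q -> box_lip rho L S ->
  (forall x t, box rho x t ->
    [/\ `|P x t| <= 400^-1, `|Q x t| <= 400^-1 & `|S x t - 1| <= 4^-1]) ->
  exists m : R -> R -> R, [/\ forall x t, `|m x t| <= 100^-1, box_lip rho (2 * L) m &
    forall x t, box rho x t -> P x t + 2 * S x t * m x t + Q x t * m x t ^+ 2 = 0].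
Proof.
move=> L0 PL QL SL bd.
pose D x t := Num.sqrt (S x t ^+ 2 - P x t * Q x t).
(* the value 0 outside the box keeps the root small everywhere *)
pose m x t := if (`|x| <= rho) && (`|t| <= rho) then - (P x t / (S x t + D x t)) else 0.
have disc x t : box rho x t -> 2^-1 <= S x t ^+ 2 - P x t * Q x t.
  move=> /bd[p q]; have := ler_normM p q; rewrite !ler_norml.
  by move: (P x t * Q x t) (S x t) => u s; clear; nra.
have Dsq x t : box rho x t -> D x t ^+ 2 = S x t ^+ 2 - P x t * Q x t.
  by move=> zb; rewrite sqr_sqrtr// (le_trans _ (disc _ _ zb)).
have D0 x t : 0 <= D x t by exact: sqrtr_ge0.
have D7 x t : box rho x t -> 7 / 10 <= D x t.
  move=> zb; have := disc _ _ zb; rewrite -Dsq//; move: (D x t) (D0 x t) => d; clear; nra.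
have den x t : box rho x t -> 1 <= S x t + D x t.
  by move=> zb; have [_ _] := bd _ _ zb; have := D7 _ _ zb; rewrite ler_norml; clear; lra.
have mE x t : box rho x t -> m x t = - (P x t / (S x t + D x t)).
  by case=> xr tr; rewrite /m xr tr.
exists m; split.
- move=> x t; rewrite /m; case: ifPn => [/andP zb|_]; last by rewrite normr0.
  have d1 := den _ _ zb; have [p _ _] := bd _ _ zb.
  rewrite normrN normrM normfV [`|_ + _|]ger0_norm ?(le_trans _ d1)//.
  rewrite ler_pdivrMr ?(lt_le_trans _ d1)//; apply: le_trans p _.
  by move: d1; clear; lra.
- move=> x t x' t' zb zb'; rewrite !mE//.
  have d1 := den _ _ zb; have d1' := den _ _ zb'.
  have [p q s] := bd _ _ zb; have [p' q' s'] := bd _ _ zb'.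
  have := PL _ _ _ _ zb zb'; have := QL _ _ _ _ zb zb'; have := SL _ _ _ _ zb zb'.
  set e := L * _ => se qe pe.
  have e0 : 0 <= e by rewrite mulr_ge0// addr_ge0.
  have De : `|D x' t' - D x t| <= 2 * e.
    have dd : 14 / 10 <= D x' t' + D x t.
      by have := D7 _ _ zb; have := D7 _ _ zb'; clear; lra.
    rewrite -(ler_pM2r (_ : 0 < D x' t' + D x t)); last by move: dd; clear; lra.
    rewrite -{1}(ger0_norm (_ : 0 <= D x' t' + D x t)) -?normrM; last first.
      by move: dd; clear; lra.
    rewrite -subr_sqr !Dsq//.
    have -> : S x' t' ^+ 2 - P x' t' * Q x' t' - (S x t ^+ 2 - P x t * Q x t) =
      (S x' t' - S x t) * (S x' t' - 1 + (S x t - 1) + 2)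
      - (P x' t' - P x t) * Q x' t' - P x t * (Q x' t' - Q x t) by ring.
    have s2 : `|S x' t' - 1 + (S x t - 1) + 2| <= 5 / 2.
      by move: s s'; rewrite !ler_norml; clear; lra.
    have := ler_normM se s2; have := ler_normM pe q'; have := ler_normM p qe.
    move: (_ * (_ + 2)) (_ * Q x' t') (P x t * _) => u v w.
    have := ler_wpM2l e0 dd; rewrite !ler_norml; clear -e0; lra.
  have n1 : S x t + D x t != 0 by rewrite gt_eqF// (lt_le_trans _ d1).
  have n2 : S x' t' + D x' t' != 0 by rewrite gt_eqF// (lt_le_trans _ d1').
  have -> : - (P x' t' / (S x' t' + D x' t')) - - (P x t / (S x t + D x t)) =
     - ((P x' t' - P x t - P x t / (S x t + D x t) *
       (S x' t' - S x t + (D x' t' - D x t))) / (S x' t' + D x' t')).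
    by field; rewrite n1 n2.
  rewrite normrN normrM normfV [`|_ + D x' t'|]ger0_norm ?(le_trans _ d1')//.
  rewrite ler_pdivrMr ?(lt_le_trans _ d1')//.
  have pd : `|P x t / (S x t + D x t)| <= 400^-1.
    rewrite normrM normfV [`|_ + _|]ger0_norm ?(le_trans _ d1)//.
    rewrite ler_pdivrMr ?(lt_le_trans _ d1)//; apply: le_trans p _.
    by move: d1; clear; lra.
  have sd : `|S x' t' - S x t + (D x' t' - D x t)| <= 3 * e.
    by apply: le_trans (ler_normD _ _) _; move: se De; clear; lra.
  apply: le_trans (ler_normB _ _) _; have := ler_normM pd sd.
  have -> : 2 * L * (`|x' - x| + `|t' - t|) = 2 * e by rewrite /e mulrA.
  by have := ler_wpM2l e0 d1'; move: pe e0; clear; lra.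
- move=> x t zb; rewrite mE//; have d1 := den _ _ zb.
  have dn : S x t + D x t != 0 by rewrite gt_eqF// (lt_le_trans _ d1).
  have -> : P x t + 2 * S x t * - (P x t / (S x t + D x t))
      + Q x t * (- (P x t / (S x t + D x t))) ^+ 2 =
    P x t * (D x t ^+ 2 - (S x t ^+ 2 - P x t * Q x t)) / (S x t + D x t) ^+ 2.
    by field.
  by rewrite Dsq// subrr mulr0 mul0r.
Qed.

Lemma cross_diff (a b a' b' : 'rV[R]_3) :
  cross a' b' - cross a b = cross (a' - a) b' + cross a (b' - b).
Proof. by apply: rV3P; rewrite !mxE; ring. Qed.

Lemma triple_lip (f g k : R -> R -> 'rV[R]_3) (rho C : R) : 0 <= C ->
  bounded_lip rho C f -> bounded_lip rho C g -> bounded_lip rho C k ->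
  box_lip rho (3 * C ^+ 3) (fun x t => dot (cross (f x t) (g x t)) (k x t)).
Proof.
move=> C0 [fb fl] [gb gl] [kb kl] x t x' t' zb zb'.
move: (fl _ _ _ _ zb zb') (gl _ _ _ _ zb zb') (kl _ _ _ _ zb zb').
move: (fb _ _ zb) (gb _ _ zb) (kb _ _ zb) (fb _ _ zb') (gb _ _ zb') (kb _ _ zb').
set d := `|_| + `|_| => f1 g1 k1 f2 g2 k2 f3 g3 k3.
have d0 : 0 <= d by rewrite addr_ge0.
have -> : dot (cross (f x' t') (g x' t')) (k x' t') - dot (cross (f x t) (g x t)) (k x t)
   = dot (cross (f x' t' - f x t) (g x' t')) (k x' t')
   + dot (cross (f x t) (g x' t' - g x t)) (k x' t')
   + dot (cross (f x t) (g x t)) (k x' t' - k x t).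
  by rewrite -dotDl -cross_diff !dotE; ring.
have b1 (u v w : 'rV[R]_3) A B E : enorm u <= A -> enorm v <= B -> enorm w <= E ->
    `|dot (cross u v) w| <= A * B * E.
  move=> hu hv hw; apply: ler_dot_bd => //; apply: le_trans (enorm_cross _ _) _.
  by rewrite ler_pM// enorm_ge0.
have := b1 _ _ _ _ _ _ f3 g2 k2; have := b1 _ _ _ _ _ _ f1 g3 k2.
have := b1 _ _ _ _ _ _ f1 g1 k3.
move: (dot _ _) (dot _ _) (dot _ _) => u v w l1 l2 l3.
apply: le_trans (ler_normD _ _) _; apply: le_trans (lerD (ler_normD _ _) (lexx _)) _.
by move: l1 l2 l3; rewrite (_ : 3 * C ^+ 3 * d = 3 * (C * C * (C * d))); [clear; lra|ring].
Qed.

(** At the centre the axes are asymptotic, so that in a small box the second fundamental form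
    is nearly a multiple of [dx dt] and its null directions are close to the axes. *)
Lemma asymptotic_exists F Fx Ft Fxx Fxt Ftt (rho C : R) :
  jet2 F Fx Ft Fxx Fxt Ftt rho C -> 1 <= C -> 0 < rho ->
  let n := cross (Fx 0 0) (Ft 0 0) in
  n != 0 -> dot n (Fxx 0 0) = 0 -> dot n (Ftt 0 0) = 0 -> dot n (Fxt 0 0) != 0 ->
  exists rho' C' c mu nu, [/\ [/\ 0 < rho', rho' <= rho, rho' <= 4^-1, C <= C' & 0 < c],
    jet2 F Fx Ft Fxx Fxt Ftt rho' C', asymptotic Fx Ft Fxx Fxt Ftt rho' C' mu,
    asymptotic (swap Ft) (swap Fx) (swap Ftt) (swap Fxt) (swap Fxx) rho' C' (swap nu) &
    forall x t, box rho' x t -> c <= dot (cross (Fx x t) (Ft x t)) (cross (Fx x t) (Ft x t))].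
Proof.
move=> j C1 rho0 n n0 p0 q0 s0.
have C0 : 0 <= C by apply: le_trans C1.
pose L3 := 3 * C ^+ 3; have L30 : 0 <= L3 by rewrite mulr_ge0// exprn_ge0.
pose h (k : R -> R -> 'rV[R]_3) x t := dot (cross (Fx x t) (Ft x t)) (k x t).
have hL k : bounded_lip rho C k -> box_lip rho L3 (h k).
  by move=> kl; apply: triple_lip => //; [exact: jet_x j|exact: jet_t j].
set s := dot n (Fxt 0 0) in s0.
have sN : 0 < `|s| by rewrite normr_gt0.
pose L := L3 / `|s|; have L0 : 0 <= L by rewrite divr_ge0.
pose g x t := dot (cross (Fx x t) (Ft x t)) (cross (Fx x t) (Ft x t)).
pose c := g 0 0 / 2.
have g0 : 0 < g 0 0.
  rewrite /g -/n -sqr_enormE exprn_gt0// lt_neqAle enorm_ge0 andbT eq_sym.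
  by rewrite enorm_eq0.
have c0 : 0 < c by rewrite divr_gt0.
pose rho' := Num.min (Num.min rho 4^-1)
  (Num.min (800 * (L + 1))^-1 (c / (4 * C ^+ 4 * 2 + 1))).
have C4 : 0 <= 4 * C ^+ 4 * 2 := mulr_ge0 (mulr_ge0 (ler0n R 4) (exprn_ge0 4 C0)) (ler0n R 2).
have L1 : 0 < 800 * (L + 1) by move: L0; clear; lra.
have r'0 : 0 < rho'.
  rewrite !lt_min rho0 invr_gt0 ltr0n invr_gt0 L1 divr_gt0//.
  by move: C4; clear; lra.
have : rho' <= rho' by [].
rewrite {2}/rho' !le_min => /andP[/andP[r1 r2] /andP[r3 r4]].
have b00 (r : R) : 0 <= r -> box r 0 0 by move=> ?; split; rewrite normr0.
have bx x t : box rho' x t -> box rho x t by case=> ? ?; split; apply: le_trans r1.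
have dist x t : box rho' x t -> `|x - 0| + `|t - 0| <= 2 * rho'.
  by case; rewrite !subr0; clear; lra.
have Lr : L * (2 * rho') <= 400^-1.
  have := ler_wpM2l (ltW L1) r3; rewrite divff ?gt_eqF//.
  by move: r'0; clear; lra.
have kL k : bounded_lip rho C k -> box_lip rho' L (fun x t => h k x t / s).
  move=> kl x t x' t' /bx zb /bx zb'; rewrite -mulrBl normrM normfV /L mulrAC ler_pM2r ?invr_gt0//.
  exact: hL kl _ _ _ _ zb zb'.
have kB k x t : bounded_lip rho C k -> box rho' x t -> `|h k x t / s - h k 0 0 / s| <= 400^-1.
  move=> kl zb; have l := kL _ kl _ _ _ _ (b00 _ (ltW r'0)) zb.
  apply: (le_trans l); apply: le_trans Lr; rewrite ler_wpM2l//; exact: dist.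
have [jxx jxt jtt] : [/\ bounded_lip rho C Fxx, bounded_lip rho C Fxt & bounded_lip rho C Ftt].
  by split; [exact: jet_xx j|exact: jet_xt j|exact: jet_tt j].
have PB x t : box rho' x t -> `|h Fxx x t / s| <= 400^-1.
  by move=> zb; have := kB _ _ _ jxx zb; rewrite {2}/h -/n p0 mul0r subr0.
have QB x t : box rho' x t -> `|h Ftt x t / s| <= 400^-1.
  by move=> zb; have := kB _ _ _ jtt zb; rewrite {2}/h -/n q0 mul0r subr0.
have SB x t : box rho' x t -> `|h Fxt x t / s - 1| <= 4^-1.
  move=> zb; have := kB _ _ _ jxt zb; rewrite {2}/h -/n -/s divff//.
  by clear; move=> l; apply: le_trans l _; lra.
have [mu [mu1 muL muE]] := slope_root L0 (kL _ jxx) (kL _ jtt) (kL _ jxt)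
  (fun x t zb => And3 (PB x t zb) (QB x t zb) (SB x t zb)).
have [nu [nu1 nuL nuE]] := slope_root L0 (kL _ jtt) (kL _ jxx) (kL _ jxt)
  (fun x t zb => And3 (QB x t zb) (PB x t zb) (SB x t zb)).
pose C' := C + 2 * L.
have CC' : C <= C' by rewrite lerDl mulr_ge0.
have LC' : 2 * L <= C' by rewrite lerDr.
exists rho', C', c, mu, nu; split.
- by split.
- exact: jet2_mono r1 CC' j.
- split => // [x t x' t' zb zb'|x t zb].
    by apply: le_trans (muL _ _ _ _ zb zb') _; rewrite ler_wpM2r// addr_ge0.
  have := muE _ _ zb; rewrite /h => e; apply: (mulIf (invr_neq0 s0)).
  rewrite mul0r -[RHS]e !dotE; ring.
- split => [x t|x t x' t' /box_swap zb /box_swap zb'|x t /box_swap zb].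
  + exact: nu1.
  + rewrite (addrC `|x' - x|); apply: le_trans (nuL _ _ _ _ zb zb') _.
    by rewrite ler_wpM2r// addr_ge0.
  + have := nuE _ _ zb; rewrite /h => e; apply: (mulIf (invr_neq0 s0)).
    rewrite mul0r -[RHS]oppr0 -[in RHS]e /swap crossC !dotE; ring.
- move=> x t zb.
  have gl : `|g x t - g 0 0| <= 4 * C ^+ 4 * (2 * rho').
    have b0 := b00 _ (ltW rho0); have {}zb' := bx _ _ zb.
    have [xb xl] := jet_x j; have [tb tl] := jet_t j.
    have : enorm (cross (Fx x t) (Ft x t) - n) <= 2 * C ^+ 2 * (2 * rho').
      rewrite /n cross_diff; apply: le_trans (ler_enormD _ _) _.
      have l0 := ler_wpM2l C0 (dist _ _ zb).
      have l1 := le_trans (xl _ _ _ _ b0 zb') l0.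
      have l2 := le_trans (tl _ _ _ _ b0 zb') l0.
      have l3 := le_trans (enorm_cross (Fx x t - Fx 0 0) (Ft x t))
        (ler_pM (enorm_ge0 _) (enorm_ge0 _) l1 (tb _ _ zb')).
      have l4 := le_trans (enorm_cross (Fx 0 0) (Ft x t - Ft 0 0))
        (ler_pM (enorm_ge0 _) (enorm_ge0 _) (xb _ _ b0) l2).
      by move: l3 l4; clear; lra.
    have nB y u : box rho y u -> enorm (cross (Fx y u) (Ft y u)) <= C ^+ 2.
      move=> yb; apply: le_trans (enorm_cross _ _) _.
      by rewrite expr2 ler_pM ?enorm_ge0 ?xb ?tb.
    have := nB _ _ zb'; have := nB _ _ b0; rewrite -/n /g -/n.
    set k := cross _ _ => n1 k1 kn.
    have -> : dot k k - dot n n = dot (k - n) (k + n) by rewrite !dotE (dotC n k); ring.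
    have kn2 : enorm (k + n) <= 2 * C ^+ 2.
      by apply: le_trans (ler_enormD _ _) _; move: n1 k1; clear; lra.
    apply: le_trans (ler_dot_bd kn kn2) _.
    by rewrite le_eqVlt; apply/orP; left; apply/eqP; ring.
  have {}r4 : (4 * C ^+ 4 * 2 + 1) * rho' <= c.
    by rewrite mulrC -ler_pdivlMr//; move: C4; clear; lra.
  move: gl r4 r'0; rewrite -/(g x t) (_ : g 0 0 = 2 * c); last by rewrite /c; field.
  by rewrite ler_norml; clear; lra.
Qed.

End slopes.

(** * Expansion of a surface in a chart *)

Section chart_jet.
Context {R : realType}.

Lemma mvt_bound (g dg : R -> R) (K : R) :
  (forall s : R, 0 <= s <= 1 -> is_derive s 1 g (dg s)) ->
  (forall s : R, 0 <= s <= 1 -> `|dg s| <= K) -> `|g 1 - g 0| <= K.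
Proof.
move=> gd dK.
have cg : {within `[0, 1], continuous g}.
  apply: derivable_within_continuous => s; rewrite in_itv/= => s01.
  by have [] := gd _ s01.
have gd' (s : R) : s \in `]0, 1[ -> is_derive s 1 g (dg s).
  by rewrite in_itv/= => /andP[s0 s1]; apply: gd; rewrite !ltW.
have [c c01 ->] := MVT ltr01 gd' cg.
by rewrite subr0 mulr1; apply: dK; move: c01; rewrite in_itv/= => /andP[s0 s1]; rewrite !ltW.
Qed.

(** Two applications of the mean value theorem. For a function with bounded third derivative
    [K] is a multiple of this bound. *)
Lemma taylor2_bound (g g1 g2 : R -> R) (K : R) : 0 <= K ->
  (forall s : R, 0 <= s <= 1 -> is_derive s 1 g (g1 s)) ->
  (forall s : R, 0 <= s <= 1 -> is_derive s 1 g1 (g2 s)) ->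
  (forall s : R, 0 <= s <= 1 -> `|g2 s - g2 0| <= K) ->
  `|g 1 - g 0 - g1 0 - 2^-1 * g2 0| <= K.
Proof.
move=> K0 d1 d2 dK.
have lin (s a : R) : is_derive s 1 ( *%R a) a.
  by apply: is_derive_eq; rewrite [LHS]mulr1.
have p1 (s : R) : 0 <= s <= 1 -> `|g1 s - g1 0 - s * g2 0| <= K.
  move=> /andP[s0 s1].
  pose k (u : R) := g1 (s * u) - g2 0 * s * u.
  have kd (u : R) : 0 <= u <= 1 -> is_derive u 1 k (s * (g2 (s * u) - g2 0)).
    move=> /andP[u0 u1]; have su : 0 <= s * u <= 1 by rewrite mulr_ge0//= mulr_ile1.
    have h1 := d2 _ su; have h2 := is_derive1_comp h1 (lin u s).
    have h3 := is_deriveB h2 (lin u (g2 0 * s)).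
    by apply: is_derive_eq h3 _; ring.
  have := mvt_bound kd (_ : forall u, _ -> _ <= K).
  rewrite /k !mulr1 !mulr0 subr0 mulrC [X in `|X| <= _](_ : _ = g1 s - g1 0 - s * g2 0).
    apply=> u /andP[u0 u1]; rewrite normrM (ger0_norm s0).
    have su : 0 <= s * u <= 1 by rewrite mulr_ge0//= mulr_ile1.
    by apply: le_trans (dK _ su); rewrite ler_piMl.
  by ring.
pose k (u : R) := g u - g1 0 * u - 2^-1 * g2 0 * u ^+ 2.
have kd (u : R) : 0 <= u <= 1 -> is_derive u 1 k (g1 u - g1 0 - u * g2 0).
  move=> u01; have h1 := d1 _ u01.
  have h2 := is_deriveB h1 (lin u (g1 0)).
  have h3 : is_derive u 1 (fun u : R => 2^-1 * g2 0 * u ^+ 2) (u * g2 0).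
    have h4 : is_derive u 1 (fun u : R => u ^+ 2) (u + u).
      apply: is_derive_eq (is_deriveM (is_derive_id u 1) (is_derive_id u 1)) _.
      by rewrite /= -![_ *: _]/(_ * _) mulr1.
    have h5 := @is_derive1_comp R ( *%R (2^-1 * g2 0)) (fun u => u ^+ 2) u _ _
      (lin (u ^+ 2) _) h4.
    by apply: (is_derive_eq h5); field.
  exact: is_deriveB h2 h3.
have := mvt_bound kd p1.
rewrite /k !mulr0 mulr1 expr0n/= mulr0 !subr0 expr1n mulr1.
by rewrite [X in `|X| <= _ -> _](_ : _ = g 1 - g 0 - g1 0 - 2^-1 * g2 0)//; ring.
Qed.

Lemma is_derive_coord (w : 'rV[R]_2 -> 'rV[R]_3) u v k : derivable w u v ->
  is_derive u v (fun u => w u 0 k) ('D_v w u 0 k).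
Proof.
move=> dw; apply: DeriveDef; first by have /derivable_mxP := dw; exact.
by rewrite (derive_mx dw) mxE.
Qed.

Lemma is_derive_line (g : 'rV[R]_2 -> R) u v (s df : R) :
  is_derive (u + s *: v) v g df -> is_derive s 1 (fun r => g (u + r *: v)) df.
Proof.
move=> [dg <-].
have e : (fun h : R => h^-1 *: (g (u + (h *: 1 + s) *: v) - g (u + s *: v))) =
         (fun h => h^-1 *: (g (h *: v + (u + s *: v)) - g (u + s *: v))).
  apply/funext => h; congr (_ *: (g _ - _)).
  by rewrite [h%:A]mulr1 scalerDl addrCA.
by apply: DeriveDef; rewrite /derivable /derive /= e.
Qed.

Lemma enorm_le3 (v : 'rV[R]_3) B : 0 <= B -> (forall k, `|v 0 k| <= B) -> enorm v <= 3 * B.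
Proof.
move=> B0 vB; rewrite -(@ler_pXn2r _ 2)// ?nnegrE ?enorm_ge0 ?mulr_ge0//.
have sq k : v 0 k ^+ 2 <= B ^+ 2.
  by rewrite -(real_normK (num_real (v 0 k))) lerXn2r ?nnegrE.
rewrite sqr_enorm; apply: le_trans (ler_sum _ (fun k _ => sq k)) _.
rewrite sumr_const card_ord -[_ *+ 3]mulr_natl exprMn.
rewrite ler_wpM2r ?sqr_ge0//; clear; lra.
Qed.

Lemma enorm_half (a b : 'rV[R]_3) (B : R) : enorm a <= B -> enorm b <= B ->
  enorm (2^-1 *: (a + b)) <= B.
Proof.
by rewrite enormZ ger0_norm// => ? ?; have := ler_enormD a b; lra.
Qed.

Lemma lin_bound (p q a b B : R) : `|a| <= B -> `|b| <= B ->
  `|p * a + q * b| <= B * (`|p| + `|q|).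
Proof.
move=> ha hb; apply: (le_trans (ler_normD _ _)).
by rewrite [leRHS]mulrC [leRHS]mulrDl !normrM lerD// ler_wpM2l.
Qed.

Lemma taylor2_coord (a b c d u v v' w : 'rV[R]_3) (p q : R) k :
  (a - b - (p *: c + q *: d)
   - 2^-1 *: (p ^+ 2 *: u + (2 * p * q) *: (2^-1 *: (v + v')) + q ^+ 2 *: w)) 0 k =
  a 0 k - b 0 k - (p * c 0 k + q * d 0 k)
   - 2^-1 * (p * (p * u 0 k + q * v' 0 k) + q * (p * v 0 k + q * w 0 k)).
Proof. by rewrite !mxE; field. Qed.

Variables (f : 'rV[R]_2 -> 'rV[R]_3) (U : set 'rV[R]_2) (e1 e2 u0 : 'rV[R]_2).
Hypotheses (oU : open U) (fs : smooth_on U f) (Uu0 : U u0).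

Let dir (x t : R) := x *: e1 + t *: e2.
Let P x t := u0 + dir x t.
Let D vs x t := iter_derive vs f (P x t).

Lemma derive_dir vs u x t : U u ->
  'D_(dir x t) (iter_derive vs f) u =
  x *: iter_derive (e1 :: vs) f u + t *: iter_derive (e2 :: vs) f u.
Proof.
by move=> Uu; have d := fs vs Uu; rewrite /= !deriveE// linearD !linearZ.
Qed.

Lemma line_derive vs u k x t s : U (u + s *: dir x t) ->
  is_derive s 1 (fun r => iter_derive vs f (u + r *: dir x t) 0 k)
    (x * iter_derive (e1 :: vs) f (u + s *: dir x t) 0 k
     + t * iter_derive (e2 :: vs) f (u + s *: dir x t) 0 k).
Proof.
move=> Us; apply: (is_derive_line (g := fun u => iter_derive vs f u 0 k)).
have dw : derivable (iter_derive vs f) (u + s *: dir x t) (dir x t).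
  by apply: diff_derivable; exact: fs.
have h := is_derive_coord k dw; rewrite (derive_dir _ _ _ Us) in h.
apply: (is_derive_eq h); rewrite mxE; congr (_ + _); exact: mxE.
Qed.

Lemma norm_dir x t : `|dir x t| <= `|x| * `|e1| + `|t| * `|e2|.
Proof. by apply: le_trans (ler_normD _ _) _; rewrite !normrZ. Qed.

Lemma near_box (A : set 'rV[R]_2) : nbhs u0 A ->
  exists2 rho : R, 0 < rho & forall x t, box rho x t -> A (P x t).
Proof.
move=> /nbhs_ballP[r /= r0 rA].
pose m := `|e1| + `|e2| + 1; have m0 : 0 < m by rewrite ltr_wpDl// addr_ge0.
exists (r / (2 * m)); first by rewrite divr_gt0// mulr_gt0.
move=> x t [xr tr]; apply: rA; rewrite -ball_normE /= /P opprD addrA subrr add0r normrN.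
apply: le_lt_trans (norm_dir x t) _.
have l1 := ler_wpM2r (normr_ge0 e1) xr; have l2 := ler_wpM2r (normr_ge0 e2) tr.
have : r / (2 * m) * `|e1| + r / (2 * m) * `|e2| < r.
  rewrite -mulrDr mulrAC ltr_pdivrMr ?mulr_gt0// ltr_pM2l// /m.
  by move: (normr_ge0 e1) (normr_ge0 e2); move: `|e1| `|e2| => a b; lra.
by move: l1 l2; lra.
Qed.

Lemma box_bound (vss : seq (seq 'rV[R]_2)) : exists rho C, [/\ 0 < rho, 1 <= C &
  forall x t, box rho x t -> U (P x t) /\
    forall vs k, vs \in vss -> `|D vs x t 0 k| <= C].
Proof.
elim: vss => [|vs vss [rho [C [rho0 C1 H]]]].
  have [rho rho0 H] := near_box (open_nbhs_nbhs (conj oU Uu0)).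
  by exists rho, 1; split => // x t /H.
have c := differentiable_continuous (fs vs Uu0).
have : \forall u \near u0, `|iter_derive vs f u| < `|iter_derive vs f u0| + 1.
  by apply: (@cvgr_norm_lt _ _ _ _ _ _ _ c); rewrite ltrDl.
move=> /near_box[rho' rho'0 H'].
exists (Num.min rho rho'), (C + (`|iter_derive vs f u0| + 1)); split.
- by rewrite lt_min rho0.
- by rewrite (le_trans C1)// lerDl addr_ge0.
move=> x t [xr tr]; move: xr tr; rewrite !le_min => /andP[x1 x2] /andP[t1 t2].
have [Uz zB] := H x t (conj x1 t1); split => // ws k; rewrite inE => /orP[/eqP->|/zB h].
  apply: le_trans (_ : `|iter_derive vs f (P x t)| <= _).
    rewrite [leRHS]/Num.Def.normr/= mx_normrE; exact: (le_bigmax _ _ (0, k)).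
  by apply: le_trans (ltW (H' _ _ (conj x2 t2))) _; rewrite lerDr (le_trans _ C1).
by apply: le_trans (h k) _; rewrite lerDl addr_ge0.
Qed.

Lemma segment_box rho x t x' t' (s : R) : box rho x t -> box rho x' t' -> 0 <= s <= 1 ->
  box rho (x + s * (x' - x)) (t + s * (t' - t)).
Proof.
have h (a b : R) : `|a| <= rho -> `|b| <= rho -> 0 <= s <= 1 ->
    `|a + s * (b - a)| <= rho.
  move=> ha hb /andP[s0 s1].
  have -> : a + s * (b - a) = (1 - s) * a + s * b by ring.
  apply: le_trans (ler_normD _ _) _; rewrite !normrM (ger0_norm s0) ger0_norm ?subr_ge0//.
  have := ler_wpM2l s0 hb; have := ler_wpM2l (_ : 0 <= 1 - s) ha.
  by rewrite subr_ge0 s1 => /(_ isT); lra.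
by move=> [? ?] [? ?] s01; split; apply: h.
Qed.

Lemma path_box x t x' t' (s : R) :
  P x t + s *: dir (x' - x) (t' - t) = P (x + s * (x' - x)) (t + s * (t' - t)).
Proof. by apply/rowP => i; rewrite !mxE; ring. Qed.

Lemma lip_of_bound rho C vs : 0 <= C ->
  (forall x t, box rho x t -> U (P x t)) ->
  (forall x t k, box rho x t -> `|D vs x t 0 k| <= C) ->
  (forall x t k, box rho x t -> `|D (e1 :: vs) x t 0 k| <= C) ->
  (forall x t k, box rho x t -> `|D (e2 :: vs) x t 0 k| <= C) ->
  forall x t x' t' k, box rho x t -> box rho x' t' ->
    `|D vs x' t' 0 k - D vs x t 0 k| <= C * (`|x' - x| + `|t' - t|).
Proof.
move=> C0 bU b0 b1 b2 x t x' t' k zb zb'.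
have sb (s : R) (s01 : 0 <= s <= 1) := segment_box zb zb' s01.
have dg (s : R) : 0 <= s <= 1 -> is_derive s 1
    (fun r => iter_derive vs f (P x t + r *: dir (x' - x) (t' - t)) 0 k)
    ((x' - x) * iter_derive (e1 :: vs) f (P x t + s *: dir (x' - x) (t' - t)) 0 k
     + (t' - t) * iter_derive (e2 :: vs) f (P x t + s *: dir (x' - x) (t' - t)) 0 k).
  by move=> s01; apply: line_derive; rewrite path_box; exact/bU/sb.
have := mvt_bound dg (_ : forall s, _ -> _ <= C * (`|x' - x| + `|t' - t|)).
rewrite !path_box !mul1r !mul0r !addr0 !(addrC x) !(addrC t) !subrK; apply=> s s01.
by rewrite path_box; apply: lin_bound; [exact: b1 (sb _ s01)|exact: b2 (sb _ s01)].
Qed.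

(** The derivatives of order at most three are bounded near [u0]; the expansion is that of
    the coordinates of [f] along a segment, where the mixed derivatives enter through their
    mean. *)
Lemma jet2_chart : exists rho C, [/\ 0 < rho, 1 <= C,
  forall x t, box rho x t -> U (P x t) &
  jet2 (D [::]) (D [:: e1]) (D [:: e2]) (D [:: e1; e1])
    (fun x t => 2^-1 *: (D [:: e1; e2] x t + D [:: e2; e1] x t)) (D [:: e2; e2]) rho C].
Proof.
pose words1 := [:: [:: e1]; [:: e2]].
pose words2 := [:: [:: e1; e1]; [:: e1; e2]; [:: e2; e1]; [:: e2; e2]].
pose words3 := [seq e1 :: w | w <- words2] ++ [seq e2 :: w | w <- words2].
have [rho [C [rho0 C1 H]]] := box_bound (words1 ++ words2 ++ words3).
have C0 : 0 <= C by apply: le_trans C1.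
have bU x t : box rho x t -> U (P x t) by case/H.
have bB x t vs k : vs \in words1 ++ words2 ++ words3 -> box rho x t ->
  `|D vs x t 0 k| <= C by move=> vw /H[_]; apply.
have L vs : vs \in words1 ++ words2 -> forall x t x' t' k, box rho x t -> box rho x' t' ->
    `|D vs x' t' 0 k - D vs x t 0 k| <= C * (`|x' - x| + `|t' - t|).
  move=> vw; apply: (lip_of_bound C0 bU) => x t k zb; apply: bB zb.
  - by rewrite catA mem_cat vw.
  - move: vw; rewrite !mem_cat => /orP[vw|vw].
      by apply/orP; right; apply/orP; left; move: vw; rewrite !inE => /orP[] /eqP ->; rewrite eqxx ?orbT.
    by rewrite [_ \in [seq e1 :: _ | _ <- _]]map_f ?orbT.
  - move: vw; rewrite !mem_cat => /orP[vw|vw].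
      by apply/orP; right; apply/orP; left; move: vw; rewrite !inE => /orP[] /eqP ->; rewrite eqxx ?orbT.
    by rewrite [_ \in [seq e2 :: _ | _ <- _]]map_f ?orbT.
have BL vs : vs \in words1 ++ words2 -> bounded_lip rho (3 * C) (D vs).
  move=> vw; split=> [x t zb|x t x' t' zb zb'].
    by apply: enorm_le3 => // k; apply: bB zb; rewrite catA mem_cat vw.
  rewrite -mulrA; apply: enorm_le3 => [|k]; first by rewrite mulr_ge0// addr_ge0.
  by rewrite !mxE; exact: L.
exists rho, (3 * C); split => //; first by move: C1; lra.
split.
- by apply: BL; rewrite !inE eqxx ?orbT.
- by apply: BL; rewrite !inE eqxx ?orbT.
- by apply: BL; rewrite !inE eqxx ?orbT.
- have [b1 l1] := BL [:: e1; e2] (ltac:(by rewrite !inE eqxx ?orbT)).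
  have [b2 l2] := BL [:: e2; e1] (ltac:(by rewrite !inE eqxx ?orbT)).
  split=> [x t zb|x t x' t' zb zb'].
    exact: enorm_half (b1 _ _ zb) (b2 _ _ zb).
  by rewrite -scalerBr opprD addrACA; apply: enorm_half; [exact: l1|exact: l2].
- by apply: BL; rewrite !inE eqxx ?orbT.
move=> x t x' t' zb zb'; rewrite -[leRHS]mulrA.
set d := `|x' - x| + `|t' - t|; have d0 : 0 <= d by rewrite addr_ge0.
have Cd : 0 <= C * d ^+ 3 by rewrite mulr_ge0// exprn_ge0.
apply: enorm_le3 => // k.
have sb (s : R) (s01 : 0 <= s <= 1) := segment_box zb zb' s01.
pose Z (s : R) := P x t + s *: dir (x' - x) (t' - t).
pose ld vs (s : R) := iter_derive vs f (Z s) 0 k.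
have ldE vs s : ld vs s = D vs (x + s * (x' - x)) (t + s * (t' - t)) 0 k.
  by rewrite /ld /Z path_box.
have ld0 vs : ld vs 0 = D vs x t 0 k by rewrite ldE !mul0r !addr0.
have ld1 vs : ld vs 1 = D vs x' t' 0 k.
  by rewrite ldE !mul1r (addrC x) (addrC t) !subrK.
have dl vs (s : R) : 0 <= s <= 1 -> is_derive s 1 (ld vs)
    ((x' - x) * ld (e1 :: vs) s + (t' - t) * ld (e2 :: vs) s).
  by move=> s01; apply: line_derive; rewrite path_box; exact/bU/sb.
have lin (a : R) vs (s b : R) : is_derive s 1 (ld vs) b ->
   is_derive s 1 (fun s => a * ld vs s) (a * b).
  by move=> h; have h' := is_deriveZ a h; exact: h'.
pose g1 s := (x' - x) * ld [:: e1] s + (t' - t) * ld [:: e2] s.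
pose g2 s := (x' - x) * ((x' - x) * ld [:: e1; e1] s + (t' - t) * ld [:: e2; e1] s)
  + (t' - t) * ((x' - x) * ld [:: e1; e2] s + (t' - t) * ld [:: e2; e2] s).
have d1 (s : R) : 0 <= s <= 1 -> is_derive s 1 (ld [::]) (g1 s) by exact: dl.
have d2 (s : R) : 0 <= s <= 1 -> is_derive s 1 g1 (g2 s).
  by move=> s01; apply: is_deriveD; apply: lin; exact: dl.
have gK (s : R) : 0 <= s <= 1 -> `|g2 s - g2 0| <= C * d ^+ 3.
  move=> /[dup] s01 /andP[s0 s1].
  have q vs : vs \in words1 ++ words2 -> `|ld vs s - ld vs 0| <= C * d.
    move=> vw; rewrite ld0 ldE; apply: le_trans (L _ vw _ _ _ _ k zb (sb _ s01)) _.
    rewrite ler_wpM2l// ![_ + _ - _]addrC !addKr !normrM -mulrDr (ger0_norm s0).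
    by rewrite ler_piMl.
  have e11 := q [:: e1; e1] (ltac:(by rewrite !inE eqxx ?orbT)).
  have e12 := q [:: e1; e2] (ltac:(by rewrite !inE eqxx ?orbT)).
  have e21 := q [:: e2; e1] (ltac:(by rewrite !inE eqxx ?orbT)).
  have e22 := q [:: e2; e2] (ltac:(by rewrite !inE eqxx ?orbT)).
  pose p := x' - x; pose r := t' - t.
  have -> : g2 s - g2 0 = p * (p * (ld [:: e1; e1] s - ld [:: e1; e1] 0)
      + r * (ld [:: e2; e1] s - ld [:: e2; e1] 0))
    + r * (p * (ld [:: e1; e2] s - ld [:: e1; e2] 0)
      + r * (ld [:: e2; e2] s - ld [:: e2; e2] 0)).
    rewrite /g2 /p /r; move: (x' - x) (t' - t) (ld [:: e1; e1]) (ld [:: e1; e2])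
      (ld [:: e2; e1]) (ld [:: e2; e2]) => a b h1 h2 h3 h4.
    by move: (h1 s) (h1 0) (h2 s) (h2 0) (h3 s) (h3 0) (h4 s) (h4 0) => *; ring.
  have in2 (a b : R) : `|a| <= C * d -> `|b| <= C * d -> `|p * a + r * b| <= C * d * d.
    exact: lin_bound.
  rewrite (_ : C * d ^+ 3 = C * d * d * d); last by ring.
  by apply: lin_bound; exact: in2.
have := taylor2_bound Cd d1 d2 gK.
by rewrite /g1 /g2 !ld0 ld1 taylor2_coord.
Qed.

End chart_jet.

(** * Asymptotic directions from principal curvatures *)

Section asymptotic_basis.
Context {R : realType}.

Lemma cross_eq0_dep (a b : 'rV[R]_3) : cross a b = 0 ->
  dot b b *: a + (- dot a b) *: b = 0.
Proof.
move=> n0; have := dot_cross_cross a b; rewrite n0 dot0l => e.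
(* the square of the norm is [|b|^2 |a x b|^2] *)
apply/eqP; rewrite -enorm_eq0 -sqrf_eq0 sqr_enormE.
apply/eqP; transitivity (dot b b * (dot a a * dot b b - dot a b ^+ 2)).
  by rewrite !dotE (dotC b a); ring.
by rewrite -e mulr0.
Qed.

Lemma dot_cross_comb (a b : 'rV[R]_3) (k x y : R) :
  dot (k *: cross a b) (x *: a + y *: b) = 0.
Proof. by rewrite dotZl dotDr !dotZr dot_crossl dot_crossr !mulr0 addr0 mulr0. Qed.

Lemma dot_comb4 (n p q p' q' : 'rV[R]_3) (x t y s : R) :
  dot n (y *: (x *: p + t *: p') + s *: (x *: q + t *: q')) =
  x * y * dot n p + x * s * dot n q + t * y * dot n p' + t * s * dot n q'.
Proof. by rewrite !dotE; ring. Qed.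

Variables (f : 'rV[R]_2 -> 'rV[R]_3) (U : set 'rV[R]_2).
Hypotheses (oU : open U) (fs : smooth_on U f).
Hypothesis (im : forall u, U u -> immersive_at f u).

Lemma derive2 u (e1 e2 : 'rV[R]_2) (x t : R) : U u ->
  'D_(x *: e1 + t *: e2) f u = x *: 'D_e1 f u + t *: 'D_e2 f u.
Proof. exact: (@derive_dir R f U e1 e2 fs [::] u x t). Qed.

Lemma cross_immersive u (e1 e2 : 'rV[R]_2) : U u ->
  (forall a b : R, a *: e1 + b *: e2 = 0 -> a = 0 /\ b = 0) ->
  cross ('D_e1 f u) ('D_e2 f u) != 0.
Proof.
move=> Uu ind; set a := 'D_e1 f u; set b := 'D_e2 f u; apply/eqP => n0.
have := cross_eq0_dep n0; rewrite -derive2// => /(im Uu)/ind[bb _].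
have b0 : b = 0 by apply: enorm0_eq0; apply/eqP; rewrite -sqrf_eq0 sqr_enormE bb.
have [|_ /eqP] := ind 0 1; last by rewrite oner_eq0.
by apply: (im Uu); rewrite derive2// -/b b0 !scaler0 scale0r add0r.
Qed.

Lemma delta_indep (a b : R) : a *: 'e_0 + b *: 'e_1 = 0 :> 'rV[R]_2 -> a = 0 /\ b = 0.
Proof.
move=> /rowP e; have := e 0; have := e 1; rewrite !mxE/= !mulr0 !mulr1 add0r addr0.
by move=> -> ->.
Qed.

Lemma rV2E (w : 'rV[R]_2) : w = w 0 0 *: 'e_0 + w 0 1 *: 'e_1.
Proof.
apply/rowP => -[[|[|//]] i2]; rewrite !mxE/= ?mulr0 ?mulr1 ?addr0 ?add0r;
  by congr (w 0 _); apply: val_inj.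
Qed.

Let nrm u := cross ('D_('e_0) f u) ('D_('e_1) f u).

Lemma nrm_neq0 u : U u -> nrm u != 0.
Proof. by move=> Uu; apply: cross_immersive => // a b; exact: delta_indep. Qed.

Lemma dot_unit_normal u (w : 'rV[R]_2) : U u -> dot (unit_normal f u) ('D_w f u) = 0.
Proof.
by move=> Uu; rewrite (rV2E w) (derive2 _ _ _ _ Uu); exact: dot_cross_comb.
Qed.

Lemma unit_normal_neq0 u : U u -> unit_normal f u != 0.
Proof.
move=> Uu; rewrite /unit_normal -/(nrm u) scaler_eq0 invr_eq0 enorm_eq0 orbb.
exact: nrm_neq0.
Qed.

Lemma differentiable_derive_coord vs u k : U u ->
  differentiable (fun u => iter_derive vs f u 0 k : R) u.
Proof.
move=> Uu; apply: (@differentiable_comp _ _ _ _ (iter_derive vs f) (fun N : 'rV[R]_3 => N 0 k : R)).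
  exact: fs.
exact: differentiable_coord.
Qed.

Lemma derivable_unit_normal u w : U u -> derivable (unit_normal f) u w.
Proof.
move=> Uu; apply/derivable_mxP => i k; rewrite ord1 {i}; apply: diff_derivable.
have dn l : differentiable (fun u => nrm u 0 l : R) u.
  rewrite (_ : (fun u => _) = (fun u => 'D_('e_0) f u 0 (l + 1)) *
      (fun u => 'D_('e_1) f u 0 (l + 2%:R)) - (fun u => 'D_('e_0) f u 0 (l + 2%:R)) *
      (fun u => 'D_('e_1) f u 0 (l + 1))); last by apply/funext => v; rewrite mxE.
  by apply: differentiableB; apply: differentiableM;
    [exact: (@differentiable_derive_coord [:: 'e_0])
    |exact: (@differentiable_derive_coord [:: 'e_1])
    |exact: (@differentiable_derive_coord [:: 'e_0])
    |exact: (@differentiable_derive_coord [:: 'e_1])].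
have dq : differentiable (fun u => \sum_l nrm u 0 l ^+ 2) u.
  rewrite (_ : (fun u => _) = \sum_l (fun u => nrm u 0 l) ^+ 2); last first.
    by apply/funext => v; rewrite fct_sumE.
  apply: differentiable_sum => l; exact: differentiableX.
have n0 : 0 < \sum_l nrm u 0 l ^+ 2.
  rewrite -sqr_enorm exprn_gt0// lt_neqAle enorm_ge0 eq_sym enorm_eq0 andbT.
  exact: nrm_neq0.
have de : differentiable (fun u => enorm (nrm u)) u.
  apply: (@differentiable_comp _ _ _ _ (fun u => \sum_l nrm u 0 l ^+ 2) Num.sqrt) => //.
  by apply/derivable1_diffP; have [] := is_derive1_sqrt n0.
rewrite (_ : (fun u => _) = (fun u => (enorm (nrm u))^-1) * (fun u => nrm u 0 k)).
  apply: differentiableM => //; apply: differentiableV => //.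
  by rewrite enorm_eq0 nrm_neq0.
by apply/funext => v; rewrite /unit_normal mxE.
Qed.

(** Differentiating the orthogonality of the normal and the tangent vectors. *)
Lemma shape_second_form u (w : 'rV[R]_2) : U u ->
  dot ('D_w (unit_normal f) u) ('D_w f u) = - dot (unit_normal f u) (iter_derive [:: w; w] f u).
Proof.
move=> Uu; apply/eqP; rewrite -addr_eq0; apply/eqP.
pose psi k := (fun u => unit_normal f u 0 k) * (fun u => 'D_w f u 0 k).
have dN k := is_derive_coord k (@derivable_unit_normal u w Uu).
have dF k : is_derive u w (fun u => 'D_w f u 0 k) (iter_derive [:: w; w] f u 0 k).
  by apply: is_derive_coord; apply: diff_derivable; exact: (fs [:: w]).
have dpsi k := is_deriveM (dN k) (dF k).
have := is_derive_sum dpsi.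
rewrite (_ : \sum_k _ = fun u => dot (unit_normal f u) ('D_w f u)); last first.
  by apply/funext => v; rewrite fct_sumE.
case=> _; rewrite (@near_eq_derive _ _ _ _ (cst 0)); last first.
  by near=> v; rewrite dot_unit_normal//; near: v; exact: open_nbhs_nbhs.
rewrite derive_cst => /esym e; rewrite -[RHS]e /dot -big_split.
by apply: eq_bigr => k _; rewrite addrC; congr (_ + _); exact: mulrC.
Unshelve. all: by end_near. Qed.

(** In a principal direction the second fundamental form has the sign of the curvature. *)
Lemma principal_second_form u k : U u -> principal_curvature f u k ->
  exists w, exists2 c : R, 0 < c & dot (unit_normal f u) (iter_derive [:: w; w] f u) = k * c.
Proof.
move=> Uu [w w0 wk]; exists w, (dot ('D_w f u) ('D_w f u)); last first.
  by have := @shape_second_form u w Uu; rewrite -[X in dot X _]opprK wk dotNl dotZl => /oppr_inj.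
rewrite -sqr_enormE exprn_gt0// lt_neqAle enorm_ge0 eq_sym enorm_eq0 andbT.
by apply/eqP => /(im Uu); exact/eqP.
Qed.

Lemma second_form_comb u (w v : 'rV[R]_2) (x t y s : R) : U u ->
  dot (unit_normal f u) (iter_derive [:: x *: v + t *: w; y *: v + s *: w] f u) =
  x * y * dot (unit_normal f u) (iter_derive [:: v; v] f u)
  + x * s * dot (unit_normal f u) (iter_derive [:: v; w] f u)
  + t * y * dot (unit_normal f u) (iter_derive [:: w; v] f u)
  + t * s * dot (unit_normal f u) (iter_derive [:: w; w] f u).
Proof.
move=> Uu.
have e : 'D_(x *: v + t *: w) ('D_(y *: v + s *: w) f) u =
    'D_(x *: v + t *: w) (y \*: 'D_v f + s \*: 'D_w f) u.
  apply: near_eq_derive; near=> z.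
  by rewrite derive2//; near: z; exact: open_nbhs_nbhs.
have dv : derivable ('D_v f) u (x *: v + t *: w).
  by apply: diff_derivable; exact: (fs [:: v]).
have dw : derivable ('D_w f) u (x *: v + t *: w).
  by apply: diff_derivable; exact: (fs [:: w]).
have e2 := etrans (deriveD (derivableZ (k := y) dv) (derivableZ (k := s) dw))
  (congr2 +%R (deriveZ y dv) (deriveZ s dw)).
have e3 := congr2 (fun p q => y *: p + s *: q)
  (@derive_dir R f U v w fs [:: v] u x t Uu) (@derive_dir R f U v w fs [:: w] u x t Uu).
have e4 := etrans e (etrans e2 e3).
exact: etrans (congr1 (dot (unit_normal f u)) e4) (dot_comb4 _ _ _ _ _ _ _ _ _).
Unshelve. all: by end_near. Qed.

(** The second fundamental form is negative on [w1] and positive on [w2], so that the quadratic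
    equation for the slopes [t] of its null directions [w2 + t w1] has two distinct roots. *)
Lemma asymptotic_basis u k1 k2 : U u ->
  principal_curvature f u k1 -> principal_curvature f u k2 -> k1 < 0 < k2 ->
  exists e1 e2, let n := cross ('D_e1 f u) ('D_e2 f u) in
  [/\ n != 0, dot n (iter_derive [:: e1; e1] f u) = 0,
      dot n (iter_derive [:: e2; e2] f u) = 0,
      dot n (2^-1 *: (iter_derive [:: e1; e2] f u + iter_derive [:: e2; e1] f u)) != 0 &
      forall a b : R, a *: e1 + b *: e2 = 0 -> a = 0 /\ b = 0].
Proof.
move=> Uu /(principal_second_form Uu)[w1 [c1 c10 E1]].
move=> /(principal_second_form Uu)[w2 [c2 c20 E2]] /andP[k10 k20].
set N := unit_normal f u in E1 E2.
pose h v w := dot N (iter_derive [:: v; w] f u).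
have A0 : h w1 w1 < 0 by rewrite /h E1 nmulr_rlt0.
have C0 : 0 < h w2 w2 by rewrite /h E2 mulr_gt0.
have hE (x t y s : R) : h (x *: w2 + t *: w1) (y *: w2 + s *: w1) =
   x * y * h w2 w2 + x * s * h w2 w1 + t * y * h w1 w2 + t * s * h w1 w1.
  exact: second_form_comb.
have hdef v w : dot N (iter_derive [:: v; w] f u) = h v w by [].
have Nperp w : dot N ('D_w f u) = 0 by exact: dot_unit_normal.
have N0 : N != 0 := unit_normal_neq0 Uu.
clearbody h N.
pose B := h w2 w1 + h w1 w2.
have [A AE] : {A | h w1 w1 = A} by exists (h w1 w1).
have [C CE] : {C | h w2 w2 = C} by exists (h w2 w2).
rewrite AE in A0 hE; rewrite CE in C0 hE.
have ind (a b : R) : a *: w2 + b *: w1 = 0 -> a = 0 /\ b = 0.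
  move=> e; have h0 : h 0 0 = 0.
    by have := hE 0 0 0 0; rewrite !scale0r addr0 => ->; ring.
  have a0 : a = 0.
    apply/eqP; apply/negPn/negP => an0.
    have e' : 1 *: w2 + 0 *: w1 = 0 *: w2 + (- (b / a)) *: w1.
      apply: (scalerI an0); rewrite !scalerDr !scalerA !mulr1 !mulr0 !scale0r addr0 add0r.
      rewrite mulrN mulrCA divff// mulr1 scaleNr.
      by apply/eqP; rewrite -addr_eq0 e.
    have := hE 1 0 1 0; rewrite {1 2}e' hE => e2.
    have e3 : C = (b / a) ^+ 2 * A by move: e2; move: (b / a) => q; clear -q; lra.
    by move: C0; rewrite e3 ltNge mulr_ge0_le0 ?sqr_ge0// ltW.
  split => //; apply/eqP; apply/negPn/negP => bn0.
  have w10 : w1 = 0.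
    by apply: (scalerI bn0); rewrite scaler0 -e a0 scale0r add0r.
  by move: A0; rewrite -AE w10 h0 ltxx.
pose d := B ^+ 2 - 4 * A * C.
have d0 : 0 < d.
  rewrite /d subr_gt0 (lt_le_trans _ (sqr_ge0 B))// -mulrA pmulr_rlt0// nmulr_rlt0//.
pose s := Num.sqrt d; have s0 : 0 < s by rewrite sqrtr_gt0.
have sd : s ^+ 2 = d by rewrite sqr_sqrtr// ltW.
have An0 : A != 0 by rewrite lt_eqF.
pose t1 := (- B + s) / (2 * A); pose t2 := (- B - s) / (2 * A).
pose e1 := 1 *: w2 + t1 *: w1; pose e2 := 1 *: w2 + t2 *: w1.
have h11 : h e1 e1 = 0.
  rewrite hE; transitivity ((s ^+ 2 - d) / (4 * A)); last by rewrite sd subrr mul0r.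
  by rewrite /t1 /d /B; field.
have h22 : h e2 e2 = 0.
  rewrite hE; transitivity ((s ^+ 2 - d) / (4 * A)); last by rewrite sd subrr mul0r.
  by rewrite /t2 /d /B; field.
have h12 : h e1 e2 + h e2 e1 = - d / A.
  rewrite !hE; transitivity ((- s ^+ 2 + d) / (2 * A) - d / A); last first.
    by rewrite sd; field.
  by rewrite /t1 /t2 /d /B; field.
have inde (a b : R) : a *: e1 + b *: e2 = 0 -> a = 0 /\ b = 0.
  move=> e; have [] := ind (a + b) (a * t1 + b * t2).
    rewrite -e /e1 /e2 !scale1r !scalerDr !scalerA !scalerDl addrACA//.
  move=> ab; rewrite (_ : a = - b); last by apply/eqP; rewrite -addr_eq0 ab.
  rewrite /t1 /t2 (_ : _ + _ = - b * (s / A)); last by field.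
  move=> /eqP; rewrite mulf_eq0 oppr_eq0 mulf_eq0 invr_eq0 (gt_eqF s0) (negbTE An0) !orbF.
  by move=> /eqP ->; rewrite oppr0.
exists e1, e2 => n.
have n0 : n != 0 by exact: cross_immersive.
have Nn : dot n n *: N = dot N n *: n.
  by apply: perp_cross; exact: Nperp.
clearbody n.
have nn0 : dot n n != 0 by rewrite -sqr_enormE sqrf_eq0 enorm_eq0.
have Nn0 : dot N n != 0.
  apply/eqP => e; move: Nn; rewrite e scale0r => /eqP.
  by rewrite scaler_eq0 (negbTE nn0) (negbTE N0).
have nh Y : dot n Y = dot n n / dot N n * dot N Y.
  apply: (mulfI Nn0); rewrite mulrA mulrCA divff// mulr1 -dotZl -Nn dotZl//.
have nz v w : h v w = 0 -> dot n (iter_derive [:: v; w] f u) = 0.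
  move=> e; apply: etrans (nh _) _.
  exact: etrans (congr1 _ (etrans (hdef v w) e)) (mulr0 _).
split.
- exact: n0.
- exact: nz h11.
- exact: nz h22.
- have e : dot n (2^-1 *: (iter_derive [:: e1; e2] f u + iter_derive [:: e2; e1] f u)) =
      dot n n / dot N n * (2^-1 * (- d / A)).
    apply: etrans (nh _) _; congr (_ * _).
    apply: etrans (dotZr _ _ _) _; congr (_ * _).
    exact: etrans (dotDr _ _ _) (etrans (congr2 +%R (hdef _ _) (hdef _ _)) h12).
  rewrite e.
  by rewrite !mulf_neq0// ?invr_neq0// ?oppr_eq0 ?gt_eqF ?pnatr_eq0.
- exact: inde.
Qed.

End asymptotic_basis.

(** * The disc and the lengths of its paths *)

Section plane.
Context {R : realType}.

Lemma norm_le_enorm n (v : 'rV[R]_n) : `|v| <= enorm v.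
Proof.
rewrite [leLHS]/Num.Def.normr/= mx_normrE; apply: bigmax_le => [|[i k] _ /=].
  exact: enorm_ge0.
rewrite ord1 -(@ler_pXn2r _ 2)// ?nnegrE ?enorm_ge0// sqr_enorm real_normK ?num_real//.
by rewrite (bigD1 k)//= lerDl; apply: sumr_ge0 => ? _; exact: sqr_ge0.
Qed.

Lemma ler_coord_norm n (v : 'rV[R]_n) k : `|v 0 k| <= `|v|.
Proof. by rewrite [leRHS]/Num.Def.normr/= mx_normrE; exact: (le_bigmax _ _ (0, k)). Qed.

Lemma ler_coord_enorm n (v : 'rV[R]_n) k : `|v 0 k| <= enorm v.
Proof. exact: le_trans (ler_coord_norm _ _) (norm_le_enorm _). Qed.

Lemma enorm_le_norm n (v : 'rV[R]_n) : enorm v <= n%:R * `|v|.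
Proof.
rewrite -(@ler_pXn2r _ 2)// ?nnegrE ?enorm_ge0 ?mulr_ge0//.
have sq k : v 0 k ^+ 2 <= `|v| ^+ 2.
  by rewrite -(real_normK (num_real (v 0 k))) lerXn2r ?nnegrE// ler_coord_norm.
rewrite sqr_enorm; apply: le_trans (ler_sum _ (fun k _ => sq k)) _.
rewrite sumr_const card_ord -[_ *+ n]mulr_natl exprMn ler_wpM2r ?sqr_ge0//.
by rewrite -natrX ler_nat; case: n {v sq} => // n; rewrite expnS leq_pmulr// expn_gt0.
Qed.

Lemma lip_continuous (X Y : normedModType R) (g : X -> Y) (L : R) :
  (forall a b, `|g a - g b| <= L * `|a - b|) -> continuous g.
Proof.
move=> gL a; apply/cvgrPdist_lt => e e0.
have L1 : 0 < `|L| + 1 by rewrite ltr_wpDl.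
near=> b; apply: le_lt_trans (gL _ _) _.
apply: (@le_lt_trans _ _ ((`|L| + 1) * `|a - b|)).
  by rewrite ler_wpM2r// ler_wpDr// ler_norm.
rewrite mulrC -ltr_pdivlMr//; near: b.
apply/nbhs_ballP; exists (e / (`|L| + 1)) => /=; first by rewrite divr_gt0.
by move=> b; rewrite -ball_normE.
Unshelve. all: by end_near. Qed.

Lemma heine (X Y : normedModType R) (K : set X) (g : X -> Y) : compact K -> continuous g ->
  forall e : R, 0 < e -> exists2 d : R, 0 < d &
    forall a b, K a -> `|a - b| < d -> `|g a - g b| < e.
Proof.
move=> /compact_near_coveringP cK cg e e0.
have e2 : 0 < e / 2 by rewrite divr_gt0.
have H : \forall d \near (0 : R)^'+, K `<=` [set a | forall b, `|a - b| < d -> `|g a - g b| < e].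
  apply: (cK _ _ (fun d a => forall b, `|a - b| < d -> `|g a - g b| < e)) => x Kx.
  have /cvgrPdist_lt/(_ _ e2) := cg x; move=> /nbhs_ballP[r /= r0 rg].
  have r2 : 0 < r / 2 by rewrite divr_gt0.
  exists ([set a | `|x - a| < r / 2], [set d | d < r / 2]) => /=.
    split; last exact: nbhs_right_lt.
    by apply/nbhs_ballP; exists (r / 2) => //= a; rewrite -ball_normE.
  move=> [a d] [/= xa dr] b ab.
  have ga : `|g x - g a| < e / 2.
    by apply: rg; rewrite -ball_normE /=; apply: lt_trans xa _; rewrite ltr_pdivrMr//; lra.
  have gb : `|g x - g b| < e / 2.
    apply: rg; rewrite -ball_normE /=; rewrite -(subrKA a).
    by apply: le_lt_trans (ler_normD _ _) _; lra.
  rewrite -(subrKA (g x)); apply: le_lt_trans (ler_normD _ _) _; rewrite (distrC (g a)).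
  lra.
have : \forall d \near (0 : R)^'+, 0 < d by exact: nbhs_right_gt.
move=> /(filterI H)/filter_ex[d [dK d0]]; exists d => // a b Ka; exact: dK.
Qed.

Definition rscale (v : 'rV[R]_2) : R := Num.max 1 (enorm v).

Lemma rscale_ge1 v : 1 <= rscale v.
Proof. by rewrite /rscale le_max lexx. Qed.

Lemma rscale_gt0 v : 0 < rscale v.
Proof. exact: lt_le_trans (rscale_ge1 v). Qed.

Lemma enorm_ret_le1 v : enorm ((rscale v)^-1 *: v) <= 1.
Proof.
rewrite enormZ ger0_norm; last by rewrite invr_ge0 ltW// rscale_gt0.
by rewrite mulrC ler_pdivrMr ?rscale_gt0// mul1r /rscale le_max lexx orbT.
Qed.

(** The radial retraction of the plane onto the disc. *)
Definition ret (v : 'rV[R]_2) : disc R := 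
  exist _ ((rscale v)^-1 *: v) (mem_set (enorm_ret_le1 v)).

Lemma val_ret v : val (ret v) = (rscale v)^-1 *: v.
Proof. by []. Qed.

Lemma enorm_disc (p : disc R) : enorm (val p) <= 1.
Proof. by case: p => v /= /set_mem. Qed.

Lemma val_ret_id v : enorm v <= 1 -> val (ret v) = v.
Proof. by move=> v1; rewrite val_ret /rscale (max_l v1) invr1 scale1r. Qed.

Lemma retK (p : disc R) : ret (val p) = p.
Proof. by apply: val_inj; rewrite val_ret_id// enorm_disc. Qed.

Lemma ret_lip a b : enorm (val (ret a) - val (ret b)) <= 2 * enorm (a - b).
Proof.
rewrite !val_ret; set k := rscale a; set l := rscale b.
have k1 : 1 <= k := rscale_ge1 a; have k0 := rscale_gt0 a; have l0 := rscale_gt0 b.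
rewrite -/k in k0; rewrite -/l in l0.
have -> : k^-1 *: a - l^-1 *: b = k^-1 *: (a - b) + ((l - k) / k) *: (l^-1 *: b).
  apply/rowP => i; rewrite !mxE; field; by rewrite !gt_eqF.
have kl : `|l - k| <= enorm (a - b).
  apply: le_trans (ler_enorm_dist _ _); rewrite distrC /k /l /rscale.
  rewrite ler_norml; have := ler_norm (enorm a - enorm b); have := ler_norm (- (enorm a - enorm b)).
  rewrite normrN; case: (leP 1 (enorm a)) => ?; case: (leP 1 (enorm b)) => ?; have := normr_ge0 (enorm a - enorm b); lra.
apply: le_trans (ler_enormD _ _) _; rewrite !enormZ -/l.
have ki : `|k^-1| <= 1 by rewrite gtr0_norm ?invr_gt0// invf_le1.
have s1 := ler_wpM2r (enorm_ge0 (a - b)) ki.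
have s2 : `|(l - k) / k| * (`|l^-1| * enorm b) <= enorm (a - b) * 1.
  apply: ler_pM; rewrite ?mulr_ge0 ?enorm_ge0//.
    by rewrite normrM; apply: le_trans kl; rewrite ler_piMr.
  by rewrite -enormZ; exact: enorm_ret_le1.
by move: s1 s2; lra.
Qed.

Lemma continuous_to_disc (T : topologicalType) (g : T -> disc R) :
  continuous (fun t => val (g t)) -> continuous g.
Proof. by move=> cg; apply: continuous_comp_initial. Qed.

Lemma continuous_val : continuous (fun p : disc R => val p).
Proof. exact: initial_continuous. Qed.

Lemma continuous_ret : continuous ret.
Proof.
apply: continuous_to_disc; apply: (@lip_continuous _ _ _ 4) => a b.
apply: le_trans (norm_le_enorm _) _; apply: le_trans (ret_lip a b) _.
by have := enorm_le_norm (a - b); lra.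
Qed.

(** Paths are continuous on the unit interval only; composition with this retraction of the
    line makes them continuous functions on the line. *)
Definition clamp (t : R) : R := Num.max 0 (Num.min 1 t).

Lemma clamp01 t : 0 <= clamp t <= 1.
Proof. by rewrite /clamp le_max lexx /= ge_max ler01 ge_min lexx. Qed.

Lemma clamp_id t : 0 <= t <= 1 -> clamp t = t.
Proof. by move=> /andP[t0 t1]; rewrite /clamp min_r// max_r. Qed.

Lemma continuous_clamp : continuous clamp.
Proof.
apply: (@lip_continuous _ _ _ 1) => a b; rewrite mul1r /clamp.
have h := ler_norm (a - b); have h' := ler_norm (- (a - b)); rewrite normrN in h'.
have h'' := normr_ge0 (a - b).
rewrite ler_norml; case: (leP 1 a) => ?; case: (leP 1 b) => ?;
  rewrite ?(max_r ler01); try case: (leP 0 a) => ?; try case: (leP 0 b) => ?; lra.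
Qed.

Lemma continuous_path_clamp (x y : disc R) (a : R -> disc R) : disc_path x y a ->
  continuous (a \o clamp).
Proof.
move=> [ca _]; apply/continuous_subspace_setT.
apply: (within_continuous_reparam (h := clamp) continuous_clamp _ _ ca) => // t _ /=.
by rewrite in_itv/= clamp01.
Qed.

Lemma compact_unit_segment : compact `[0 : R, 1].
Proof. exact: segment_compact. Qed.

Lemma compact_ball (r : R) : compact [set v : 'rV[R]_2 | enorm v <= r].
Proof.
apply: bounded_closed_compact.
  exists r; split; first exact: num_real.
  by move=> M rM v /= vr; apply: le_trans (norm_le_enorm v) _; apply: le_trans vr (ltW rM).
have ce : continuous (fun v : 'rV[R]_2 => enorm v : R^o).
  apply: (@lip_continuous _ _ _ 2) => a b.
  by apply: le_trans (ler_enorm_dist a b) _; have := enorm_le_norm (a - b).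
by apply: (closed_comp (f := fun v : 'rV[R]_2 => enorm v : R) (D := [set x | x <= r]));
  [move=> *; exact: ce|exact: closed_le].
Qed.

End plane.

Section length.
Context {R : realType}.

Lemma curve_length_lip (Y : Type) (d : Y -> Y -> \bar R) (a b L : R) (g : R -> Y) :
  (forall s t, a <= s -> s <= t -> t <= b -> (d (g s) (g t) <= (L * (t - s))%:E)%E) ->
  (curve_length d a b g <= (L * (b - a))%:E)%E.
Proof.
move=> gL; apply: ge_ereal_sup => _ [n [t [tm t0 tn ->]]].
have tb i : (i <= n)%N -> t i <= b by move=> /tm; rewrite tn.
have ta i : a <= t i by rewrite -t0; exact: tm.
apply: (@le_trans _ _ (\sum_(i < n) (L * (t i.+1 - t i))%:E)%E).
  by apply: lee_sum => i _; apply: gL; [|exact: tm|exact: tb].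
rewrite sumEFin lee_fin -mulr_sumr -tn -t0.
rewrite -(big_mkord xpredT (fun i => t i.+1 - t i)) telescope_sumr//.
Qed.

Lemma sum_le_curve_length n (g : R -> 'rV[R]_n) (N : nat) (t : nat -> R) :
  {homo t : i j / (i <= j)%N >-> i <= j} -> 0 <= t 0%N -> t N <= 1 ->
  ((\sum_(i < N) enorm (g (t i) - g (t i.+1)))%:E <= curve_length Defs.edist 0 1 g)%E.
Proof.
move=> tm t0 tN.
pose u i := if i is i'.+1 then (if (i' <= N)%N then t i' else 1) else 0.
apply: (@le_trans _ _ (\sum_(i < N.+2) Defs.edist (g (u i)) (g (u i.+1)))%E); last first.
  apply: ereal_sup_ubound; exists N.+2, u; split => //.
  - move=> [|i] [|j]//= ij; rewrite ?ltnS in ij.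
      by case: ifP => // _; apply: le_trans t0 _; exact: tm.
    case: ifPn => iN; case: ifPn => jN //; first exact: tm.
      by apply: le_trans tN; exact: tm.
    by move: iN; rewrite (leq_trans ij jN).
  - by rewrite /= ltnn.
rewrite /Defs.edist sumEFin lee_fin.
rewrite -(big_mkord xpredT (fun i => enorm (g (u i) - g (u i.+1)))).
rewrite big_nat_recl//= big_nat_recr//=.
apply: (@le_trans _ _ (\sum_(0 <= i < N) enorm (g (u i.+1) - g (u i.+2)))); last first.
  by rewrite addrCA lerDl addr_ge0// enorm_ge0.
rewrite big_mkord; apply: ler_sum => i _ /=.
by rewrite ltn_ord (ltnW (ltn_ord i)).
Qed.

Lemma dist_le_curve_length n (g : R -> 'rV[R]_n) (s t : R) :
  0 <= s <= 1 -> 0 <= t <= 1 ->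
  ((enorm (g s - g t))%:E <= curve_length Defs.edist 0 1 g)%E.
Proof.
wlog st : s t / s <= t => [hw s01 t01|/andP[s0 s1] /andP[t0 t1]].
  by case: (leP s t) => [|/ltW] st; [exact: hw|rewrite enorm_distC; exact: hw].
have := @sum_le_curve_length n g 1 (fun i => if i is 0%N then s else t).
by rewrite big_ord_recl big_ord0 addr0; apply => // -[|i] [|j].
Qed.

Lemma dist_le_length_dist (s : disc R -> 'rV[R]_3) x y :
  ((enorm (s x - s y))%:E <= length_dist s x y)%E.
Proof.
apply: le_ereal_inf_tmp => _ [a [_ [a0 a1]] <-].
have := @dist_le_curve_length 3 (s \o a) 0 1; rewrite /= a0 a1; apply; by rewrite lexx ler01.
Qed.

Lemma length_dist_lip (s : disc R -> 'rV[R]_3) (x y : disc R) (L : R) :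
  (forall u t : R, 0 <= u -> u <= t -> t <= 1 ->
     enorm (s (ret (val x + u *: (val y - val x))) - s (ret (val x + t *: (val y - val x))))
       <= L * (t - u)) ->
  (length_dist s x y <= L%:E)%E.
Proof.
move=> sL; pose a (t : R) := ret (val x + t *: (val y - val x)).
have pa : disc_path x y a.
  split; last by rewrite /a scale0r addr0 retK scale1r addrC subrK retK.
  apply: continuous_subspaceT => t; apply: (@continuous_comp _ _ _ (fun t : R => val x + t *: (val y - val x)) ret).
    suff : continuous (fun t : R => val x + t *: (val y - val x)) by apply.
    apply: (@lip_continuous R R _ _ `|val y - val x|) => u v.
    by rewrite opprD addrACA subrr add0r -scalerBl normrZ mulrC.
  exact: continuous_ret.
apply: le_trans (_ : curve_length Defs.edist 0 1 (s \o a) <= _)%E.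
  by apply: ereal_inf_lbound; exists a.
have := @curve_length_lip _ Defs.edist 0 1 L (s \o a).
by rewrite subr0 mulr1; apply => u t *; rewrite lee_fin; exact: sL.
Qed.

End length.

(** * Discrete winding numbers *)

Section winding.
Context {R : realType}.
Local Notation point := 'rV[R]_2.

Definition quadrant (v : point) : bool * bool := (0 <= v 0 0, 0 <= v 0 1).

(** The number of quarter turns between two quadrants. Its value on opposite quadrants is
    conventional, and all steps are short enough to avoid this case. *)
Definition turn (a b : bool * bool) : int :=
  match a, b with
  | (true, true), (false, true) | (false, true), (false, false)
  | (false, false), (true, false) | (true, false), (true, true) => 1
  | (false, true), (true, true) | (false, false), (false, true)
  | (true, false), (false, false) | (true, true), (true, false) => -1
  | _, _ => 0
  end.

Arguments turn : simpl never.

Definition opposite (a b : bool * bool) := (a.1 != b.1) && (a.2 != b.2).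

Lemma turn_square a b c d : ~~ opposite a b -> ~~ opposite a c -> ~~ opposite a d ->
  ~~ opposite b c -> ~~ opposite b d -> ~~ opposite c d ->
  turn a b + turn b d = turn a c + turn c d.
Proof. by move: a b c d => [[] []] [[] []] [[] []] [[] []]. Qed.

Lemma norm2_le (v : point) (d : R) : `|v 0 0| <= d -> `|v 0 1| <= d -> `|v| <= d.
Proof.
move=> h0 h1; rewrite [leLHS]/Num.Def.normr/= mx_normrE; apply: bigmax_le => [|[i k] _ /=].
  exact: le_trans h0.
rewrite ord1; case: k => -[|[|//]] k2.
  by rewrite (_ : Ordinal k2 = 0)//; exact: val_inj.
by rewrite (_ : Ordinal k2 = 1)//; exact: val_inj.
Qed.

Lemma near_not_opposite (u v : point) (d : R) : d < `|u| -> `|u - v| <= d ->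
  ~~ opposite (quadrant u) (quadrant v).
Proof.
move=> du uv; apply/negP; rewrite /opposite /quadrant /= => /andP[sx sy].
have h (a b : R) : (0 <= a) != (0 <= b) -> `|a| <= `|a - b|.
  by case: (leP 0 a) => a0; case: (leP 0 b) => b0 //= _; rewrite ler_norml;
    [rewrite ger0_norm; lra|rewrite ler0_norm; lra].
move: du; apply/negP; rewrite -leNgt; apply: norm2_le.
  apply: le_trans (h _ _ sx) _; apply: le_trans uv.
  by have := ler_coord_norm (u - v) 0; rewrite !mxE.
apply: le_trans (h _ _ sy) _; apply: le_trans uv.
by have := ler_coord_norm (u - v) 1; rewrite !mxE.
Qed.

(** Four times the winding number of a polygonal chain around [k], when the chain is
    closed and its steps are short compared to its distance to [k]. *)
Fixpoint wind (k p : point) (l : seq point) : int :=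
  if l is p' :: l' then turn (quadrant (p - k)) (quadrant (p' - k)) + wind k p' l' else 0.

(** The turning of the vector from [k] to [p] while [k] moves along a chain: the contribution
    of an endpoint [p] when the centre of a winding number moves. *)
Fixpoint trace (p k : point) (ks : seq point) : int :=
  if ks is k' :: ks' then turn (quadrant (p - k)) (quadrant (p - k')) + trace p k' ks' else 0.

Definition steps (d : R) (p : point) (l : seq point) : bool := path (fun a b => `|a - b| <= d) p l.

Definition far (d : R) (p : point) (l : seq point) (k : point) : Prop :=
  forall c, c \in p :: l -> 4 * d < `|c - k|.

(** Around each quadrilateral formed by a step of the chain and the step of the centre the
    quarter turns cancel, so that only the two ends contribute. *)
Lemma wind_move d k k' p l : 0 <= d -> steps d p l -> `|k - k'| <= d -> far d p l k ->
  wind k p l - wind k' p l = turn (quadrant (p - k)) (quadrant (p - k'))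
    - turn (quadrant (last p l - k)) (quadrant (last p l - k')).
Proof.
move=> d0; elim: l p => [|p' l IH] p /=; first by rewrite subrr subrr.
move=> /andP[pp' sl] kk' fr.
have fl : far d p' l k by move=> c cl; apply: fr; rewrite inE cl orbT.
have f0 : 4 * d < `|p - k| by apply: fr; exact: mem_head.
have f1 : 4 * d < `|p' - k| by apply: fl; exact: mem_head.
have f2 : 3 * d < `|p - k'|.
  have := ler_normD (p - k') (k' - k); rewrite addrA subrK (distrC k').
  by move: f0 kk'; clear; lra.
have {}IH := IH _ sl kk' fl.
suff : turn (quadrant (p - k)) (quadrant (p' - k)) + turn (quadrant (p' - k)) (quadrant (p' - k'))
     = turn (quadrant (p - k)) (quadrant (p - k')) + turn (quadrant (p - k')) (quadrant (p' - k')).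
  by move: IH; clear; lra.
have eqv (u v w : point) : u = v -> `|v| <= d -> `|u| <= d by move=> ->.
have eqv2 (u v w : point) : u = v + w -> `|v| <= d -> `|w| <= d -> `|u| <= d + d.
  by move=> -> hv hw; apply: le_trans (ler_normD _ _) _; exact: lerD.
have k'k : `|k' - k| <= d by rewrite distrC.
apply: turn_square.
- apply: (@near_not_opposite _ _ d); first by move: f0 d0; clear; lra.
  by apply: (eqv _ (p - p')) => //; apply/rowP => i; rewrite !mxE; ring.
- apply: (@near_not_opposite _ _ d); first by move: f0 d0; clear; lra.
  by apply: (eqv _ (k' - k)) => //; apply/rowP => i; rewrite !mxE; ring.
- apply: (@near_not_opposite _ _ (d + d)); first by move: f0 d0; clear; lra.
  by apply: (eqv2 _ (p - p') (k' - k)) => //; apply/rowP => i; rewrite !mxE; ring.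
- apply: (@near_not_opposite _ _ (d + d)); first by move: f1 d0; clear; lra.
  rewrite -normrN.
  by apply: (eqv2 _ (p - p') (k - k')) => //; apply/rowP => i; rewrite !mxE; ring.
- apply: (@near_not_opposite _ _ d); first by move: f1 d0; clear; lra.
  by apply: (eqv _ (k' - k)) => //; apply/rowP => i; rewrite !mxE; ring.
- apply: (@near_not_opposite _ _ d); first by move: f2 d0; clear; lra.
  by apply: (eqv _ (p - p')) => //; apply/rowP => i; rewrite !mxE; ring.
Qed.

Lemma wind_path d k ks p l : 0 <= d -> steps d p l -> steps d k ks ->
  (forall k', k' \in k :: ks -> far d p l k') ->
  wind k p l - wind (last k ks) p l = trace p k ks - trace (last p l) k ks.
Proof.
move=> d0 sl; elim: ks k => [|k' ks IH] k /=; first by rewrite !subrr.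
move=> /andP[kk' sk] fr.
have := IH k' sk (fun c h => fr c (mem_behead (s := k :: k' :: ks) h)).
by have := wind_move d0 sl kk' (fr k (mem_head _ _)); clear; lra.
Qed.

(** The winding of a chain that stays in a half plane is the variation of a potential. *)
Definition potential (s : bool * bool) (a : bool * bool) : int :=
  let: (dir, side) := s in
  if dir then (if side then (a.2 : nat)%:Z else - (a.2 : nat)%:Z)
  else (if side then - (a.1 : nat)%:Z else (a.1 : nat)%:Z).

(** [s] encodes an axis and a side of it. *)
Definition in_half (s : bool * bool) (a : bool * bool) : bool :=
  if s.1 then a.1 == s.2 else a.2 == s.2.

Lemma wind_half s k p l : (forall c, c \in p :: l -> in_half s (quadrant (c - k))) ->
  wind k p l = potential s (quadrant (last p l - k)) - potential s (quadrant (p - k)).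
Proof.
elim: l p => [|p' l IH] p h /=; first by rewrite subrr.
rewrite IH; last by move=> c cl; apply: h; rewrite inE cl orbT.
have := h p (mem_head _ _); have := h p' (mem_behead (s := [:: p, p' & l]) (mem_head _ _)).
move: (quadrant (p - k)) (quadrant (p' - k)) (quadrant (last p' l - k)).
by case: s {h IH} => [[] []] [[] []] [[] []] [[] []].
Qed.

(** A square whose edges are replaced by chains. *)
Definition cell_wind (k : point) (m : nat -> nat -> point) (H V : nat -> nat -> seq point)
    (i j : nat) : int :=
  wind k (m i j) (H i j) + wind k (m i.+1 j) (V i.+1 j)
  - wind k (m i j.+1) (H i j.+1) - wind k (m i j) (V i j).

Definition lattice (m : nat -> nat -> point) (H V : nat -> nat -> seq point) : Prop :=
  (forall i j, last (m i j) (H i j) = m i.+1 j) /\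
  (forall i j, last (m i j) (V i j) = m i j.+1).

(** The centre can be moved, away from the cell, to a point that sees the cell within a half
    plane, where the winding of a closed chain vanishes. *)
Lemma cell_wind_eq0 d k ks s m H V i j : 0 <= d -> lattice m H V -> steps d k ks ->
  let E (p : point) l := [/\ steps d p l, forall k', k' \in k :: ks -> far d p l k' &
    forall c, c \in p :: l -> in_half s (quadrant (c - last k ks))] in
  E (m i j) (H i j) -> E (m i.+1 j) (V i.+1 j) -> E (m i j.+1) (H i j.+1) ->
  E (m i j) (V i j) -> cell_wind k m H V i j = 0.
Proof.
move=> d0 [mH mV] sk E [s1 f1 h1] [s2 f2 h2] [s3 f3 h3] [s4 f4 h4].
have := wind_path d0 s1 sk f1; have := wind_path d0 s2 sk f2.
have := wind_path d0 s3 sk f3; have := wind_path d0 s4 sk f4.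
rewrite (wind_half h1) (wind_half h2) (wind_half h3) (wind_half h4) !mH !mV /cell_wind.
by clear; lra.
Qed.

Lemma sum_frontier (I : nat -> bool) (h : nat -> int) n : h 0%N = 0 -> h n = 0 ->
  (forall j, (0 < j < n)%N -> I j != I j.-1 -> h j = 0) ->
  \sum_(0 <= j < n) (if I j then h j - h j.+1 else 0) = 0.
Proof.
move=> h0 hn hI; case: n hn hI => [|n] hn hI; first by rewrite big_geq.
have H m : (m <= n)%N -> \sum_(0 <= j < m.+1) (if I j then h j - h j.+1 else 0) =
    if I m then - h m.+1 else 0.
  elim: m => [|m IH] mn; first by rewrite big_nat1 h0 sub0r.
  rewrite big_nat_recr//= IH ?(ltnW mn)//.
  have := hI m.+1; rewrite /= ltnS mn => /(_ isT).
  have [->|ne] := eqVneq (I m.+1) (I m) => e; first by case: (I m); [ring|exact: addr0].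
  by rewrite (e isT); case: (I m); case: (I m.+1); ring.
by rewrite H// hn oppr0; case: ifP.
Qed.

(** Winding numbers detect that the frontier of a set of squares separates: a chain from
    [kx] to [ky] cannot stay away from the images of the frontier edges when the squares of
    the set wind around [kx] in total but not around [ky]. *)
Lemma grid_winding d n (I : nat -> nat -> bool) m H V kx ks :
  0 <= d -> lattice m H V -> steps d kx ks ->
  (forall i j, (i <= n)%N -> (j <= n)%N -> steps d (m i j) (H i j) /\ steps d (m i j) (V i j)) ->
  (forall i j, (i < n)%N -> (j <= n)%N ->
     [|| j == 0%N, j == n | I i j != I i j.-1] ->
     forall k, k \in kx :: ks -> far d (m i j) (H i j) k) ->
  (forall i j, (i <= n)%N -> (j < n)%N ->
     [|| i == 0%N, i == n | I i j != I i.-1 j] ->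
     forall k, k \in kx :: ks -> far d (m i j) (V i j) k) ->
  (forall i j, (i < n)%N -> (j < n)%N -> ~~ I i j -> cell_wind kx m H V i j = 0) ->
  (forall i j, (i < n)%N -> (j < n)%N -> I i j -> cell_wind (last kx ks) m H V i j = 0) ->
  \sum_(0 <= i < n) \sum_(0 <= j < n) cell_wind kx m H V i j = 0.
Proof.
move=> d0 [mH mV] sk sHV fH fV cx cy.
set ky := last kx ks in cy.
pose h i j := wind kx (m i j) (H i j) - wind ky (m i j) (H i j)
  - (trace (m i j) kx ks - trace (m i.+1 j) kx ks).
pose v i j := wind kx (m i j) (V i j) - wind ky (m i j) (V i j)
  - (trace (m i j) kx ks - trace (m i j.+1) kx ks).
have h0 i j : (i < n)%N -> (j <= n)%N -> [|| j == 0%N, j == n | I i j != I i j.-1] -> h i j = 0.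
  move=> iN jN e; rewrite /h; have [s _] := sHV _ _ (ltnW iN) jN.
  by rewrite (wind_path d0 s sk (fH _ _ iN jN e)) mH subrr.
have v0 i j : (i <= n)%N -> (j < n)%N -> [|| i == 0%N, i == n | I i j != I i.-1 j] -> v i j = 0.
  move=> iN jN e; rewrite /v; have [_ s] := sHV _ _ iN (ltnW jN).
  by rewrite (wind_path d0 s sk (fV _ _ iN jN e)) mV subrr.
have E i j : (i < n)%N -> (j < n)%N -> cell_wind kx m H V i j =
    (if I i j then h i j - h i j.+1 else 0) - (if I i j then v i j - v i.+1 j else 0).
  move=> iN jN; case: ifP => Iij; last by rewrite cx ?Iij// subrr.
  have := cy _ _ iN jN Iij; rewrite /cell_wind /h /v.
  by clear; lra.
transitivity (\sum_(0 <= i < n) \sum_(0 <= j < n)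
   ((if I i j then h i j - h i j.+1 else 0) - (if I i j then v i j - v i.+1 j else 0))).
  rewrite [LHS]big_nat [RHS]big_nat; apply: eq_bigr => i /andP[_ iN].
  rewrite [LHS]big_nat [RHS]big_nat; apply: eq_bigr => j /andP[_ jN].
  exact: E.
under eq_bigr do rewrite sumrB.
rewrite sumrB [X in X - _]big_nat [X in X - _]big1 ?sub0r => [|i /andP[_ iN]]; last first.
  apply: sum_frontier => [||j /andP[j0 jN] e].
  - exact: h0.
  - by apply: h0 => //; rewrite eqxx orbT.
  - by apply: h0; rewrite ?(ltnW jN)// e !orbT.
rewrite exchange_big/= big_nat big1 ?oppr0// => j /andP[_ jN].
apply: (@sum_frontier (I^~ j) (v^~ j)) => [||i /andP[i0 iN] e].
- exact: v0.
- by apply: v0 => //; rewrite eqxx orbT.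
- by apply: v0; rewrite ?(ltnW iN)// e !orbT.
Qed.

(** Only the outer edges survive in the sum. Each side of the grid is seen within a half plane,
    and the variations of the four potentials add up to one full turn. *)
Lemma total_wind n k m H V : lattice m H V ->
  (forall i, (i < n)%N -> [/\ H i 0%N = [:: m i.+1 0%N], H i n = [:: m i.+1 n],
     V 0%N i = [:: m 0%N i.+1] & V n i = [:: m n i.+1]]) ->
  (forall i, (i <= n)%N -> [/\ (m i 0%N - k) 0 1 < 0, 0 <= (m i n - k) 0 1,
     (m 0%N i - k) 0 0 < 0 & 0 <= (m n i - k) 0 0]) ->
  \sum_(0 <= i < n) \sum_(0 <= j < n) cell_wind k m H V i j = 4.
Proof.
move=> _ HV bd.
have tel1 (f : nat -> nat -> int) : \sum_(0 <= i < n) \sum_(0 <= j < n) (f i j - f i j.+1) =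
    \sum_(0 <= i < n) (f i 0%N - f i n).
  by apply: eq_bigr => i _; rewrite -[RHS]opprB -telescope_sumr// -sumrN;
    apply: eq_bigr => j _; rewrite opprB.
pose h i j := wind k (m i j) (H i j); pose v i j := wind k (m i j) (V i j).
transitivity (\sum_(0 <= i < n) \sum_(0 <= j < n) ((h i j - h i j.+1) - (v i j - v i.+1 j))).
  by apply: eq_bigr => i _; apply: eq_bigr => j _; rewrite /cell_wind /h /v; ring.
under eq_bigr do rewrite sumrB.
rewrite sumrB tel1 exchange_big/= (tel1 (fun j i => v i j)) !sumrB.
have tel2 (f : nat -> int) (F : nat -> int) : (forall i, (i < n)%N -> f i = F i.+1 - F i) ->
    \sum_(0 <= i < n) f i = F n - F 0%N.
  by move=> fF; rewrite -telescope_sumr// !big_nat; apply: eq_bigr => i /andP[_ /fF].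
pose Q i j := quadrant (m i j - k).
have half (s : bool * bool) i j i' j' : in_half s (Q i j) -> in_half s (Q i' j') ->
    wind k (m i j) [:: m i' j'] = potential s (Q i' j') - potential s (Q i j).
  by move=> h1 h2; rewrite (@wind_half s)// => c; rewrite !inE => /orP[] /eqP ->.
have bot i : (i <= n)%N -> in_half (false, false) (Q i 0%N).
  by move=> /bd[l _ _ _]; rewrite /in_half/= leNgt l.
have top i : (i <= n)%N -> in_half (false, true) (Q i n).
  by move=> /bd[_ l _ _]; rewrite /in_half/= l.
have left i : (i <= n)%N -> in_half (true, false) (Q 0%N i).
  by move=> /bd[_ _ l _]; rewrite /in_half/= leNgt l.
have right i : (i <= n)%N -> in_half (true, true) (Q n i).
  by move=> /bd[_ _ _ l]; rewrite /in_half/= l.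
rewrite (tel2 _ (fun i => potential (false, false) (Q i 0%N))); last first.
  by move=> i iN; rewrite /h; have [-> _ _ _] := HV _ iN; apply: half; apply: bot => //; exact: ltnW.
rewrite (tel2 _ (fun i => potential (false, true) (Q i n))); last first.
  by move=> i iN; rewrite /h; have [_ -> _ _] := HV _ iN; apply: half; apply: top => //; exact: ltnW.
rewrite (tel2 _ (fun i => potential (true, false) (Q 0%N i))); last first.
  by move=> i iN; rewrite /v; have [_ _ -> _] := HV _ iN; apply: half; apply: left => //; exact: ltnW.
rewrite (tel2 _ (fun i => potential (true, true) (Q n i))); last first.
  by move=> i iN; rewrite /v; have [_ _ _ ->] := HV _ iN; apply: half; apply: right => //; exact: ltnW.
have := bd _ (leq0n n); have := bd _ (leqnn n); rewrite /potential /Q /quadrant /=.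
move=> [n1 n2 n3 n4] [z1 z2 z3 z4].
by rewrite n2 n4 z2 z4 !leNgt n1 n3 z1 z3.
Qed.

End winding.

(** * Images of short edges *)

Section lifts.
Context {R : realType}.
Local Notation point := 'rV[R]_2.

Lemma sample_path (x y : disc R) (a : R -> disc R) (d : R) : disc_path x y a -> 0 < d ->
  exists l : seq point, [/\ last (val x) l = val y, steps d (val x) l &
    forall c, c \in val x :: l -> exists2 r, 0 <= r <= 1 & c = val (a r)].
Proof.
move=> pa d0; have ca := continuous_path_clamp pa; case: pa => _ [a0 a1].
have cv : continuous (fun r : R => val (a (clamp r)) : point).
  move=> r; apply: (@continuous_comp _ _ _ (a \o clamp) (fun p : disc R => val p)); first exact: ca.
  exact: continuous_val.
have [e e0 H] := heine compact_unit_segment cv d0.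
pose N := (Num.bound e^-1).+1.
have N0 : 0 < N%:R :> R by rewrite ltr0n.
have Ne : N%:R^-1 < e.
  rewrite invf_plt ?posrE//; apply: lt_trans (archi_boundP _) _; last by rewrite ltr_nat.
  by rewrite invr_ge0 ltW.
pose p (i : nat) := val (a (i%:R / N%:R)).
have in01 i : (i <= N)%N -> 0 <= (i%:R / N%:R : R) <= 1.
  by move=> iN; rewrite divr_ge0//= ler_pdivrMr// mul1r ler_nat.
have px : val x = p 0%N by rewrite /p mul0r a0.
exists (map p (iota 1 N)); split.
- have li m : last 0%N (iota 1 m) = m.
    by case: m => // m; rewrite -(addn1 m) iotaD last_cat /= add1n addn1.
  rewrite px last_map li.
  by rewrite /p divff ?gt_eqF// a1.
- rewrite px /steps path_map.
  have : forall k i, (i + k <= N)%N ->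
      path (relpre p (fun b c : point => `|b - c| <= d)) i (iota i.+1 k).
    elim=> [//|k IH] i ik /=; rewrite IH ?addSnnS// andbT.
    have iN : (i < N)%N by apply: leq_trans ik; rewrite addnS ltnS leq_addr.
    have i1 := in01 _ (ltnW iN); have i2 := in01 _ iN.
    have := H (i%:R / N%:R) (i.+1%:R / N%:R); rewrite /= in_itv/= i1 => /(_ isT).
    rewrite !clamp_id// -mulrBl -(natr1 i) opprD addrA subrr sub0r mulN1r normrN.
    by rewrite ger0_norm ?invr_ge0// natr1 => /(_ Ne)/ltW.
  by apply.
- move=> c; rewrite inE => /orP[/eqP ->|/mapP[i + ->]].
    by exists 0; rewrite ?a0 // lexx ler01.
  by rewrite mem_iota add1n ltnS => /andP[_ iN]; exists (i%:R / N%:R) => //; exact: in01.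
Qed.

Variables (s s' : disc R -> 'rV[R]_3) (M : disc R -> disc R) (C : R).
Hypothesis C0 : 0 < C.
Hypothesis sC : forall p q, (length_dist s p q <= (C * enorm (val p - val q))%:E)%E.
Hypothesis M1 : forall p q, (length_dist s' (M p) (M q) <= length_dist s p q)%E.
Hypothesis M2 : forall p, s' (M p) = s p.
Hypothesis M3 : forall p, enorm (val p) = 1 -> M p = p.

(** As [M] is the identity on the circle, it is extended by the identity. *)
Definition plane_map (v : point) : point := if enorm v <= 1 then val (M (ret v)) else v.

Lemma enorm_ret (v : point) : 1 <= enorm v -> enorm (val (ret v)) = 1.
Proof.
move=> v1; have v0 : 0 < enorm v by apply: lt_le_trans v1.
by rewrite val_ret /rscale (max_r v1) enormZ gtr0_norm ?invr_gt0// mulVf// gt_eqF.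
Qed.

Lemma plane_map_out v : 1 < enorm v -> plane_map v = v.
Proof. by move=> v1; rewrite /plane_map leNgt v1. Qed.

Lemma plane_map_ret v : ret (plane_map v) = M (ret v).
Proof.
rewrite /plane_map; case: (leP (enorm v) 1) => [_|v1]; first by rewrite retK.
by rewrite M3// enorm_ret// ltW.
Qed.

Lemma plane_mapE v : s' (ret (plane_map v)) = s (ret v).
Proof. by rewrite plane_map_ret M2. Qed.

Lemma s_lip p q : enorm (s p - s q) <= C * enorm (val p - val q).
Proof. by rewrite -lee_fin; apply: le_trans (sC p q); exact: dist_le_length_dist. Qed.

Lemma dist_ret (v w : point) : enorm w <= 1 -> enorm (v - val (ret v)) <= enorm (v - w).
Proof.
move=> w1; case: (leP (enorm v) 1) => v1.
  by rewrite val_ret_id// subrr enorm0 enorm_ge0.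
have v0 : 0 < enorm v by apply: lt_trans v1.
rewrite val_ret /rscale (max_r (ltW v1)).
have -> : v - (enorm v)^-1 *: v = (1 - (enorm v)^-1) *: v by rewrite scalerBl scale1r.
rewrite enormZ ger0_norm; last by rewrite subr_ge0 invf_le1// ltW.
rewrite mulrBl mul1r mulVf ?gt_eqF//.
by have := ler_enorm_dist v w; have := ler_norm (enorm v - enorm w); lra.
Qed.

Lemma sample_short (P Q : disc R) (e d : R) : 0 < d -> (length_dist s' P Q < e%:E)%E ->
  exists l : seq point, [/\ last (val P) l = val Q, steps d (val P) l,
    forall c, c \in val P :: l -> `|s' (ret c) - s' P| <= e &
    forall c, c \in val P :: l -> enorm c <= 1].
Proof.
move=> d0 /ereal_inf_lt[_ [a pa <-] le].
have [l [ll sl lc]] := sample_path pa d0; exists l; split => // c /lc[r r01 ->].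
  rewrite retK; apply: le_trans (norm_le_enorm _) _.
  have [_ [a0 _]] := pa; rewrite -a0.
  have := @dist_le_curve_length R 3 (s' \o a) r 0 r01; rewrite lexx ler01 => /(_ isT) /=.
  by move=> h; have := le_lt_trans h le; rewrite lte_fin => /ltW.
exact: enorm_disc.
Qed.

(** The map [M] need not be continuous. The image of a short edge is replaced by a fine sample of
    a path between the images of its endpoints that [s'] maps to a short curve. *)
Lemma lift_edge (e d : R) : 0 < e -> 0 < d -> exists2 e0 : R, 0 < e0 &
  forall z z' : point, enorm (z - z') <= e0 -> exists l : seq point,
  [/\ last (plane_map z) l = plane_map z', steps d (plane_map z) l,
    forall c, c \in plane_map z :: l -> `|s' (ret c) - s (ret z)| <= e,
    1 < enorm z -> 1 < enorm z' -> l = [:: z'] &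
    forall c, c \in plane_map z :: l -> enorm c <= 1 \/ c = z \/ c = z'].
Proof.
move=> e_gt0 d0; pose e0 := Num.min d (e / (3 * C)).
have e00 : 0 < e0 by rewrite lt_min d0 divr_gt0// mulr_gt0.
have C3 : 0 < 3 * C by rewrite mulr_gt0.
exists e0 => // z z' zz'.
have zd : enorm (z - z') <= d by apply: le_trans zz' _; rewrite /e0 ge_min lexx.
have ze : 3 * C * enorm (z - z') <= e.
  by rewrite mulrC -ler_pdivlMr//; apply: le_trans zz' _; rewrite /e0 ge_min lexx orbT.
have n0 := enorm_ge0 (z - z').
have Cn : 0 <= C * enorm (z - z') by rewrite mulr_ge0// ltW.
have Sz : `|s (ret z') - s (ret z)| <= e.
  apply: le_trans (norm_le_enorm _) _; apply: le_trans (s_lip _ _) _.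
  have := ret_lip z' z; rewrite (enorm_distC z') => h.
  by have := ler_wpM2l (ltW C0) h; move: ze Cn; lra.
have mem1 (c : point) : c \in plane_map z :: [:: plane_map z'] ->
    c = plane_map z \/ c = plane_map z'.
  by rewrite !inE => /orP[] /eqP ->; [left|right].
have [/andP[z1 z1']|out] := boolP ((1 < enorm z) && (1 < enorm z')).
  exists [:: z']; rewrite !plane_map_out//; split => //=.
  - by rewrite andbT; apply: le_trans (norm_le_enorm _) zd.
  - move=> c; rewrite !inE => /orP[] /eqP ->.
      rewrite -{1}(plane_map_out z1) plane_mapE subrr normr0 ltW//.
    by rewrite -{1}(plane_map_out z1') plane_mapE.
  - by move=> c; rewrite !inE => /orP[] /eqP ->; right; [left|right].
have in_out : enorm z <= 1 \/ enorm z' <= 1.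
  by move: out; rewrite negb_and -!leNgt => /orP[]; [left|right].
have ePQ : (length_dist s' (M (ret z)) (M (ret z')) < e%:E)%E.
  apply: le_lt_trans (M1 _ _) _; apply: le_lt_trans (sC _ _) _; rewrite lte_fin.
  have h := ler_wpM2l (ltW C0) (ret_lip z z').
  by move: ze e_gt0 h; lra.
have [l [ll sl lc lb]] := sample_short d0 ePQ.
have near_ret w w' : enorm w <= 1 \/ enorm w' <= 1 -> enorm (w - w') <= d ->
    `|plane_map w - val (M (ret w))| <= d.
  move=> ww wd; rewrite /plane_map; case: (leP (enorm w) 1) => w1.
    by rewrite subrr normr0 ltW.
  rewrite M3 ?enorm_ret ?(ltW w1)//; apply: le_trans (norm_le_enorm _) _.
  apply: le_trans wd; apply: dist_ret; case: ww => //.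
  by rewrite leNgt w1.
exists (val (M (ret z)) :: rcons l (plane_map z')); split.
- by rewrite /= last_rcons.
- rewrite /steps /= (near_ret _ z')//= rcons_path; apply/andP; split; first exact: sl.
  by rewrite ll distrC (near_ret _ z)// 1?enorm_distC//; case: in_out; [right|left].
- move=> c; rewrite inE => /orP[/eqP ->|]; first by rewrite plane_mapE subrr normr0 ltW.
  rewrite -rcons_cons mem_rcons inE => /orP[/eqP ->|cl]; first by rewrite plane_mapE.
  by rewrite -M2; exact: lc.
- by move=> z1 z1'; move: out; rewrite z1 z1'.
- have pm w : enorm (plane_map w) <= 1 \/ plane_map w = w.
    by rewrite /plane_map; case: ifP => _; [left; exact: enorm_disc|right].
  move=> c; rewrite inE => /orP[/eqP ->|]; first by case: (pm z); auto.
  rewrite -rcons_cons mem_rcons inE => /orP[/eqP ->|cl]; first by case: (pm z'); auto.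
  by left; exact: lb.
Qed.

End lifts.

(** * Images of grid cells away from a point *)

Section numeric.
Context {R : realType}.
Implicit Types (t u v : R).

Lemma abs_between t u v : (u < t) != (v < t) -> `|u - t| <= `|u - v|.
Proof.
case: (ltP u t) => ut; case: (ltP v t) => vt //= _.
  by rewrite ltr0_norm ?subr_lt0// ltr0_norm ?subr_lt0; [lra|exact: lt_le_trans vt].
by rewrite ger0_norm ?subr_ge0// ger0_norm ?subr_ge0; [lra|apply: ltW; exact: lt_le_trans ut].
Qed.

Lemma coordinate_in_frame t : `|t| <= 1 -> (-2 - t < 0) * (0 <= 2 - t).
Proof. by rewrite ler_norml => /andP[t1 t2]; split; lra. Qed.

Lemma margin_split t u v : 0 < t -> u <= t / 4 -> v < t / 2 -> t < u + v -> False.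
Proof. lra. Qed.

Lemma outer_gap t u v d : 2 <= t -> u <= 1 -> d <= 8^-1 -> t <= v + u -> 4 * d < v.
Proof. lra. Qed.

Lemma chain_gap t u v w d : u <= d / 8 -> v < d / 2 -> t <= d / 8 -> w <= d / 4 -> 0 < d ->
  d <= u + v + t + w -> False.
Proof. lra. Qed.

Lemma sign_far t u : 5 < `|t| -> -4 <= u <= 4 -> (t <= u) = (t < 0).
Proof.
move=> t5 /andP[u1 u2]; apply/idP/idP => h.
  by case: (ltP t 0) => // t0; move: t5 u2 h; rewrite ger0_norm//; lra.
by move: t5 u1; rewrite ltr0_norm//; lra.
Qed.

End numeric.

Section cells.
Context {R : realType}.
Local Notation point := 'rV[R]_2.

Variables (s s' : disc R -> 'rV[R]_3) (M : disc R -> disc R) (C c : R).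
Hypotheses (C0 : 0 < C) (c0 : 0 < c).
Hypothesis cs' : continuous s'.
Hypothesis sC : forall p q, (length_dist s p q <= (C * enorm (val p - val q))%:E)%E.
Hypothesis sc : forall p q, c * enorm (val p - val q) <= enorm (s p - s q).
Hypothesis M1 : forall p q, (length_dist s' (M p) (M q) <= length_dist s p q)%E.
Hypothesis M2 : forall p, s' (M p) = s p.
Hypothesis M3 : forall p, enorm (val p) = 1 -> M p = p.

Let ld (x p : disc R) : R := fine (length_dist s x p).

Lemma ldE x p : length_dist s x p = (ld x p)%:E.
Proof.
rewrite /ld fineK// ge0_fin_numE ?length_dist_ge0//.
by apply: le_lt_trans (sC x p) _; rewrite ltry.
Qed.

Lemma ld_lip x p q : `|ld x p - ld x q| <= C * enorm (val p - val q).
Proof.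
have h p' q' : ld x p' - ld x q' <= C * enorm (val p' - val q').
  rewrite lerBlDr addrC -lee_fin EFinD -!ldE.
  apply: le_trans (length_dist_triangle s q' x p') _.
  by apply: leeD => //; rewrite length_distC.
by rewrite ler_norml h andbT lerNl opprB enorm_distC h.
Qed.

Let Sp (v : point) := s (ret v).
Let S'p (v : point) := s' (ret v).

Lemma Sp_lip v w : `|Sp v - Sp w| <= 2 * C * enorm (v - w).
Proof.
apply: le_trans (norm_le_enorm _) _; apply: le_trans (s_lip sC _ _) _.
by rewrite (mulrC 2) -mulrA ler_pM2l// ret_lip.
Qed.

Lemma Ux_lip x v w : `|ld x (ret v) - ld x (ret w)| <= 2 * C * enorm (v - w).
Proof.
apply: le_trans (ld_lip _ _ _) _.
by rewrite (mulrC 2) -mulrA ler_pM2l// ret_lip.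
Qed.

Lemma S'p_continuous : continuous S'p.
Proof. by move=> v; apply: (@continuous_comp _ _ _ (@ret R) s'); [exact: continuous_ret|exact: cs']. Qed.

Lemma lip2_continuous (Y : normedModType R) (g : point -> Y) (L : R) : 0 <= L ->
  (forall a b, `|g a - g b| <= L * enorm (a - b)) -> continuous g.
Proof.
move=> L0 h; apply: (@lip_continuous _ _ _ _ (L * 2)) => a b.
apply: le_trans (h _ _) _; rewrite -mulrA ler_wpM2l//; exact: (enorm_le_norm (a - b)).
Qed.

(** If no point at distance [t] from [x] has the same image as a point of the path then, by
    compactness, the images of the points at nearly this distance stay away from the path. *)
Lemma margin x P Q a (t : R) : disc_path P Q a ->
  (forall p r, 0 <= r <= 1 -> s p = s' (a r) -> ld x p = t -> False) ->
  exists2 e : R, 0 < e & forall v r, 0 <= r <= 1 -> `|ld x (ret v) - t| <= e ->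
    e < `|Sp v - s' (a r)|.
Proof.
move=> pa nohit; have ca := continuous_path_clamp pa.
pose phi (z : point * R) : R := `|ld x (ret z.1) - t| + `|Sp z.1 - s' (a (clamp z.2))|.
pose K : set (point * R) := [set v | enorm v <= 1] `*` `[0, 1].
have cK : compact K by apply: compact_setX; [exact: compact_ball|exact: segment_compact].
have K0 : K !=set0 by exists (0, 0); split => /=; [rewrite enorm0|rewrite in_itv/= lexx ler01].
have cphi : continuous phi.
  have C20 : 0 <= 2 * C by rewrite mulr_ge0// ltW.
  have c1 : continuous (fun z : point * R => ld x (ret z.1) : R).
    move=> z; apply: (@continuous_comp _ _ _ fst (fun v : point => ld x (ret v) : R)).
      exact: cvg_fst.
    exact: (lip2_continuous C20 (Ux_lip x)).
  have c2 : continuous (fun z : point * R => Sp z.1).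
    move=> z; apply: (@continuous_comp _ _ _ fst Sp); first exact: cvg_fst.
    exact: (lip2_continuous C20 Sp_lip).
  have c3 : continuous (fun z : point * R => s' (a (clamp z.2))).
    move=> z; apply: (@continuous_comp _ _ _ snd (s' \o (a \o clamp))); first exact: cvg_snd.
    by apply: continuous_comp; [exact: ca|exact: cs'].
  move=> z; apply: cvgD; apply: cvg_norm; apply: cvgB => //.
  - exact: c1.
  - exact: cvg_cst.
  - exact: c2.
  - exact: c3.
have [[v r] /set_mem[/= v1 r1] min] := compact_EVT_min K0 cK (continuous_subspaceT cphi).
move: r1; rewrite in_itv/= => r01.
have pos : 0 < phi (v, r).
  rewrite lt_neqAle addr_ge0// andbT eq_sym; apply/negP; rewrite /phi /= paddr_eq0//.
  rewrite !normr_eq0 !subr_eq0 clamp_id// => /andP[/eqP e1 /eqP e2].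
  exact: (nohit (ret v) r r01 e2 e1).
exists (phi (v, r) / 3); first by rewrite divr_gt0.
move=> w q q01 le; rewrite ltNge; apply/negP => le2.
have inK : K (val (ret w), q) by split => /=; [exact: (enorm_disc (ret w))|rewrite in_itv].
have h := min _ (mem_set inK).
have phiE : phi (val (ret w), q) = `|ld x (ret w) - t| + `|Sp w - s' (a q)|.
  transitivity (`|ld x (ret (val (ret w))) - t| + `|s (ret (val (ret w))) - s' (a (clamp q))|) => //.
  by rewrite retK clamp_id.
rewrite phiE in h.
by move: pos le le2 h; lra.
Qed.

Definition grid_point (n i j : nat) : point :=
  \row_k (if k == 0 then 4 * i%:R / n%:R - 2 else 4 * j%:R / n%:R - 2).

Lemma grid_point0 n i j : grid_point n i j 0 0 = 4 * i%:R / n%:R - 2.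
Proof. by rewrite mxE. Qed.

Lemma grid_point1 n i j : grid_point n i j 0 1 = 4 * j%:R / n%:R - 2.
Proof. by rewrite mxE. Qed.

Lemma enorm2_le (v : point) (d : R) : `|v 0 0| <= d -> `|v 0 1| <= d -> enorm v <= 2 * d.
Proof.
move=> h0 h1; apply: le_trans (enorm_le_norm v) _; rewrite ler_pM2l//.
exact: norm2_le.
Qed.

Lemma grid_point_step n i j i' j' (e : R) : (0 < n)%N -> (i <= i' <= i.+1)%N -> (j <= j' <= j.+1)%N ->
  8 / n%:R <= e -> enorm (grid_point n i' j' - grid_point n i j) <= e.
Proof.
move=> n0 /andP[i1 i2] /andP[j1 j2]; have n0' : 0 < n%:R :> R by rewrite ltr0n.
apply: le_trans; rewrite -[leRHS](_ : 2 * (4 / n%:R) = _); last by field; rewrite gt_eqF.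
have h (k k' : nat) : (k <= k')%N -> (k' <= k.+1)%N ->
    `|4 * k'%:R / n%:R - 2 - (4 * k%:R / n%:R - 2)| <= 4 / n%:R :> R.
  move=> k1 k2; have -> : 4 * k'%:R / n%:R - 2 - (4 * k%:R / n%:R - 2) =
      4 / n%:R * (k' - k)%:R :> R by rewrite natrB//; field; rewrite gt_eqF.
  rewrite normrM ger0_norm ?divr_ge0 ?(ltW n0')// ger0_norm//.
  by rewrite ler_piMr ?divr_ge0 ?(ltW n0')// lern1 leq_subLR addn1.
by apply: enorm2_le; rewrite !mxE /=; exact: h.
Qed.

Lemma grid_point_bound n i j : (0 < n)%N -> (i <= n)%N -> (j <= n)%N ->
  `|grid_point n i j 0 0| <= 2 /\ `|grid_point n i j 0 1| <= 2.
Proof.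
move=> n0 iN jN; have n0' : 0 < n%:R :> R by rewrite ltr0n.
have h (k : nat) : (k <= n)%N -> `|4 * k%:R / n%:R - 2| <= 2 :> R.
  move=> kn; have : k%:R / n%:R <= 1 :> R by rewrite ler_pdivrMr// mul1r ler_nat.
  have : 0 <= k%:R / n%:R :> R by rewrite divr_ge0.
  by rewrite -mulrA ler_norml; lra.
by rewrite grid_point0 grid_point1; split; exact: h.
Qed.

Lemma grid_point_out n i j : (0 < n)%N -> (i == 0%N) || (i == n) \/ (j == 0%N) || (j == n) ->
  1 < enorm (grid_point n i j).
Proof.
move=> n0; have n0' : n%:R != 0 :> R by rewrite pnatr_eq0 -lt0n.
have h (k : nat) : (k == 0%N) || (k == n) -> 1 < `|4 * k%:R / n%:R - 2| :> R.
  move=> /orP[] /eqP ->; first by rewrite mulr0 mul0r sub0r normrN ger0_norm//; lra.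
  rewrite mulfK// ger0_norm; lra.
case=> /h; [rewrite -(grid_point0 _ _ j)|rewrite -(grid_point1 _ i)] => lt; apply: lt_le_trans lt _;
  exact: ler_coord_enorm.
Qed.

(** Continuing a chord of the disc beyond its endpoint [x0] and retracting radially does not
    come closer to the other endpoint [q], because the retraction is the nearest point
    projection to a convex set. *)
Lemma ret_ray (x0 q : point) (r : R) : enorm x0 <= 1 -> 0 <= r ->
  enorm (x0 - q) <= enorm (val (ret (x0 + r *: (x0 - q))) - q).
Proof.
move=> x1 r0; set D := x0 - q; set w := x0 + r *: D.
case: (leP (enorm w) 1) => w1.
  rewrite val_ret_id//; have -> : w - q = (1 + r) *: D.
    by rewrite /w /D scalerDl scale1r -addrA (addrC (r *: _)) addrA.
  rewrite enormZ ger0_norm; last by rewrite addr_ge0.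
  by rewrite ler_peMl ?enorm_ge0// lerDl.
have w0 : 0 < enorm w by apply: lt_trans w1.
rewrite val_ret /rscale (max_r (ltW w1)); set k := (enorm w)^-1.
have k0 : 0 < k by rewrite invr_gt0.
have k1 : k < 1 by rewrite invf_lt1.
have kw : k * enorm w = 1 by rewrite mulVf// gt_eqF.
pose v := k *: w - x0.
have obtuse : dot v v <= r * dot D v.
  have gen (u : point) : k * enorm u = 1 -> dot (k *: u - x0) (k *: u - x0) <= dot (u - x0) (k *: u - x0).
    move=> ku; have xu : dot x0 u <= enorm u.
      apply: le_trans (cauchy_schwarz x0 u) _.
      by rewrite ler_piMl// enorm_ge0.
    rewrite -subr_ge0 !dotE (dotC u x0) -(sqr_enormE u).
    rewrite (_ : _ - _ = (1 - k) * (k * enorm u ^+ 2 - dot x0 u)); last by ring.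
    by rewrite mulr_ge0 ?subr_ge0 ?(ltW k1)// expr2 mulrA ku mul1r.
  have rD : r *: D = w - x0 by rewrite /w addrC addKr.
  by rewrite -dotZl rD; exact: gen.
have Dv : 0 <= dot D v.
  have v0 : 0 <= dot v v by rewrite -sqr_enormE sqr_ge0.
  have rp : 0 < r.
    rewrite lt_neqAle r0 andbT eq_sym; apply/eqP => re.
    by move: w1; rewrite /w re scale0r addr0 ltNge x1.
  by rewrite -(pmulr_rge0 _ rp); apply: le_trans obtuse.
rewrite -(@ler_pXn2r _ 2)// ?nnegrE ?enorm_ge0//.
have -> : k *: w - q = v + D by rewrite /v /D addrA subrK.
clearbody v D.
rewrite !sqr_enormE !dotE (dotC v D).
have : 0 <= dot v v by rewrite -sqr_enormE sqr_ge0.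
by move: (dot v v) (dot D v) (dot D D) Dv => a b e; lra.
Qed.

(** The conclusion of [lift_edge] as a relation between an edge and a chain. *)
Definition is_lift (e d : R) (z z' : point) (l : seq point) : Prop :=
  [/\ last (plane_map M z) l = plane_map M z', steps d (plane_map M z) l,
    forall c, c \in plane_map M z :: l -> `|S'p c - Sp z| <= e,
    1 < enorm z -> 1 < enorm z' -> l = [:: z'] &
    forall c, c \in plane_map M z :: l -> enorm c <= 1 \/ c = z \/ c = z'].

Lemma lift_chain (e d : R) (w : nat -> point) n : 0 <= e ->
  (forall i, (i < n)%N -> exists l, is_lift e d (w i) (w i.+1) l) ->
  exists ks, [/\ last (plane_map M (w 0%N)) ks = plane_map M (w n),
    steps d (plane_map M (w 0%N)) ks &
    forall k, k \in plane_map M (w 0%N) :: ks -> exists2 i, (i <= n)%N & `|S'p k - Sp (w i)| <= e].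
Proof.
move=> e0; elim: n => [|n IH] h.
  exists [::]; split => // k; rewrite inE => /eqP ->; exists 0%N => //.
  by rewrite /S'p (plane_mapE M2 M3) subrr normr0.
have [i iN|ks [kl ksd kc]] := IH; first by apply: h; exact: ltnW.
have [l [ll ls lc _ _]] := h n (ltnSn n).
exists (ks ++ l); split.
- by rewrite last_cat kl.
- by rewrite /steps cat_path kl; apply/andP.
- move=> k; rewrite -cat_cons mem_cat => /orP[/kc[i iN hi]|kl'].
    by exists i => //; exact: leqW.
  by exists n; [exact: leqnSn|apply: lc; rewrite inE kl' orbT].
Qed.

(** A point [x0] of the disc cannot be surrounded by the image of a small cell that is away from
    it: the chord from the cell to [x0], continued to infinity, is mapped to a curve that leads
    from [M x0] out of the disc and avoids the image of the cell. *)
Lemma cell_away (x0 : disc R) (r0 : R) : 0 < r0 -> exists e1 d1 h1 : R,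
  [/\ 0 < e1, 0 < d1, 0 < h1 &
  forall (e d : R) (Z : nat -> nat -> point) H V i j, 0 < d <= d1 -> e <= e1 ->
    (forall i j, is_lift e d (Z i j) (Z i.+1 j) (H i j)) ->
    (forall i j, is_lift e d (Z i j) (Z i j.+1) (V i j)) ->
    (forall k l, (k <= 1)%N -> (l <= 1)%N ->
       enorm (Z (i + k)%N (j + l)%N) <= 4 /\ enorm (Z (i + k)%N (j + l)%N - Z i j) <= h1) ->
    r0 <= enorm (val x0 - val (ret (Z i j))) ->
    cell_wind (val (M x0)) (fun i j => plane_map M (Z i j)) H V i j = 0].
Proof.
move=> r00; pose sg := c * r0 / 3.
have sg0 : 0 < sg by rewrite divr_gt0// mulr_gt0.
have sg2 : 0 < sg / 2 by rewrite divr_gt0.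
have e10 : 0 < sg / 8 by rewrite divr_gt0.
have [dh dh0 near] := heine (@compact_ball R 4) S'p_continuous sg2.
exists (sg / 8), (dh / 5), (sg / (8 * C)); split=> //.
- by rewrite divr_gt0.
- by rewrite divr_gt0// mulr_gt0.
move=> e d Z H V i j /andP[d0 dd] ee lH lV small away.
set q := val (ret (Z i j)) in away.
have [e0 e00 LE] := lift_edge C0 sC M1 M2 M3 e10 d0.
have q1 : enorm q <= 1 := enorm_disc _.
have x1 : enorm (val x0) <= 1 := enorm_disc _.
pose D : point := val x0 - q.
have D2 : enorm D <= 2.
  by apply: le_trans (ler_enormB _ _) _; move: q1 x1; move: (enorm q) (enorm (val x0)) => a b; lra.
(* the ray of total length at least 12 is divided into [L] steps *)
pose L := (Num.bound (24 / (r0 * e0))).+1.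
have L0 : 0 < L%:R :> R by rewrite ltr0n.
have LL : 24 / (r0 * e0) <= L%:R.
  apply: ltW; apply: lt_le_trans (archi_boundP _) _; last by rewrite ler_nat.
  by rewrite divr_ge0// mulr_ge0// ltW.
pose ka := 12 / (r0 * L%:R).
have ka0 : 0 < ka by rewrite divr_gt0// mulr_gt0.
have kae : 2 * ka <= e0.
  move: LL; rewrite ler_pdivrMr; last by rewrite mulr_gt0.
  move=> h; rewrite /ka mulrA ler_pdivrMr; last by rewrite mulr_gt0.
  by move: (L%:R) h => a h; lra.
pose w (l : nat) : point := val x0 + (l%:R * ka) *: D.
have chain l : (l < L)%N -> exists ks, is_lift (sg / 8) d (w l) (w l.+1) ks.
  move=> _; apply: LE; have -> : w l - w l.+1 = - ka *: D.
    by rewrite /w -(natr1 l); clearbody D; apply/rowP => k; rewrite !mxE; ring.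
  rewrite enormZ normrN (gtr0_norm ka0); apply: le_trans kae.
  by rewrite mulrC ler_wpM2r// ltW.
have [ks [kl ksd kc]] := lift_chain (ltW e10) chain.
have w0 : w 0%N = val x0 by rewrite /w mul0r scale0r addr0.
have pw0 : plane_map M (w 0%N) = val (M x0) by rewrite w0 /plane_map x1 retK.
(* at this distance the cell, which has norm at most 4, is seen within a half plane *)
have wL : 11 <= enorm (w L).
  have := ler_enormB (w L) (val x0).
  have -> : w L - val x0 = (12 / r0) *: D.
    rewrite /w addrC addKr; congr (_ *: _); rewrite /ka; field.
    by rewrite !gt_eqF.
  rewrite enormZ ger0_norm ?divr_ge0// ?(ltW r00)// => h.
  have : 12 <= 12 / r0 * enorm D by rewrite mulrAC ler_pdivlMr// ler_pM2l.
  by move: (enorm (w L)) (enorm D) h x1 => a b; move: (enorm (val x0)) => a'; move: (12 / r0 * b) => b'; lra.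
have pwL : plane_map M (w L) = w L by rewrite plane_map_out//; apply: lt_le_trans wL; rewrite ltr1n.
rewrite pw0 pwL in kl ksd kc.
have [k wk] : exists k : 'I_2, 5 < `|w L 0 k|.
  case: (leP `|w L 0 0| 5) => h0; last by exists 0.
  case: (leP `|w L 0 1| 5) => h1; last by exists 1.
  by have := le_trans wL (enorm2_le h0 h1); rewrite -natrM ler_nat.
pose side := (k == 0, w L 0 k < 0).
have sep l : sg <= `|Sp (w l) - Sp (Z i j)|.
  have h := ret_ray q x1 (mulr_ge0 (ler0n R l) (ltW ka0)).
  have h2 := le_trans (ler_wpM2l (ltW c0) (le_trans away h)) (sc (ret (w l)) (ret (Z i j))).
  by rewrite /sg ler_pdivrMr//; apply: le_trans h2 _; rewrite mulrC; exact: enorm_le_norm.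
have edge z z' l : is_lift e d z z' l -> enorm z <= 4 -> enorm z' <= 4 ->
    enorm (z - Z i j) <= sg / (8 * C) ->
  [/\ steps d (plane_map M z) l, forall k', k' \in val (M x0) :: ks -> far d (plane_map M z) l k' &
    forall c, c \in plane_map M z :: l -> in_half side (quadrant (c - last (val (M x0)) ks))].
  move=> [_ ls lc _ lin] z4 z'4 zz; have c4 c' : c' \in plane_map M z :: l -> enorm c' <= 4.
    by move=> /lin[h|[->|->]] //; apply: le_trans h _; rewrite ler1n.
  split=> // [k' /kc[m _ km] c' cl|c' cl].
    rewrite ltNge; apply/negP => close.
    have h : `|c' - k'| < dh.
      apply: le_lt_trans close _; rewrite mulrC -ltr_pdivlMr//; apply: le_lt_trans dd _.
      by rewrite ltr_pM2l// ltf_pV2 ?posrE// ltr_nat.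
    have h1 := near _ _ (c4 _ cl) h; have h2 := le_trans (lc _ cl) ee.
    have h3 : `|Sp z - Sp (Z i j)| <= sg / 4.
      apply: le_trans (Sp_lip _ _) _; apply: le_trans (ler_wpM2l (ltW (mulr_gt0 (ltr0Sn R 1) C0)) zz) _.
      by rewrite (_ : 2 * C * (sg / (8 * C)) = sg / 4)//; field; rewrite gt_eqF.
    have tri : `|Sp (w m) - Sp (Z i j)| <= `|S'p k' - Sp (w m)| + `|S'p c' - S'p k'| +
        `|S'p c' - Sp z| + `|Sp z - Sp (Z i j)|.
      move: (Sp (w m)) (S'p k') (S'p c') (Sp z) (Sp (Z i j)) => a1 a2 a3 a4 a5.
      apply: le_trans (ler_distD a4 _ _) _; rewrite lerD2r.
      apply: le_trans (ler_distD a3 _ _) _; rewrite lerD2r.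
      by apply: le_trans (ler_distD a2 _ _) _; rewrite (distrC a1) (distrC a3).
    move: (le_trans (sep m) tri); move: km h1 h2 h3 sg0.
    move: `|S'p k' - _| `|S'p c' - S'p k'| `|S'p c' - _| `|Sp z - _| (sg) => b1 b2 b3 b4 b5.
    exact: chain_gap.
  rewrite kl /in_half /side /=; have ck := le_trans (ler_coord_enorm c' k) (c4 _ cl).
  have E : (0 <= c' 0 k - w L 0 k) = (w L 0 k < 0).
    by rewrite subr_ge0; apply: sign_far => //; rewrite -ler_norml.
  rewrite -E; have ok : k = 0 \/ k = 1.
    by case: k {wk side ck E} => -[|[|//]] k2; [left|right]; exact: val_inj.
  by case: ok => ->; rewrite /quadrant /= !mxE eqxx.
have s4 k l k1 l1 := (small k l k1 l1).1; have sh k l k1 l1 := (small k l k1 l1).2.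
have e01 := s4 0%N 1%N isT isT; have e10' := s4 1%N 0%N isT isT.
have e11 := s4 1%N 1%N isT isT; have e00' := s4 0%N 0%N isT isT.
have h01 := sh 0%N 1%N isT isT; have h10 := sh 1%N 0%N isT isT; have h00 := sh 0%N 0%N isT isT.
rewrite !addn0 !addn1 in e01 e10' e11 e00' h01 h10 h00.
apply: (@cell_wind_eq0 _ d _ ks side) => //.
- exact: ltW.
- by split=> a b; [case: (lH a b)|case: (lV a b)].
- exact: (edge _ _ _ (lH i j)).
- exact: (edge _ _ _ (lV i.+1 j)).
- exact: (edge _ _ _ (lH i j.+1)).
- exact: (edge _ _ _ (lV i j)).
Qed.

End cells.

(** * Intermediate distances occur on every path *)

Section crossing.
Context {R : realType}.
Local Notation point := 'rV[R]_2.

Variables (s s' : disc R -> 'rV[R]_3) (M : disc R -> disc R) (C c : R).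
Hypotheses (C0 : 0 < C) (c0 : 0 < c).
Hypothesis cs' : continuous s'.
Hypothesis sC : forall p q, (length_dist s p q <= (C * enorm (val p - val q))%:E)%E.
Hypothesis sc : forall p q, c * enorm (val p - val q) <= enorm (s p - s q).
Hypothesis M1 : forall p q, (length_dist s' (M p) (M q) <= length_dist s p q)%E.
Hypothesis M2 : forall p, s' (M p) = s p.
Hypothesis M3 : forall p, enorm (val p) = 1 -> M p = p.

Local Notation ld x p := (fine (length_dist s x p)).
Local Notation Sp v := (s (ret v)).
Local Notation S'p v := (s' (ret v)).

(** Otherwise consider the cells of a fine grid that are at distance less than [t] from [x]: the
    images of the edges on their frontier avoid the path [a], so that the total winding of the
    images of these cells around [M x] and around [M y] agree. Around [M x] it is that of the
    boundary of the grid, as the remaining cells are away from [x]; around [M y] it vanishes, as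
    these cells are away from [y]. *)
Lemma crossing x y a (t : R) : disc_path (M x) (M y) a -> 0 < t < ld x y ->
  exists p r, [/\ 0 <= r <= 1, s p = s' (a r) & ld x p = t].
Proof.
move=> pa /andP[t0 ty]; apply: contrapT => nohit.
have [et et0 mg] : exists2 e : R, 0 < e & forall v r, 0 <= r <= 1 -> `|ld x (ret v) - t| <= e ->
    e < `|Sp v - s' (a r)|.
  by apply: (margin C0 cs' sC pa) => p r r01 e1 e2; apply: nohit; exists p, r.
have rx : 0 < t / C by rewrite divr_gt0.
have ry : 0 < (ld x y - t) / C by rewrite divr_gt0// subr_gt0.
have [e1 [d1 [h1 [e10 d10 h10 cellx]]]] := cell_away C0 c0 cs' sC sc M1 M2 M3 x rx.
have [e2 [d2 [h2 [e20 d20 h20 celly]]]] := cell_away C0 c0 cs' sC sc M1 M2 M3 y ry.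
have et2 : 0 < et / 2 by rewrite divr_gt0.
have [dh dh0 near] := heine (@compact_ball R 4) (S'p_continuous cs') et2.
pose e := Num.min (et / 4) (Num.min e1 e2).
pose d := Num.min (Num.min (dh / 5) 8^-1) (Num.min d1 d2).
have e0 : 0 < e by rewrite !lt_min divr_gt0//= e10.
have d0 : 0 < d by rewrite !lt_min divr_gt0//= d10 d20 invr_gt0 ltr0n.
have [ee ee1 ee2] : [/\ e <= et / 4, e <= e1 & e <= e2].
  by split; rewrite /e !ge_min lexx ?orbT.
have [ddh dd8 dd1 dd2] : [/\ d <= dh / 5, d <= 8^-1, d <= d1 & d <= d2].
  by split; rewrite /d !ge_min lexx ?orbT.
clearbody e d.
have [l0 l00 LE] := lift_edge C0 sC M1 M2 M3 e0 d0.
pose h := Num.min (Num.min l0 (et / (2 * C))) (Num.min h1 h2).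
have h0 : 0 < h by rewrite !lt_min l00 h10 h20 divr_gt0// mulr_gt0.
have [hl het hh1 hh2] : [/\ h <= l0, h <= et / (2 * C), h <= h1 & h <= h2].
  by split; rewrite /h !ge_min lexx ?orbT.
clearbody h.
pose n := (Num.bound (8 / h)).+1.
have n0 : (0 < n)%N by [].
have nh : 8 / n%:R <= h.
  rewrite ler_pdivrMr ?ltr0n// mulrC -ler_pdivrMr//.
  apply: ltW; apply: lt_le_trans (archi_boundP _) _; last by rewrite ler_nat.
  by rewrite divr_ge0// ltW.
clearbody n.
pose Z : nat -> nat -> point := grid_point n.
have step i j k l : (k <= 1)%N -> (l <= 1)%N -> enorm (Z (i + k)%N (j + l)%N - Z i j) <= h.
  by move=> k1 l1; apply: grid_point_step => //; rewrite leq_addr -addn1 leq_add2l.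
have bound i j : (i <= n)%N -> (j <= n)%N -> enorm (Z i j) <= 4.
  move=> iN jN; have [b0 b1] := @grid_point_bound R n i j n0 iN jN.
  by rewrite (natrM R 2 2); exact: enorm2_le.
have exH i j : exists l, is_lift s s' M e d (Z i j) (Z i.+1 j) l.
  apply: LE; rewrite enorm_distC; apply: le_trans hl.
  by have := step i j 1%N 0%N isT isT; rewrite addn0 addn1.
have exV i j : exists l, is_lift s s' M e d (Z i j) (Z i j.+1) l.
  apply: LE; rewrite enorm_distC; apply: le_trans hl.
  by have := step i j 0%N 1%N isT isT; rewrite addn0 addn1.
pose H i j := projT1 (cid (exH i j)); pose V i j := projT1 (cid (exV i j)).
have lH i j : is_lift s s' M e d (Z i j) (Z i.+1 j) (H i j) := projT2 (cid (exH i j)).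
have lV i j : is_lift s s' M e d (Z i j) (Z i j.+1) (V i j) := projT2 (cid (exV i j)).
clearbody H V.
have [ks [kl ksd kc]] := sample_path pa d0.
pose m i j := plane_map M (Z i j).
have mHV : lattice m H V.
  by split=> i j; [case: (lH i j)|case: (lV i j)].
pose I i j := ld x (ret (Z i j)) < t.
have nn0 : n%:R != 0 :> R by rewrite pnatr_eq0 -lt0n.
have lo1 i : Z i 0%N 0 1 = -2 by rewrite /Z grid_point1 mulr0 mul0r sub0r.
have hi1 i : Z i n 0 1 = 2 by rewrite /Z grid_point1 mulfK//; ring.
have lo0 i : Z 0%N i 0 0 = -2 by rewrite /Z grid_point0 mulr0 mul0r sub0r.
have hi0 i : Z n i 0 0 = 2 by rewrite /Z grid_point0 mulfK//; ring.
have out i j : (i == 0%N) || (i == n) \/ (j == 0%N) || (j == n) -> 1 < enorm (Z i j).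
  exact: grid_point_out.
have E : \sum_(0 <= i < n) \sum_(0 <= j < n) cell_wind (val (M x)) m H V i j = 4.
  apply: total_wind => //.
  - move=> i iN; split.
    + by case: (lH i 0%N) => _ _ _ -> //; rewrite ?/m ?plane_map_out //; apply: grid_point_out => //; right.
    + by case: (lH i n) => _ _ _ -> //; rewrite ?/m ?plane_map_out //; apply: grid_point_out => //; right; rewrite eqxx orbT.
    + by case: (lV 0%N i) => _ _ _ -> //; rewrite ?/m ?plane_map_out //; apply: grid_point_out => //; left.
    + by case: (lV n i) => _ _ _ -> //; rewrite ?/m ?plane_map_out //; apply: grid_point_out => //; left; rewrite eqxx orbT.
  - move=> i iN; rewrite /m !plane_map_out; first last.
    + by apply: out; right.
    + by apply: out; right; rewrite eqxx orbT.
    + by apply: out; left.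
    + by apply: out; left; rewrite eqxx orbT.
    have c0' := le_trans (ler_coord_enorm (val (M x)) 0) (enorm_disc (M x)).
    have c1 := le_trans (ler_coord_enorm (val (M x)) 1) (enorm_disc (M x)).
    by split; rewrite mxE ?lo1 ?hi1 ?lo0 ?hi0 mxE ?(coordinate_in_frame c0').1 ?(coordinate_in_frame c0').2
      ?(coordinate_in_frame c1).1 ?(coordinate_in_frame c1).2.
suff : \sum_(0 <= i < n) \sum_(0 <= j < n) cell_wind (val (M x)) m H V i j = 0 by rewrite E.
have K1 k : k \in val (M x) :: ks -> enorm k <= 1.
  by move=> /kc[r _ ->]; exact: enorm_disc.
have frontier z z' l : is_lift s s' M e d z z' l -> enorm z <= 4 -> enorm z' <= 4 ->
    `|ld x (ret z) - t| <= et -> forall k, k \in val (M x) :: ks -> far d (plane_map M z) l k.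
  move=> [_ _ lc _ lin] z4 z'4 zt k /kc[r r01 ->] c' cl.
  rewrite ltNge; apply/negP => close.
  have c'4 : enorm c' <= 4.
    by case: (lin _ cl) => [h'|[->|->]] //; apply: le_trans h' _; rewrite ler1n.
  have hd : `|c' - val (a r)| < dh.
    apply: le_lt_trans close _; rewrite mulrC -ltr_pdivlMr//; apply: le_lt_trans ddh _.
    by rewrite ltr_pM2l// ltf_pV2 ?posrE// ltr_nat.
  have := near _ _ c'4 hd; have := mg z r r01 zt; have := le_trans (lc _ cl) ee.
  rewrite retK => g1 g2 g3; have := ler_distD (S'p c') (Sp z) (s' (a r)).
  rewrite (distrC (Sp z) (S'p c')) => g4; move: g2 => /lt_le_trans/(_ g4).
  exact: (margin_split et0 g1 g3).
have outer z z' l k0 : is_lift s s' M e d z z' l -> 1 < enorm z -> 1 < enorm z' ->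
    2 <= `|z 0 k0| -> 2 <= `|z' 0 k0| ->
    forall k, k \in val (M x) :: ks -> far d (plane_map M z) l k.
  move=> [_ _ _ lo _] z1 z'1 z2 z'2 k kK c'; rewrite (lo z1 z'1) plane_map_out// => cl.
  have c2 : 2 <= `|c' 0 k0| by move: cl; rewrite !inE => /orP[] /eqP ->.
  have k1 := le_trans (ler_coord_enorm k k0) (K1 _ kK).
  have := ler_coord_norm (c' - k) k0; rewrite !mxE => h'; apply: lt_le_trans h'.
  have := ler_normD (c' 0 k0 - k 0 k0) (k 0 k0); rewrite subrK.
  exact: outer_gap.
have close z z' : enorm (z - z') <= h -> (ld x (ret z) < t) != (ld x (ret z') < t) ->
    `|ld x (ret z) - t| <= et.
  move=> zz sides; apply: le_trans (abs_between sides) _.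
  apply: le_trans (Ux_lip C0 sC x z z') _; rewrite mulrC -ler_pdivlMr ?mulr_gt0//.
  exact: le_trans zz het.
apply: (@grid_winding R d n I m H V (val (M x)) ks) => //.
- exact: ltW.
- by move=> i j _ _; split; [case: (lH i j)|case: (lV i j)].
- move=> i j iN jN; have [j0|j0] := boolP ((j == 0%N) || (j == n)).
    move=> _; apply: (outer _ _ _ 1 (lH i j)).
    + by apply: out; right.
    + by apply: out; right.
    + by case/orP: j0 => /eqP ->; rewrite ?lo1 ?hi1 ?normrN ger0_norm.
    + by case/orP: j0 => /eqP ->; rewrite ?lo1 ?hi1 ?normrN ger0_norm.
  move: j0; rewrite negb_or => /andP[/negbTE j0 /negbTE ->]; rewrite j0 /= => Ij.
  apply: (frontier _ _ _ (lH i j)); [by apply: bound => //; exact: ltnW|exact: bound|].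
  case: j j0 jN Ij => // j _ jN Ij; apply: close Ij.
  by have := step i j 0%N 1%N isT isT; rewrite addn0 addn1.
- move=> i j iN jN; have [i0|i0] := boolP ((i == 0%N) || (i == n)).
    move=> _; apply: (outer _ _ _ 0 (lV i j)).
    + by apply: out; left.
    + by apply: out; left.
    + by case/orP: i0 => /eqP ->; rewrite ?lo0 ?hi0 ?normrN ger0_norm.
    + by case/orP: i0 => /eqP ->; rewrite ?lo0 ?hi0 ?normrN ger0_norm.
  move: i0; rewrite negb_or => /andP[/negbTE i0 /negbTE ->]; rewrite i0 /= => Ij.
  apply: (frontier _ _ _ (lV i j)); [by apply: bound => //; exact: ltnW|exact: bound|].
  case: i i0 iN Ij => // i _ iN Ij; apply: close Ij.
  by have := step i j 1%N 0%N isT isT; rewrite addn0 addn1.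
- move=> i j iN jN; rewrite /I -leNgt => far_x.
  apply: (cellx e d Z H V i j _ ee1 lH lV); first by rewrite d0.
    move=> k l k1 l1; split; last exact: le_trans (step _ _ _ _ k1 l1) hh1.
    by apply: bound; [apply: leq_trans (leq_add (leqnn i) k1) _|
      apply: leq_trans (leq_add (leqnn j) l1) _]; rewrite addn1.
  rewrite ler_pdivrMr// mulrC; apply: le_trans far_x _.
  have := ld_lip sC x (ret (Z i j)) x; rewrite length_distxx /= subr0.
  by rewrite enorm_distC; exact/le_trans/ler_norm.
- move=> i j iN jN; rewrite /I => near_x; rewrite kl.
  apply: (celly e d Z H V i j _ ee2 lH lV); first by rewrite d0.
    move=> k l k1 l1; split; last exact: le_trans (step _ _ _ _ k1 l1) hh2.
    by apply: bound; [apply: leq_trans (leq_add (leqnn i) k1) _|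
      apply: leq_trans (leq_add (leqnn j) l1) _]; rewrite addn1.
  rewrite ler_pdivrMr// mulrC; apply: le_trans (ld_lip sC x y (ret (Z i j))).
  by apply: le_trans (ler_norm _); rewrite lerD2l lerN2 ltW.
Qed.
End crossing.

(** * No shortcuts *)

Section shortcut.
Context {R : realType}.

(** Take many equally spaced values of [t] and order them by the parameters [r] at which they
    occur. Successive parameters are mostly closer than [e], and then the spacing bounds the
    corresponding chord of [g] from below; the number of the remaining ones is bounded. *)
Lemma length_of_hits n (g : R -> 'rV[R]_n) (P : R -> R -> Prop) (d l K e : R) :
  0 < d -> 0 <= K -> 0 < e -> (curve_length Defs.edist 0 1 g <= l%:E)%E ->
  (forall t, 0 < t < d -> exists2 r, 0 <= r <= 1 & P t r) ->
  (forall t t' r r', P t r -> P t' r' -> `|r - r'| < e -> `|t - t'| <= K * enorm (g r - g r')) ->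
  d <= K * l.
Proof.
move=> d0 K0 e0 gl hit close; rewrite leNgt; apply/negP => lt.
pose eta := d - K * l; have eta0 : 0 < eta by rewrite subr_gt0.
pose m := Num.bound ((2 * d + d / e) / eta).
have mB : (2 * d + d / e) < eta * m%:R.
  rewrite (mulrC eta) -ltr_pdivrMr//; apply: archi_boundP.
  rewrite divr_ge0 ?(ltW eta0)//; apply: addr_ge0; first exact: (mulr_ge0 (ler0n R 2) (ltW d0)).
  exact: (divr_ge0 (ltW d0) (ltW e0)).
pose h := d / m.+2%:R.
have h0 : 0 < h by rewrite divr_gt0.
have hd : h * m.+2%:R = d by rewrite /h mulfVK// gt_eqF.
clearbody h.
have ex (j : nat) : exists r, (j <= m)%N -> 0 <= r <= 1 /\ P (j.+1%:R * h) r.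
  have [jm|_] := leqP j m; last by exists 0.
  have [|r r01 Pr] := hit (j.+1%:R * h); last by exists r.
  by rewrite mulr_gt0//= -[ltRHS]hd mulrC ltr_pM2l// ltr_nat.
pose rr j := projT1 (cid (ex j)).
have rrP j : (j <= m)%N -> 0 <= rr j <= 1 /\ P (j.+1%:R * h) (rr j) := projT2 (cid (ex j)).
clearbody rr.
pose q := sort (relpre rr <=%O) (iota 0 m.+1).
have qs : size q = m.+1 by rewrite size_sort size_iota.
have qu : uniq q by rewrite sort_uniq iota_uniq.
have qm j : (j <= m)%N -> (nth 0%N q j <= m)%N.
  by move=> jm; have : nth 0%N q j \in q by [rewrite mem_nth// qs]; rewrite mem_sort mem_iota.
have qsort i j : (i <= j)%N -> (j <= m)%N -> rr (nth 0%N q i) <= rr (nth 0%N q j).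
  move=> ij jm; have tot : total (relpre rr <=%O) by move=> a b; exact: le_total.
  apply: (@sorted_leq_nth _ (relpre rr <=%O)) => //=.
  - by move=> a b c; exact: le_trans.
  - by move=> a; exact: lexx.
  - exact: sort_sorted.
  - by rewrite inE qs ltnS (leq_trans ij).
  - by rewrite inE qs ltnS.
pose tau i := rr (nth 0%N q (minn i m)).
have tauE i : (i <= m)%N -> tau i = rr (nth 0%N q i) by move=> im; rewrite /tau (minn_idPl im).
have tau_homo : {homo tau : i j / (i <= j)%N >-> i <= j}.
  by move=> i j ij; apply: qsort; [rewrite leq_min geq_minr andbT geq_min ij|exact: geq_minr].
have t01 i : 0 <= tau i <= 1.
  by rewrite /tau; case: (rrP (nth 0%N q (minn i m))) => //; apply: qm; exact: geq_minr.
have tot := sum_le_curve_length g (N := m) tau_homo (andP (t01 0%N)).1 (andP (t01 m)).2.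
have {tot} : \sum_(i < m) enorm (g (tau i) - g (tau i.+1)) <= l.
  by rewrite -lee_fin; apply: le_trans gl.
set S := \sum_(i < m) _ => Sl.
(* the second term takes over when the two parameters are not close; its sum is bounded *)
have : \sum_(i < m) h <= \sum_(i < m) (K * enorm (g (tau i) - g (tau i.+1)) + h / e * (tau i.+1 - tau i)).
  apply: ler_sum => i _; have iN := ltn_ord i.
  have i1 : (i <= m)%N := ltnW iN.
  have [far|near] := leP e (tau i.+1 - tau i).
    apply: (@le_trans _ _ (h / e * (tau i.+1 - tau i))).
      by rewrite mulrAC ler_pdivlMr// ler_pM2l.
    by rewrite lerDr mulr_ge0 ?enorm_ge0.
  apply: (@le_trans _ _ (K * enorm (g (tau i) - g (tau i.+1)))); last first.
    by rewrite lerDl mulr_ge0 ?(divr_ge0 (ltW h0) (ltW e0))// subr_ge0 tau_homo.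
  have [_ P1] := rrP _ (qm _ i1); have [_ P2] := rrP _ (qm _ iN).
  rewrite !tauE// in near *.
  apply: le_trans (close _ _ _ _ P1 P2 _); last first.
    by rewrite distrC ger0_norm// subr_ge0 qsort.
  rewrite -mulrBl normrM (gtr0_norm h0) ler_peMl ?(ltW h0)//.
  have : nth 0%N q i != nth 0%N q i.+1 by rewrite nth_uniq ?qs ?ltnS// neq_ltn leqnn.
  move: (nth _ q i) (nth _ q i.+1) => a b.
  rewrite neq_ltn => /orP[] ab.
    rewrite distrC -natrB ?ltnS ?(ltnW ab)// normr_nat ler1n subSS subn_gt0 //.
  by rewrite -natrB ?ltnS ?(ltnW ab)// normr_nat ler1n subSS subn_gt0.
rewrite big_split /= -!mulr_sumr sumr_const card_ord -[in X in _ <= _ + _ * X](big_mkord xpredT (fun i => tau i.+1 - tau i)).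
rewrite telescope_sumr// -/S -mulr_natr.
have tt : tau m - tau 0%N <= 1.
  have /andP[_ tm] := t01 m; have /andP[t0 _] := t01 0%N.
  by rewrite lerBlDr (le_trans tm)// lerDl.
move=> H.
have : h * m%:R <= K * l + h / e.
  apply: le_trans H _; apply: lerD; first by rewrite ler_wpM2l.
  by rewrite ler_piMr// divr_ge0// ltW.
rewrite -(ler_pM2r (ltr0Sn R m.+1)) mulrDl mulrAC hd.
have -> : h / e * m.+2%:R = d / e by rewrite mulrAC hd.
rewrite -(addn2 m) natrD => H2; move: mB; apply/negP; rewrite -leNgt /eta.
by move: H2 lt; move: (d / e) (K * l) (m%:R); clear => a b c; lra.
Qed.

Variables (s s' : disc R -> 'rV[R]_3) (C c : R).
Hypotheses (C0 : 0 < C) (c0 : 0 < c).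
Hypothesis cs' : continuous s'.
Hypothesis sC : forall p q, (length_dist s p q <= (C * enorm (val p - val q))%:E)%E.
Hypothesis sc : forall p q, c * enorm (val p - val q) <= enorm (s p - s q).
Hypothesis sloc : forall e : R, 0 < e -> exists2 d : R, 0 < d & forall p q,
  enorm (val p - val q) < d -> (length_dist s p q <= ((1 + e) * enorm (s p - s q))%:E)%E.

(** By [crossing] every distance less than that of [x] and [y] occurs along the path, and locally
    differences of distances are at most the chords of the image curve, up to a factor [1 + e]. *)
Lemma no_shortcut_fixed (M : disc R -> disc R) (x y : disc R) :
  (forall p q, (length_dist s' (M p) (M q) <= length_dist s p q)%E) ->
  (forall p, s' (M p) = s p) -> (forall p, enorm (val p) = 1 -> M p = p) ->
  (length_dist s x y <= length_dist s' (M x) (M y))%E.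
Proof.
move=> M1 M2 M3; apply: le_ereal_inf_tmp => _ [a pa <-].
have L0 : (0 <= curve_length Defs.edist 0 1 (s' \o a))%E.
  by apply: curve_length_ge0 => //; exact: Defs.edist_ge0.
rewrite leNgt; apply/negP; rewrite (ldE sC) => short.
have Lfin : curve_length Defs.edist 0 1 (s' \o a) \is a fin_num.
  by rewrite ge0_fin_numE//; apply: lt_trans short _; rewrite ltry.
move: short L0 (lexx (curve_length Defs.edist 0 1 (s' \o a))).
rewrite -{1 2 4}(fineK Lfin); set l := fine (curve_length _ _ _ _); set d := fine _.
rewrite lte_fin lee_fin => ld l0 gl.
have d0 : 0 < d := le_lt_trans l0 ld.
pose e := (d - l) / (2 * d).
have e0 : 0 < e by rewrite divr_gt0 ?subr_gt0// mulr_gt0.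
have [dl dl0 loc] := sloc e0.
have ca0 := continuous_path_clamp pa.
have ca : continuous (s' \o (a \o clamp)).
  by move=> r; apply: continuous_comp; [exact: ca0|exact: cs'].
have cd3 : 0 < c * dl / 3 by rewrite divr_gt0// mulr_gt0.
have [h h0 near] := heine compact_unit_segment ca cd3.
pose P t r := 0 <= r <= 1 /\ exists2 p, s p = s' (a r) & fine (length_dist s x p) = t.
have : d <= (1 + e) * l.
  apply: (@length_of_hits _ (s' \o a) P d l (1 + e) h) => //.
  - by rewrite addr_ge0// ltW.
  - move=> t td; have [p [r [r01 pr pt]]] := crossing C0 c0 cs' sC sc M1 M2 M3 pa td.
    by exists r => //; split=> //; exists p.
  - move=> t t' r r' [r01 [p pr <-]] [r'01 [p' pr' <-]] rr.
    have pp : enorm (val p - val p') < dl.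
      rewrite -(ltr_pM2l c0); apply: le_lt_trans (sc _ _) _.
      apply: le_lt_trans (enorm_le_norm _) _; rewrite mulrC -ltr_pdivlMr//.
      have := near r r'; rewrite /= in_itv/= r01 => /(_ isT rr).
      by rewrite !clamp_id// -pr -pr'.
    rewrite /= -pr -pr'; have := loc _ _ pp; rewrite (ldE sC) lee_fin; apply: le_trans.
    have tri u v : fine (length_dist s x u) - fine (length_dist s x v) <= fine (length_dist s v u).
      rewrite lerBlDl -lee_fin EFinD -!(ldE sC); exact: length_dist_triangle.
    by rewrite ler_norml lerNl opprB tri (length_distC s p p') tri.
apply/negP; rewrite -ltNge.
have eE : e * (2 * d) = d - l by rewrite /e mulfVK// gt_eqF// mulr_gt0.
have el : e * l < e * d by rewrite ltr_pM2l.
have ed : 0 < e * d by rewrite mulr_gt0.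
by move: eE el ed; clearbody e d l; lra.
Qed.

(** A majorization fixes the points of the circle only up to pseudodistance 0; redefining [M]
    there changes no distance. *)
Lemma no_shortcut (M : disc R -> disc R) (x y : disc R) :
  (forall p q, (length_dist s' (M p) (M q) <= length_dist s p q)%E) ->
  (forall p, s' (M p) = s p) -> (forall p, enorm (val p) = 1 -> length_dist s' (M p) p = 0%E) ->
  (length_dist s x y <= length_dist s' (M x) (M y))%E.
Proof.
move=> M1 M2 M3; pose N p := if enorm (val p) == 1 then p else M p.
have NM p : length_dist s' (N p) (M p) = 0%E.
  by rewrite /N; case: eqP => [/M3|_]; [rewrite length_distC|rewrite length_distxx].
have dN p q : (length_dist s' (N p) (N q) <= length_dist s' (M p) (M q))%E.
  apply: le_trans (length_dist_triangle s' (M p) _ _) _; rewrite NM add0e.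
  apply: le_trans (length_dist_triangle s' (M q) _ _) _.
  by rewrite (length_distC s' (M q)) NM adde0.
have N2 p : s' (N p) = s p.
  rewrite -M2; apply/eqP; rewrite -subr_eq0 -enorm_eq0 eq_le enorm_ge0 andbT.
  by have := dist_le_length_dist s' (N p) (M p); rewrite NM lee_fin.
have N3 p : enorm (val p) = 1 -> N p = p by move=> p1; rewrite /N p1 eqxx.
apply: le_trans (dN x y).
exact: no_shortcut_fixed (fun p q => le_trans (dN p q) (M1 p q)) N2 N3.
Qed.

End shortcut.

(** * Small round discs of a surface *)

Section patch.
Context {R : realType}.
Local Notation point := 'rV[R]_2.
Implicit Types (v z d : point).

Lemma cross_combr (X T : 'rV[R]_3) (a b : R) : cross X (a *: X + b *: T) = b *: cross X T.
Proof. by apply: rV3P; rewrite !mxE /=; ring. Qed.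

Lemma cross_combl (X T : 'rV[R]_3) (a b : R) : cross (a *: X + b *: T) T = a *: cross X T.
Proof. by apply: rV3P; rewrite !mxE /=; ring. Qed.

Definition taxi v : R := `|v 0 0| + `|v 0 1|.

Lemma taxi_ge0 v : 0 <= taxi v.
Proof. by rewrite addr_ge0. Qed.

Lemma taxi_le_enorm v : taxi v <= 2 * enorm v.
Proof.
by have := ler_coord_enorm v 0; have := ler_coord_enorm v 1; rewrite /taxi; lra.
Qed.

Lemma enorm_le_taxi v : enorm v <= taxi v.
Proof.
have h : enorm v ^+ 2 = v 0 0 ^+ 2 + v 0 1 ^+ 2.
  rewrite sqr_enorm !big_ord_recl big_ord0 addr0.
  by congr (v _ _ ^+ 2 + v _ _ ^+ 2); exact: val_inj.
rewrite -(@ler_pXn2r _ 2)// ?nnegrE ?enorm_ge0 ?taxi_ge0// h /taxi sqrrD.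
rewrite -[v 0 0 ^+ 2]real_normK ?num_real// -[v 0 1 ^+ 2]real_normK ?num_real//.
have : 0 <= `|v 0 0| * `|v 0 1| by rewrite mulr_ge0.
lra.
Qed.

Definition disc_map (F : R -> R -> 'rV[R]_3) (rho : R) (p : disc R) : 'rV[R]_3 :=
  F (rho * val p 0 0) (rho * val p 0 1).

Variables (F Fx Ft Fxx Fxt Ftt : R -> R -> 'rV[R]_3) (rho0 C c : R).
Hypothesis j : jet2 F Fx Ft Fxx Fxt Ftt rho0 C.
Hypotheses (C1 : 1 <= C) (c0 : 0 < c) (r4 : rho0 <= 4^-1).
Hypothesis gram : forall x t, box rho0 x t ->
  c <= dot (cross (Fx x t) (Ft x t)) (cross (Fx x t) (Ft x t)).

Let C0 : 0 < C := lt_le_trans ltr01 C1.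

Let Fv v := F (v 0 0) (v 0 1).
Let inbox v := box rho0 (v 0 0) (v 0 1).
Let Dv z d := d 0 0 *: Fx (z 0 0) (z 0 1) + d 0 1 *: Ft (z 0 0) (z 0 1).

Lemma inbox_convex z d (s : R) : inbox z -> inbox (z + d) -> 0 <= s <= 1 -> inbox (z + s *: d).
Proof.
move=> [z1 z2] []; rewrite !mxE => d1 d2 /andP[s0 s1].
have h (a b : R) : `|a| <= rho0 -> `|a + b| <= rho0 -> `|a + s * b| <= rho0.
  rewrite !ler_norml => /andP[a1 a2] /andP[b1 b2]; apply/andP; split; nra.
by split; rewrite !mxE; exact: h.
Qed.

Lemma inbox_taxi z d : inbox z -> inbox (z + d) -> taxi d <= 1.
Proof.
move=> [z1 z2] []; rewrite !mxE => d1 d2; rewrite /taxi.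
have h (a b : R) : `|a| <= rho0 -> `|a + b| <= rho0 -> `|b| <= 2 * rho0.
  by rewrite !ler_norml => /andP[a1 a2] /andP[b1 b2]; apply/andP; split; lra.
by have := h _ _ z1 d1; have := h _ _ z2 d2; move: r4; lra.
Qed.

(** Along a short segment the velocity differs from its initial value by [O(taxi d)]. *)
Lemma speed_segment z d (s t : R) : inbox z -> inbox (z + d) -> 0 <= s -> s <= t -> t <= 1 ->
  enorm (Fv (z + t *: d) - Fv (z + s *: d)) <= (t - s) * (enorm (Dv z d) + 3 * C * taxi d ^+ 2).
Proof.
move=> zb zdb s0 st t1; have C0' := ltW C0.
have s01 : 0 <= s <= 1 by rewrite s0 (le_trans st).
have t01 : 0 <= t <= 1 by rewrite t1 (le_trans s0).
have wb := inbox_convex zb zdb s01; have wb' := inbox_convex zb zdb t01.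
have d1 := inbox_taxi zb zdb; have d0 := taxi_ge0 d.
set w := z + s *: d in wb *; set w' := z + t *: d in wb' *.
have dw k : w' 0 k - w 0 k = (t - s) * d 0 k by rewrite !mxE; ring.
have ts : 0 <= t - s <= 1 by rewrite subr_ge0 st lerBlDr (le_trans t1)// lerDl.
have /andP[ts0 ts1] := ts.
have dE : `|w' 0 0 - w 0 0| + `|w' 0 1 - w 0 1| = (t - s) * taxi d.
  by rewrite !dw !normrM ger0_norm// -mulrDr.
have tay := jet_taylor1 j wb wb' C0'; rewrite dE in tay.
have {}tay := tay (le_trans (ler_piMl d0 ts1) d1).
pose D := Dv w d; pose E := Fv w' - Fv w - (t - s) *: D.
have EB : enorm E <= 2 * C * ((t - s) * taxi d) ^+ 2.
  rewrite (_ : E = Fv w' - Fv w - ((w' 0 0 - w 0 0) *: Fx (w 0 0) (w 0 1) +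
      (w' 0 1 - w 0 1) *: Ft (w 0 0) (w 0 1)))//.
  by rewrite !dw /E /D /Dv scalerDr !scalerA.
have wz k : `|w 0 k - z 0 k| <= `|d 0 k|.
  rewrite !mxE addrC addKr normrM ler_piMl//; case/andP: s01 => _.
  by rewrite ger0_norm.
have wzB : `|w 0 0 - z 0 0| + `|w 0 1 - z 0 1| <= taxi d by apply: lerD.
have DB : enorm (D - Dv z d) <= C * taxi d ^+ 2.
  have -> : D - Dv z d = d 0 0 *: (Fx (w 0 0) (w 0 1) - Fx (z 0 0) (z 0 1)) +
      d 0 1 *: (Ft (w 0 0) (w 0 1) - Ft (z 0 0) (z 0 1)).
    by rewrite /D /Dv !scalerBr opprD addrACA.
  apply: le_trans (ler_enormD _ _) _; rewrite !enormZ.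
  have [_ xl] := jet_x j; have [_ tl] := jet_t j.
  have hx := le_trans (xl _ _ _ _ zb wb) (ler_wpM2l C0' wzB).
  have ht := le_trans (tl _ _ _ _ zb wb) (ler_wpM2l C0' wzB).
  apply: le_trans (lerD (ler_wpM2l (normr_ge0 (d 0 0)) hx) (ler_wpM2l (normr_ge0 (d 0 1)) ht)) _.
  by rewrite -mulrDl -/(taxi d) expr2 mulrCA.
have DB' : enorm D <= enorm (Dv z d) + C * taxi d ^+ 2.
  have := ler_enormD (D - Dv z d) (Dv z d); rewrite subrK => h; apply: le_trans h _.
  by rewrite addrC lerD2l.
have -> : Fv w' - Fv w = (t - s) *: D + E by rewrite (addrC _ E) /E subrK.
apply: le_trans (ler_enormD _ _) _; rewrite enormZ ger0_norm//.
have l1 := ler_wpM2l ts0 DB'.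
have l2 : 2 * C * ((t - s) * taxi d) ^+ 2 <= (t - s) * (2 * C * taxi d ^+ 2).
  rewrite exprMn mulrCA ler_wpM2r ?mulr_ge0 ?exprn_ge0//.
  by rewrite expr2 ler_piMl.
move: (enorm D) (enorm E) (enorm (Dv z d)) (taxi d ^+ 2) l1 l2 EB.
move: (((t - s) * taxi d) ^+ 2) (t - s) => a1 a2 a3 a4 a5 a6 h1 h2 h3.
by lra.
Qed.

(** A lower bound of the first fundamental form, from the area of the tangent parallelogram. *)
Let c1 := Num.sqrt c / (2 * C).

Lemma c1_gt0 : 0 < c1.
Proof. by rewrite divr_gt0 ?sqrtr_gt0// mulr_gt0. Qed.

Lemma speed_lower z d : inbox z -> c1 * taxi d <= enorm (Dv z d).
Proof.
move=> zb; have [[xb _] [tb _]] := (jet_x j, jet_t j).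
set X := Fx (z 0 0) (z 0 1); set T := Ft (z 0 0) (z 0 1).
have XB : enorm X <= C := xb _ _ zb; have TB : enorm T <= C := tb _ _ zb.
have cB : Num.sqrt c <= enorm (cross X T).
  rewrite -(@ler_pXn2r _ 2)// ?nnegrE ?sqrtr_ge0 ?enorm_ge0// sqr_sqrtr ?(ltW c0)//.
  by rewrite sqr_enormE; exact: gram.
set w := Dv z d.
have ht : Num.sqrt c * `|d 0 1| <= C * enorm w.
  apply: le_trans (_ : enorm (cross X w) <= _); last first.
    by apply: le_trans (enorm_cross _ _) _; rewrite ler_wpM2r ?enorm_ge0.
  have -> : cross X w = d 0 1 *: cross X T.
    exact: cross_combr.
  by rewrite enormZ mulrC ler_wpM2l.
have hx : Num.sqrt c * `|d 0 0| <= C * enorm w.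
  apply: le_trans (_ : enorm (cross w T) <= _); last first.
    by apply: le_trans (enorm_cross _ _) _; rewrite mulrC ler_wpM2r ?enorm_ge0.
  have -> : cross w T = d 0 0 *: cross X T.
    exact: cross_combl.
  by rewrite enormZ mulrC ler_wpM2l.
rewrite /c1 mulrAC ler_pdivrMr ?mulr_gt0// /taxi mulrDr.
apply: le_trans (lerD hx ht) _.
by rewrite (_ : enorm w * (2 * C) = C * enorm w + C * enorm w)//; ring.
Qed.

Variable rho : R.
Hypotheses (rho_gt0 : 0 < rho) (rho_le : rho <= rho0) (rho_small : 16 * C * rho <= c1).

Let s := disc_map F rho.
Let dn v : disc R := ret (rho^-1 *: v).

Lemma patchE p : s p = Fv (rho *: val p).
Proof. by rewrite /s /disc_map /Fv !mxE. Qed.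

Lemma inbox_disc v : enorm v <= rho -> inbox v.
Proof. by move=> v1; split; apply: le_trans (ler_coord_enorm _ _) (le_trans v1 rho_le). Qed.

Lemma val_dn v : enorm v <= rho -> val (dn v) = rho^-1 *: v.
Proof.
move=> v1; rewrite val_ret_id// enormZ ger0_norm ?invr_ge0 ?(ltW rho_gt0)//.
by rewrite mulrC ler_pdivrMr// mul1r.
Qed.

Lemma patch_dn v : enorm v <= rho -> s (dn v) = Fv v.
Proof. by move=> v1; rewrite patchE val_dn// scalerA divff ?gt_eqF// scale1r. Qed.

Lemma scale_disc (p : disc R) : enorm (rho *: val p) <= rho.
Proof. by rewrite enormZ gtr0_norm// ler_piMr ?(ltW rho_gt0)// enorm_disc. Qed.

Lemma dnK (p : disc R) : dn (rho *: val p) = p.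
Proof. by rewrite /dn scalerA mulVf ?gt_eqF// scale1r retK. Qed.

Lemma enorm_convex (r : R) (a b : point) (u : R) : enorm a <= r -> enorm b <= r -> 0 <= u <= 1 ->
  enorm (a + u *: (b - a)) <= r.
Proof.
move=> ar br /andP[u0 u1].
have -> : a + u *: (b - a) = (1 - u) *: a + u *: b.
  by apply/rowP => k; rewrite !mxE; ring.
apply: le_trans (ler_enormD _ _) _; rewrite !enormZ !ger0_norm ?subr_ge0//.
have l1 := ler_wpM2l (_ : 0 <= 1 - u) ar; have l2 := ler_wpM2l u0 br.
by have {}l1 := l1 ltac:(by rewrite subr_ge0); move: l1 l2; lra.
Qed.

Lemma dist_piece z d (a b : R) : inbox z -> inbox (z + d) -> 0 <= a -> a <= b -> b <= 1 ->
  enorm (z + a *: d) <= rho -> enorm (z + b *: d) <= rho ->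
  (length_dist s (dn (z + a *: d)%R) (dn (z + b *: d)%R) <=
    ((b - a) * (enorm (Dv z d) + 3 * C * taxi d ^+ 2))%:E)%E.
Proof.
move=> zb zdb a0 ab b1 ar br; apply: length_dist_lip => u t u0 ut t1.
have on (r : R) : 0 <= r <= 1 -> s (ret (val (dn (z + a *: d)) +
    r *: (val (dn (z + b *: d)) - val (dn (z + a *: d))))) = Fv (z + (a + r * (b - a)) *: d).
  move=> r01; have E : z + (a + r * (b - a)) *: d = (z + a *: d) + r *: ((z + b *: d) - (z + a *: d)).
    by apply/rowP => k; rewrite !mxE; ring.
  have nr : enorm (z + (a + r * (b - a)) *: d) <= rho by rewrite E; exact: enorm_convex.
  rewrite -(patch_dn nr) E !val_dn//; congr (s (ret _)).
  by rewrite -scalerBr scalerA mulrC -scalerA -scalerDr.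
rewrite !on ?u0 ?t1 ?(le_trans u0 ut) ?(le_trans ut t1)// enorm_distC.
have ba : 0 <= b - a by rewrite subr_ge0.
have -> : (b - a) * (enorm (Dv z d) + 3 * C * taxi d ^+ 2) * (t - u) =
    (a + t * (b - a) - (a + u * (b - a))) * (enorm (Dv z d) + 3 * C * taxi d ^+ 2) by ring.
apply: speed_segment => //.
- by rewrite addr_ge0// mulr_ge0.
- by rewrite lerD2l ler_wpM2r.
- by apply: le_trans b1; rewrite -lerBrDl ler_piMl.
Qed.

Let dl (p q : disc R) : point := rho *: (val q - val p).

Lemma add_dl p q : rho *: val p + dl p q = rho *: val q.
Proof. by rewrite /dl -scalerDr addrC subrK. Qed.

Lemma dist_patch p q :
  (length_dist s p q <= (enorm (Dv (rho *: val p) (dl p q)) + 3 * C * taxi (dl p q) ^+ 2)%:E)%E.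
Proof.
have := @dist_piece (rho *: val p) (dl p q) 0 1.
rewrite scale0r scale1r addr0 subr0 mul1r add_dl !dnK.
by apply; rewrite ?lexx ?ler01// ?scale_disc//; apply: inbox_disc; exact: scale_disc.
Qed.

Lemma taxi_dl p q : taxi (dl p q) <= 2 * rho * enorm (val p - val q).
Proof.
apply: le_trans (taxi_le_enorm _) _; rewrite enormZ gtr0_norm//.
by rewrite enorm_distC mulrA.
Qed.

Lemma taxi_dl1 p q : taxi (dl p q) <= 1.
Proof.
apply: (@inbox_taxi (rho *: val p)); rewrite ?add_dl; apply: inbox_disc; exact: scale_disc.
Qed.

Lemma enorm_dl p q : rho * enorm (val p - val q) <= taxi (dl p q).
Proof.
by apply: le_trans (enorm_le_taxi _); rewrite enormZ gtr0_norm// enorm_distC.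
Qed.

Lemma chord_patch p q :
  enorm (s q - s p - Dv (rho *: val p) (dl p q)) <= 2 * C * taxi (dl p q) ^+ 2.
Proof.
have zb := inbox_disc (scale_disc p); have zb' := inbox_disc (scale_disc q).
have e k : (rho *: val q) 0 k - (rho *: val p) 0 k = dl p q 0 k by rewrite !mxE; ring.
have := jet_taylor1 j zb zb' (ltW C0); rewrite !e => /(_ (taxi_dl1 p q)).
by rewrite !patchE.
Qed.

Lemma patch_length_lip p q : (length_dist s p q <= (8 * C * rho * enorm (val p - val q))%:E)%E.
Proof.
apply: le_trans (dist_patch p q) _; rewrite lee_fin.
have DB := enorm_diff_le (dl p q 0 0) (dl p q 0 1) (jet_x j) (jet_t j) (inbox_disc (scale_disc p)).
have T0 := taxi_ge0 (dl p q).
have T2 : C * taxi (dl p q) ^+ 2 <= C * taxi (dl p q).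
  by rewrite ler_pM2l// expr2 ler_piMl// taxi_dl1.
have T1 := ler_wpM2l (ltW C0) (taxi_dl p q).
rewrite -/(Dv _ _) -/(taxi _) in DB.
move: DB T2 T1; move: (taxi _) (taxi _ ^+ 2) (enorm (Dv _ _)) (enorm (_ - _)) => a b e f h1 h2 h3.
by lra.
Qed.

Lemma patch_lower_taxi p q : c1 / 2 * taxi (dl p q) <= enorm (s q - s p).
Proof.
have h1 := speed_lower (dl p q) (inbox_disc (scale_disc p)).
have h2 := chord_patch p q; have T0 := taxi_ge0 (dl p q).
have h3 := ler_enorm_dist (Dv (rho *: val p) (dl p q)) (s q - s p).
rewrite (enorm_distC (Dv _ _)) in h3.
have h4 : 2 * C * taxi (dl p q) ^+ 2 <= c1 / 2 * taxi (dl p q).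
  rewrite expr2 mulrA ler_wpM2r//.
  apply: le_trans (_ : 2 * C * (4 * rho) <= _).
    rewrite ler_pM2l ?mulr_gt0//; apply: le_trans (taxi_dl p q) _.
    have : enorm (val p - val q) <= 2.
      by apply: le_trans (ler_enormB _ _) _; have := enorm_disc p; have := enorm_disc q; lra.
    by move=> h; rewrite (_ : 4 * rho = 2 * rho * 2); [rewrite ler_pM2l ?mulr_gt0|ring].
  by move: rho_small; lra.
have h6 := ler_norm (enorm (Dv (rho *: val p) (dl p q)) - enorm (s q - s p)).
move: h1 h2 h3 h4 h6.
move: (taxi _) (taxi _ ^+ 2) (enorm (_ - _ - _)) => a b e.
move: (enorm (s q - s p)) (enorm (Dv _ _)) => g h; move: `|h - g| => f.
by lra.
Qed.

Lemma patch_lower p q : c1 * rho / 2 * enorm (val p - val q) <= enorm (s p - s q).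
Proof.
rewrite (enorm_distC (s p)); apply: le_trans (patch_lower_taxi p q).
rewrite (mulrAC c1 rho) -(mulrA (c1 / 2)) ler_pM2l ?enorm_dl//; exact: divr_gt0 c1_gt0 (ltr0Sn R 1).
Qed.

(** The excess of the length over the chord is quadratic in the distance, while the chord is
    bounded below linearly. *)
Lemma patch_almost_chord (e : R) : 0 < e -> exists2 d : R, 0 < d & forall p q,
  enorm (val p - val q) < d -> (length_dist s p q <= ((1 + e) * enorm (s p - s q))%:E)%E.
Proof.
move=> e0; have K0 : 0 < 20 * C * rho := mulr_gt0 (mulr_gt0 (ltr0Sn R 19) C0) rho_gt0.
exists (e * c1 / (20 * C * rho)); first exact: divr_gt0 (mulr_gt0 e0 c1_gt0) K0.
move=> p q; rewrite ltr_pdivlMr// => pq.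
apply: le_trans (dist_patch p q) _; rewrite lee_fin.
have h1 := speed_lower (dl p q) (inbox_disc (scale_disc p)).
have h2 := chord_patch p q; have T0 := taxi_ge0 (dl p q).
have h3 := ler_enorm_dist (Dv (rho *: val p) (dl p q)) (s q - s p).
rewrite (enorm_distC (Dv _ _)) in h3.
have h4 := ler_norm (enorm (Dv (rho *: val p) (dl p q)) - enorm (s q - s p)).
have T2 : 10 * C * taxi (dl p q) ^+ 2 <= e * c1 * taxi (dl p q).
  rewrite expr2 mulrA ler_wpM2r//; apply: le_trans (ltW pq).
  apply: le_trans (ler_wpM2l _ (taxi_dl p q)) _; first by rewrite mulr_ge0// ltW.
  by rewrite (_ : 10 * C * (2 * rho * enorm (val p - val q)) =
    enorm (val p - val q) * (20 * C * rho)); last by ring.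
have h5 := patch_lower_taxi p q.
have h6 := ler_wpM2l (ltW e0) h5.
rewrite (enorm_distC (s p)).
move: h1 h2 h3 h4 h5 h6 T2; move: (taxi _) (taxi _ ^+ 2) (enorm (_ - _ - _)) => a b e'.
move: (enorm (s q - s p)) (enorm (Dv _ _)) => g h; move: `|h - g| => f.
move=> _ h2 h3 h4 _ h6 h7.
by lra.
Qed.

Lemma patch_continuous : continuous s.
Proof.
have L0 : 0 <= 8 * C * rho.
  exact: ltW (mulr_gt0 (mulr_gt0 (ltr0Sn R 7) C0) rho_gt0).
have lip a b : enorm (s (ret a) - s (ret b)) <= 8 * C * rho * (2 * enorm (a - b)).
  apply: le_trans (s_lip patch_length_lip _ _) _.
  by rewrite ler_wpM2l// ret_lip.
have cr : continuous (fun v : point => s (ret v)).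
  apply: (@lip_continuous _ _ _ _ (8 * C * rho * 4)) => a b.
  apply: le_trans (norm_le_enorm _) _; apply: le_trans (lip a b) _.
  rewrite -!mulrA; do 3 (rewrite ler_pM2l//).
  have := enorm_le_norm (a - b); move: (enorm _) `|_ - _| => x y; lra.
move=> p; have -> : s = (fun v => s (ret v)) \o (fun q : disc R => val q).
  by apply/funext => q /=; rewrite retK.
by apply: continuous_comp; [exact: continuous_val|exact: cr].
Qed.

Lemma patch_injective : injective s.
Proof.
move=> p q pq; apply: val_inj; apply/eqP; rewrite -subr_eq0 -enorm_eq0 eq_le enorm_ge0 andbT.
have := patch_lower p q; rewrite pq subrr enorm0 pmulr_rle0//.
by rewrite divr_gt0// mulr_gt0// c1_gt0.
Qed.

Lemma enorm_circle_point (a b : R) :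
  enorm (val (val (circle_point a)) - val (val (circle_point b))) <= 2 * `|b - a|.
Proof.
wlog ab : a b / a <= b => [h|].
  by case: (leP a b) => [/h//|/ltW/h]; rewrite enorm_distC distrC.
rewrite enorm_distC; apply: le_trans (enorm_le_taxi _) _; rewrite /taxi !mxE /=.
have [x _ ->] := @MVT_segment R cos (fun r : R => - sin r) a b ab (fun (r : R) _ => is_derive_cos r) (continuous_subspaceT (@continuous_cos R)).
have [y _ ->] := @MVT_segment R sin (fun r : R => cos r) a b ab (fun (r : R) _ => is_derive_sin r) (continuous_subspaceT (@continuous_sin R)).
rewrite !normrM normrN -mulrDl ler_wpM2r//.
by have := cos_max y; have := sin_max x; move: `|sin x| `|cos y| => u v; lra.
Qed.

Lemma patch_rectifiable : bdry_rectifiable s.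
Proof.
apply: le_lt_trans (_ : (8 * C * rho * 2 * (2 * pi - 0))%:E < +oo)%E; last by rewrite ltry.
apply: curve_length_lip => a b _ ab _.
rewrite /= /bdry_curve space_dist_proj; apply: le_trans (patch_length_lip _ _) _.
rewrite lee_fin -(mulrA (8 * C * rho)) ler_wpM2l//.
  exact: ltW (mulr_gt0 (mulr_gt0 (ltr0Sn R 7) C0) rho_gt0).
by apply: le_trans (enorm_circle_point a b) _; rewrite ger0_norm// subr_ge0.
Qed.

Variable W : disc R -> 'rV[R]_3.
Hypothesis W_short : forall p q, ((enorm (W p - W q))%:E <= length_dist s p q)%E.
Hypothesis W_bdry : forall p : disc R, enorm (val p) = 1 -> W p = s p.

(** The competitor: [W] inside the disc, and the surface outside. *)
Let Gv v := if enorm v <= rho then W (dn v) else Fv v.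

Lemma GvF v : rho <= enorm v -> Gv v = Fv v.
Proof.
rewrite /Gv; case: ifP => // v1 v2; have ve : enorm v = rho by apply/eqP; rewrite eq_le v1.
rewrite W_bdry ?patch_dn// val_dn// enormZ ve ger0_norm ?mulVf ?gt_eqF//.
by rewrite invr_ge0 ltW.
Qed.

Lemma G_piece z d (a b : R) : inbox z -> inbox (z + d) -> 0 <= a -> a <= b -> b <= 1 ->
  (enorm (z + a *: d) <= rho /\ enorm (z + b *: d) <= rho) \/
  (rho <= enorm (z + a *: d) /\ rho <= enorm (z + b *: d)) ->
  enorm (Gv (z + b *: d) - Gv (z + a *: d)) <= (b - a) * (enorm (Dv z d) + 3 * C * taxi d ^+ 2).
Proof.
move=> zb zdb a0 ab b1 [[ar br]|[ar br]].
  rewrite /Gv ar br -lee_fin enorm_distC; apply: le_trans (W_short _ _) _.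
  exact: dist_piece.
by rewrite !GvF//; exact: speed_segment.
Qed.

(** A segment that leaves or enters the disc is cut where it crosses the circle. *)
Lemma G_short z d : inbox z -> inbox (z + d) ->
  enorm (Gv (z + d) - Gv z) <= enorm (Dv z d) + 3 * C * taxi d ^+ 2.
Proof.
move=> zb zdb; set B := (X in _ <= X).
have piece := G_piece zb zdb; rewrite -/B in piece.
pose phi (t : R) := enorm (z + t *: d).
have cphi : {within `[0, 1], continuous phi}.
  apply: continuous_subspaceT; apply: (@lip_continuous R R R phi (enorm d)) => a b.
  apply: le_trans (ler_enorm_dist _ _) _.
  rewrite opprD addrACA subrr add0r -scalerBl enormZ mulrC; exact: lexx.
have [e0 e1] : z + 0 *: d = z /\ z + 1 *: d = z + d by rewrite scale0r scale1r addr0.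
have cut : (phi 0 <= rho <= phi 1) || (phi 1 <= rho <= phi 0) -> enorm (Gv (z + d) - Gv z) <= B.
  move=> sides; have [t] : exists2 t, t \in `[0, 1] & phi t = rho.
    apply: IVT => //; rewrite ge_min le_max.
    by case/orP: sides => /andP[-> ->]; rewrite ?orbT.
  rewrite in_itv/= => /andP[t0 t1] ht.
  have h1 : enorm (Gv (z + t *: d) - Gv (z + 0 *: d)) <= (t - 0) * B.
    apply: piece => //; rewrite -/(phi t) ht -/(phi 0).
    by case/orP: sides => /andP[s1 s2]; [left|right].
  have h2 : enorm (Gv (z + 1 *: d) - Gv (z + t *: d)) <= (1 - t) * B.
    apply: piece => //; rewrite -/(phi t) ht -/(phi 1).
    by case/orP: sides => /andP[s1 s2]; [right|left].
  rewrite e0 in h1; rewrite e1 in h2.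
  apply: le_trans (enorm_distD (Gv (z + t *: d)) _ _) _.
  by move: h1 h2; move: (enorm _) (enorm _) => u v; lra.
have [p0|p0] := leP (phi 0) rho; have [p1|p1] := leP (phi 1) rho.
- by have := piece 0 1 (lexx _) ler01 (lexx _) (or_introl (conj p0 p1)); rewrite e0 e1 subr0 mul1r.
- by apply: cut; rewrite p0 ltW.
- by apply: cut; rewrite p1 orbC ltW.
- have := piece 0 1 (lexx _) ler01 (lexx _) (or_intror (conj (ltW p0) (ltW p1))).
  by rewrite e0 e1 subr0 mul1r.
Qed.

Definition vec (x t : R) : point := \row_k (if k == 0 then x else t).

Definition glued (x t : R) : 'rV[R]_3 := Gv (vec x t).

Lemma glued_short : short_for Fx Ft rho0 (3 * C) glued.
Proof.
move=> x t x' t' b b'; rewrite /glued.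
have E : vec x' t' = vec x t + vec (x' - x) (t' - t).
  by apply/rowP => k; rewrite !mxE; case: ifP => _; ring.
have := @G_short (vec x t) (vec (x' - x) (t' - t)); rewrite -E /Dv /taxi !mxE /=; apply.
  by rewrite /inbox !mxE.
by rewrite /inbox !mxE.
Qed.

Lemma glued_out x t : rho ^+ 2 <= x ^+ 2 + t ^+ 2 -> glued x t = F x t.
Proof.
move=> h; rewrite /glued GvF ?/Fv ?mxE//.
rewrite -(@ler_pXn2r _ 2)// ?nnegrE ?enorm_ge0 ?(ltW rho_gt0)//.
rewrite sqr_enorm !big_ord_recl big_ord0 addr0 !mxE /=; exact: h.
Qed.

Lemma glued_in (p : disc R) : glued (rho * val p 0 0) (rho * val p 0 1) = W p.
Proof.
have E : vec (rho * val p 0 0) (rho * val p 0 1) = rho *: val p.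
  apply/rowP => -[[|[|//]] k2]; rewrite !mxE /=; congr (_ * val p _ _); exact: val_inj.
by rewrite /glued E /Gv scale_disc dnK.
Qed.

End patch.

(** * Small saddle discs are metric-minimizing *)

Local Open Scope quotient_scope.

Section minimizing.
Context {R : realType}.

Lemma asymptotic_mono Fx Ft Fxx Fxt Ftt (rho C C' : R) mu : C <= C' ->
  asymptotic Fx Ft Fxx Fxt Ftt rho C mu -> asymptotic Fx Ft Fxx Fxt Ftt rho C' mu.
Proof.
move=> CC [small lip eq]; split=> // x t x' t' b b'; apply: le_trans (lip _ _ _ _ b b') _.
by rewrite ler_wpM2r ?addr_ge0.
Qed.

Lemma proj_repr (s : disc R -> 'rV[R]_3) (a : length_space s) :
  length_proj s (repr (a : {eq_quot indist_equiv s})) = a.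
Proof. exact: reprK. Qed.

(** With [M] representing the majorization, [s' \o M] is a competitor that does not increase
    lengths; rigidity identifies it with [s], and then there are no shortcuts for [s'] between
    points of the image of [M]. *)
Theorem patch_minimizing (F Fx Ft Fxx Fxt Ftt : R -> R -> 'rV[R]_3) (mu nu : R -> R -> R)
    (rho0 C c : R) :
  jet2 F Fx Ft Fxx Fxt Ftt rho0 C -> asymptotic Fx Ft Fxx Fxt Ftt rho0 C mu ->
  asymptotic (swap Ft) (swap Fx) (swap Ftt) (swap Fxt) (swap Fxx) rho0 C (swap nu) ->
  1 <= C -> 0 < c -> 0 < rho0 -> rho0 <= 4^-1 ->
  (forall x t, box rho0 x t ->
    c <= dot (cross (Fx x t) (Ft x t)) (cross (Fx x t) (Ft x t))) ->
  exists2 r0 : R, 0 < r0 & forall rho, 0 < rho -> rho <= r0 ->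
    metric_minimizing_disc (disc_map F rho) /\ injective (disc_map F rho).
Proof.
move=> j amu anu C1 c0 rho00 r4 gram.
have C0 : 0 < C := lt_le_trans ltr01 C1.
have C3 : C <= 3 * C by rewrite ler_peMl ?(ltW C0)// ler1n.
have [r1 r10 rigid] := energy_rigidity (jet2_mono (lexx rho0) C3 j) (asymptotic_mono C3 amu)
  (asymptotic_mono C3 anu) (le_trans C1 C3) c0 rho00 r4 gram.
pose c1 := Num.sqrt c / (2 * C).
have c10 : 0 < c1 by rewrite divr_gt0 ?sqrtr_gt0// mulr_gt0.
have K0 : 0 < 16 * C := mulr_gt0 (ltr0Sn R 15) C0.
exists (Num.min (Num.min r1 rho0) (c1 / (16 * C))).
  by rewrite !lt_min r10 rho00 divr_gt0.
move=> rho rho_gt0; rewrite !le_min -andbA => /and3P[rr1 rle].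
rewrite ler_pdivlMr// mulrC => rsmall.
have lip := patch_length_lip j C1 r4 rho_gt0 rle.
have low := patch_lower j C1 c0 r4 gram rho_gt0 rle rsmall.
have loc := patch_almost_chord j C1 c0 r4 gram rho_gt0 rle rsmall.
split; last exact: (patch_injective j C1 c0 r4 gram rho_gt0 rle rsmall).
split; first exact: (patch_continuous j C1 r4 rho_gt0 rle).
  exact: (patch_rectifiable j C1 r4 rho_gt0 rle).
set s := disc_map F rho in lip low loc *.
move=> s' cs' bd m [short mbd].
pose M (p : disc R) : disc R := repr (m (length_proj s p) : {eq_quot indist_equiv s'}).
have M1 p q : (length_dist s' (M p) (M q) <= length_dist s p q)%E.
  by rewrite -(space_dist_proj s); exact: short.
have M3 (p : disc R) : enorm (val p) = 1 -> length_dist s' (M p) p = 0%E.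
  move=> p1; pose x : circle R := exist _ p (mem_set p1).
  have mx : m (length_proj s p) = length_proj s' p.
    by have := congr1 (fun f => f x) mbd; rewrite /bdry_curve /= => ->.
  rewrite -space_dist_proj (_ : length_proj s' (M p) = length_proj s' p).
    by rewrite space_dist_proj length_distxx.
  by rewrite /M proj_repr mx.
have W_bdry p : enorm (val p) = 1 -> s' (M p) = s p.
  move=> p1; rewrite (bd (exist _ p (mem_set p1) : circle R)) /=.
  have := dist_le_length_dist s' (M p) p; rewrite (M3 _ p1) lee_fin => h.
  by apply/eqP; rewrite -subr_eq0 -enorm_eq0 eq_le enorm_ge0 andbT.
have W_short p q : ((enorm (s' (M p) - s' (M q)))%:E <= length_dist s p q)%E.
  by apply: le_trans (M1 p q); exact: dist_le_length_dist.
have M2 p : s' (M p) = s p.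
  have := rigid rho rho_gt0 rr1 (glued F rho (s' \o M)).
  move=> /(_ (fun x t h _ => glued_out rho_gt0 W_bdry h)).
  move=> /(_ (glued_short j C1 r4 rho_gt0 W_short W_bdry)).
  move=> /(_ (rho * val p 0 0) (rho * val p 0 1)).
  rewrite glued_in// => h; apply: h.
  - by rewrite normrM gtr0_norm// ler_piMr ?(ltW rho_gt0)// (le_trans (ler_coord_enorm _ _))// enorm_disc.
  - by rewrite normrM gtr0_norm// ler_piMr ?(ltW rho_gt0)// (le_trans (ler_coord_enorm _ _))// enorm_disc.
have CL : 0 < 8 * C * rho := mulr_gt0 (mulr_gt0 (ltr0Sn R 7) C0) rho_gt0.
have cL : 0 < c1 * rho / 2 by rewrite divr_gt0// mulr_gt0.
move=> a a'; apply/eqP; rewrite eq_le short /=.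
rewrite -(proj_repr a) -(proj_repr a') space_dist_proj.
have H := no_shortcut CL cL cs' lip low loc.
exact: (H M _ _ M1 M2 M3).
Qed.

End minimizing.

(** * Saddle surfaces *)

(** By Cramer's rule the coordinates in a basis are Lipschitz. *)
Lemma near_coordinates (R : realType) (e1 e2 u0 : 'rV[R]_2) (rho : R) : 0 < rho ->
  (forall a b : R, a *: e1 + b *: e2 = 0 -> a = 0 /\ b = 0) ->
  \forall w \near u0, exists x t : R, x ^+ 2 + t ^+ 2 <= rho ^+ 2 /\ w = u0 + (x *: e1 + t *: e2).
Proof.
move=> rho0 indep; pose d := e1 0 0 * e2 0 1 - e1 0 1 * e2 0 0.
have rowP2 (a b : 'rV[R]_2) : a 0 0 = b 0 0 -> a 0 1 = b 0 1 -> a = b.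
  move=> h0 h1; apply/rowP => -[[|[|//]] k2].
    by rewrite (_ : Ordinal k2 = 0)//; exact: val_inj.
  by rewrite (_ : Ordinal k2 = 1)//; exact: val_inj.
have d0 : d != 0.
  apply/eqP => d0.
  have [a1 b1] : e2 0 0 = 0 /\ - e1 0 0 = 0.
    by apply: indep; apply: rowP2; rewrite !mxE; move: d0; rewrite /d; lra.
  have [a2 b2] : e2 0 1 = 0 /\ - e1 0 1 = 0.
    by apply: indep; apply: rowP2; rewrite !mxE; move: d0; rewrite /d; lra.
  have [] : (1 : R) = 0 /\ (1 : R) = 0.
    by apply: indep; apply: rowP2; rewrite !mxE; move: a1 b1 a2 b2; lra.
  by move/eqP; rewrite oner_eq0.
pose K := (`|e1 0 0| + `|e1 0 1| + `|e2 0 0| + `|e2 0 1|) / `|d| + 1.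
have K0 : 0 < K by rewrite ltr_wpDl// divr_ge0// !addr_ge0.
apply/nbhs_ballP; exists (rho / K) => /=; first exact: divr_gt0.
move=> w; rewrite -ball_normE /= distrC ltr_pdivlMr// => wr.
pose v := w - u0; rewrite -/v in wr.
exists ((v 0 0 * e2 0 1 - v 0 1 * e2 0 0) / d), ((e1 0 0 * v 0 1 - e1 0 1 * v 0 0) / d).
split; last first.
  have -> : w = u0 + v by rewrite /v addrC subrK.
  by congr (u0 + _); apply: rowP2; rewrite !mxE /d; field.
set x := (X in X ^+ 2 + _ <= _); set t := (X in _ + X ^+ 2 <= _).
have v0 := ler_coord_norm v 0; have v1 := ler_coord_norm v 1.
have xt : `|x| + `|t| <= rho.
  apply: le_trans (ltW wr); apply: (@le_trans _ _ (`|v| * (K - 1))); last first.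
    by rewrite ler_wpM2l// gerBl.
  rewrite /x /t !normrM !normfV -mulrDl /K addrK mulrA ler_wpM2r ?invr_ge0//.
  have b a (h : `|a| <= `|v|) (p : R) : `|a * p| <= `|v| * `|p| by rewrite normrM ler_wpM2r.
  have l1 := b _ v0 (e2 0 1); have l2 := b _ v1 (e2 0 0).
  have l3 := b _ v1 (e1 0 0); have l4 := b _ v0 (e1 0 1).
  apply: le_trans (lerD (ler_normB _ _) (ler_normB _ _)) _.
  rewrite (mulrC (e1 0 0)) (mulrC (e1 0 1)) !mulrDr.
  by move: l1 l2 l3 l4; clear; lra.
apply: (@le_trans _ _ ((`|x| + `|t|) ^+ 2)).
  rewrite -(real_normK (num_real x)) -(real_normK (num_real t)) sqrrD.
  have := mulr_ge0 (normr_ge0 x) (normr_ge0 t); clear; lra.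
by rewrite lerXn2r ?nnegrE ?addr_ge0// ltW.
Qed.

Theorem proposition1p2 (R : realType) (Sigma : set 'rV[R]_3) :
  smooth_surface Sigma -> strictly_saddle Sigma ->
  locally_metric_minimizing Sigma.
Proof.
move=> _ saddle p [f [u0 chu]]; have [k1 [k2 [pc1 pc2 k12]]] := saddle _ _ _ chu.
case: chu => U [V [g [ch [Uu _] fu]]].
have oU := chart_open_dom ch; have fs := chart_smooth ch.
have [e1 [e2 [n0 h11 h22 h12 indep]]] :=
  asymptotic_basis oU fs (chart_immersive ch) Uu pc1 pc2 k12.
have [rho1 [C1 [rho10 C11 inU j]]] := jet2_chart e1 e2 oU fs Uu.
have P0 : u0 + (0 *: e1 + 0 *: e2) = u0 by rewrite !scale0r !addr0.
have := asymptotic_exists j C11 rho10; rewrite /= P0 => /(_ n0 h11 h22 h12).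
move=> [rho2 [C2 [c [mu [nu [[rho20 rho21 rho24 C12 c0] j2 amu anu gram]]]]]].
have [r0 r00 mini] := patch_minimizing j2 amu anu (le_trans C11 C12) c0 rho20 rho24 gram.
pose rho := Num.min r0 rho2.
have rho0 : 0 < rho by rewrite lt_min r00.
have [rr0 rr2] : rho <= r0 /\ rho <= rho2 by split; rewrite /rho ge_min lexx ?orbT.
have [mm inj] := mini rho rho0 rr0.
eexists; split; [exact: mm|exact: inj| |].
- move=> _ [x _ <-]; rewrite /disc_map /=.
  have bx k : `|rho * val x 0 k| <= rho1.
    apply: le_trans (le_trans rr2 rho21); rewrite normrM gtr0_norm// ler_piMr ?(ltW rho0)//.
    by apply: le_trans (ler_coord_enorm _ _) _; exact: enorm_disc.
  by have [] := chart_to ch (conj (inU _ _ (conj (bx 0) (bx 1))) I).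
- have SVp : (Sigma `&` V) p by rewrite -fu; exact: (chart_to ch (conj Uu I)).
  have gp : g p = u0 by rewrite -fu; exact: (chart_invl ch (conj Uu I)).
  (* near [p] the inverse of the chart takes values in the disc, by continuity *)
  have cg : g @ within (Sigma `&` V) (nbhs p) --> u0.
    rewrite -[u0]gp; have := chart_inv_continuous ch.
    by move=> /subspace_continuousP/(_ _ SVp).
  have near_g := cg _ (near_coordinates u0 rho0 indep).
  have near_V : nbhs p V by apply: open_nbhs_nbhs; split; [exact: chart_open_img ch|case: SVp].
  have {}near_g : \forall q \near p, (Sigma `&` V) q ->
    exists x t : R, x ^+ 2 + t ^+ 2 <= rho ^+ 2 /\ g q = u0 + (x *: e1 + t *: e2) := near_g.
  rewrite /within /=; near=> q => Sq.
  have Vq : V q by near: q.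
  have near_q : (Sigma `&` V) q ->
    exists x t : R, x ^+ 2 + t ^+ 2 <= rho ^+ 2 /\ g q = u0 + (x *: e1 + t *: e2) by near: q.
  have [x [t [xt gq]]] := near_q (conj Sq Vq).
  have vB : enorm (vec x t) <= rho.
    rewrite -(@ler_pXn2r _ 2)// ?nnegrE ?enorm_ge0 ?(ltW rho0)//.
    by rewrite sqr_enorm !big_ord_recl big_ord0 addr0 !mxE /=.
  exists (ret (rho^-1 *: vec x t)) => //; rewrite /disc_map (val_dn rho0 vB).
  rewrite !mxE /= !mulrA divff ?gt_eqF// !mul1r -gq.
  exact: (chart_invr ch).
Unshelve. all: by end_near.
Qed.
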